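(* Let $\pi$ be a non-critical distribution on $\mathbb{N}$ with index $\gamma\in(0,1)$, and let $\{\xi_n:n\ge1\}$ be i.i.d. with common distribution $\pi$. Write $o(1)$ for quantities tending to $0$ as $n\to\infty$. (1) For every $\ell\ge1$, almost surely $$\lim_{n\to\infty}\frac{R_{n,\ell}}{R_n}=r_\ell(\gamma):=\frac{\gamma\,\Gamma(\ell-\gamma)}{\ell!\,\Gamma(1-\gamma)}=\frac{\gamma\prod_{j=1}^{\ell-1}(j-\gamma)}{\ell!},$$ where $r_\ell(\gamma)=\frac{\gamma}{\Gamma(1-\gamma)}\,\ell^{-(1+\gamma)}\,[1+O(1/\ell)]$ as $\ell\to\infty$; equivalently, for every $\ell\ge 1$, almost surely $$\lim_{n\to\infty}\frac{R_{n,\ell}}{R_{n,\ell+}}=\frac{\gamma}{\ell}.$$ Furthermore, for every $\ell\ge1$, $\lim_{n\to\infty}R_{n,\ell}/\mathbb{E}R_{n,\ell}=1$ almost surely, and $$\mathbb{E}R_n=\Gamma(1-\gamma)\,\varphi^{-1}(n)\,[1+o(1)],\qquad \mathbb{E}R_{n,\ell}=\frac{\gamma\,\Gamma(\ell-\gamma)}{\ell!}\,\varphi^{-1}(n)\,[1+o(1)].$$ (2) For each $1\le k\le\ell$, almost surely $$\lim_{n\to\infty}\frac{\widetilde R_{n,k,\ell}}{R_{n,\ell}}=S_{k,\ell}(\pi),\qquad \lim_{n\to\infty}\frac{\widetilde R_{n,k}}{R_n}=f_k(\pi):=\sum_{\ell=k}^\infty r_\ell(\gamma)\,S_{k,\ell}(\pi),$$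 $$\lim_{n\to\infty}\frac{\widetilde R_{n,k,\ell}}{\mathbb{E}\widetilde R_{n,k,\ell}}=1,\qquad \lim_{n\to\infty}\frac{\widetilde R_{n,k}}{\mathbb{E}\widetilde R_{n,k}}=1,$$ and $$\mathbb{E}\widetilde R_{n,k,\ell}=S_{k,\ell}(\pi)\,\frac{\gamma\,\Gamma(\ell-\gamma)}{\ell!}\,\varphi^{-1}(n)\,[1+o(1)],\qquad \mathbb{E}\widetilde R_{n,k}=f_k(\pi)\,\Gamma(1-\gamma)\,\varphi^{-1}(n)\,[1+o(1)].$$ (3) For each $1\le k\le 2\ell$, almost surely $$\lim_{n\to\infty}\frac{\widehat R_{n,k,\ell}}{R_{n,\ell}}=S_{k,2\ell}(\pi),\qquad \lim_{n\to\infty}\frac{\widehat R_{n,k}}{R_n}=\widehat f_k(\pi):=\sum_{\ell=\lfloor (k+1)/2\rfloor}^\infty r_\ell(\gamma)\,S_{k,2\ell}(\pi).$$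
   Context: $\mathbb{N}=\{1,2,\dots\}$. The indices $k,\ell$ are positive integers. Standing assumption on $\pi$: $\pi_1\ge\pi_2\ge\cdots$ and $\pi_n>\pi_{n+1}>0$ for all large $n$. Put $\varphi(x)=1/\pi_x$ for $x\in\mathbb{N}$; $\varphi$ is extended to a continuous function on $[1,\infty)$ which is strictly increasing for large $x$, so that the inverse $\varphi^{-1}(x)$ exists for all large $x$. Non-critical with index $\gamma\in(0,1)$: $\lim_{n\to\infty}\varphi^{-1}(n\lambda)/\varphi^{-1}(n)=\lambda^\gamma$ for all $\lambda\in(0,\infty)$, with a domination allowing dominated convergence: for every $\varepsilon>0$ there are $C,x_0$ with $\varphi^{-1}(n\lambda)/\varphi^{-1}(n)\le C\max(\lambda^{\gamma-\varepsilon},\lambda^{\gamma+\varepsilon})$ whenever $n\ge x_0$ and $n\lambda\ge x_0$. Visiting intensity statistics: $N_n(x)=\sum_{k=1}^n 1_{\{\xi_k=x\}}$, $R_n=\#\{\xi_k:1\le k\le n\}$, $R_{n,\ell}=\sum_x 1_{\{N_n(x)=\ell\}}$, $R_{n,\ell+}=\sum_x 1_{\{N_n(x)\ge\ell\}}$. Out-degree statistics (of the directed graph with vertices $\xi_1,\dots,\xi_n$ and edges $\xi_i\to\xi_{i+1}$, $1\le i\le n-1$): $d_n(x,y)=\sum_{i=1}^{n-1}1_{\{\xi_i=x,\,\xi_{i+1}=y\}}$, $D_n(x)=\sum_y 1_{\{d_n(x,y)\ge1\}}$, $\widetilde R_{n,k,\ell}=\sum_x 1_{\{N_{n-1}(x)=\ell,\,D_n(x)=k\}}$,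 $\widetilde R_{n,k}=\sum_x 1_{\{D_n(x)=k\}}$. Degree statistics (of the induced undirected graph): $\widehat d_n(x,y)=\sum_{i=1}^{n-1}1_{\{(\xi_i,\xi_{i+1})=(x,y)\text{ or }(\xi_i,\xi_{i+1})=(y,x)\}}$, $\widehat D_n(x)=\sum_y 1_{\{\widehat d_n(x,y)\ge1\}}$, $N_x([2,n-1])=\sum_{k=2}^{n-1}1_{\{\xi_k=x\}}$, $\widehat R_{n,k,\ell}=\sum_x 1_{\{N_x([2,n-1])=\ell,\,\widehat D_n(x)=k\}}$, $\widehat R_{n,k}=\sum_x 1_{\{\widehat D_n(x)=k\}}$. $S_{k,\ell}(\pi)=\sum\prod_{j=1}^\ell\pi_{x_j}$, the sum over all ordered tuples $(x_1,\dots,x_\ell)\in\mathbb{N}^\ell$ with $\#\{x_1,\dots,x_\ell\}=k$. *)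

(* Defs.v *)
From HB Require Import structures.
From mathcomp Require Import all_boot all_order all_algebra.
From mathcomp Require Import all_classical all_reals all_analysis.

Set Implicit Arguments.
Unset Strict Implicit.
Unset Printing Implicit Defensive.

Import Order.TTheory GRing.Theory Num.Theory.
Import numFieldNormedType.Exports.

Local Open Scope classical_set_scope.
Local Open Scope ring_scope.

(* The state space is {1, 2, ...}: [posN] inside [nat], where a distribution
   is required to give no mass to 0.  Time is also counted from 1, so the
   value of a path at time 0 is never used. *)
Definition posN : set nat := [set x | (0 < x)%N].

Section Path.
Variable s : nat -> nat.
Local Open Scope nat_scope.

Definition visits (n x : nat) : nat := \sum_(1 <= k < n.+1) (s k == x).

Definition range_size (n : nat) : nat :=
  size (undup [seq s k | k <- index_iota 1 n.+1]).

(* For l >= 1 (resp. k >= 1 below) only finitely many states contribute, so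
   the finite-support sums over the infinite set [posN] are genuine sums. *)
Definition range_eq (n l : nat) : nat :=
  \big[addn/0]_(x \in posN) (visits n x == l).

Definition range_ge (n l : nat) : nat :=
  \big[addn/0]_(x \in posN) (l <= visits n x).

Definition out_edges (n x y : nat) : nat :=
  \sum_(1 <= i < n) ((s i == x) && (s i.+1 == y)).

Definition out_degree (n x : nat) : nat :=
  \big[addn/0]_(y \in posN) (1 <= out_edges n x y).

Definition out_range_visits (n k l : nat) : nat :=
  \big[addn/0]_(x \in posN) ((visits n.-1 x == l) && (out_degree n x == k)).

Definition out_range (n k : nat) : nat :=
  \big[addn/0]_(x \in posN) (out_degree n x == k).

Definition edges (n x y : nat) : nat :=
  \sum_(1 <= i < n) (((s i == x) && (s i.+1 == y)) ||
                     ((s i == y) && (s i.+1 == x))).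

Definition degree (n x : nat) : nat :=
  \big[addn/0]_(y \in posN) (1 <= edges n x y).

Definition inner_visits (n x : nat) : nat := \sum_(2 <= k < n) (s k == x).

Definition deg_range_visits (n k l : nat) : nat :=
  \big[addn/0]_(x \in posN) ((inner_visits n x == l) && (degree n x == k)).

Definition deg_range (n k : nat) : nat :=
  \big[addn/0]_(x \in posN) (degree n x == k).

End Path.

Section Constants.
Context {R : realType}.

(* Used for s > 0 only, where the integral converges. *)
Definition Gamma (s : R) : R :=
  \int[lebesgue_measure]_(t in `]0, +oo[) (t `^ (s - 1) * expR (- t)).

Definition rlim (g : R) (l : nat) : R :=
  g * Gamma (l%:R - g) / (l`!%:R * Gamma (1 - g)).

(* Non-negative (unordered) sums are taken in the extended reals; they are
   finite for a probability mass function [p] and 0 < g < 1. *)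
Definition Ssum (p : nat -> R) (k l : nat) : R :=
  fine (\esum_(x in [set x : l.-tuple nat |
                      (forall j, posN (tnth x j)) /\ size (undup x) = k])
          (\prod_(j < l) p (tnth x j))%:E).

Definition fsum (p : nat -> R) (g : R) (k : nat) : R :=
  fine (\sum_(k <= l <oo) (rlim g l * Ssum p k l)%:E)%E.

Definition fhat (p : nat -> R) (g : R) (k : nat) : R :=
  fine (\sum_((k.+1)./2 <= l <oo) (rlim g l * Ssum p k l.*2)%:E)%E.

End Constants.

Section Distribution.
Context {R : realType}.

Definition is_pmf (p : nat -> R) : Prop :=
  [/\ p 0%N = 0, forall x, 0 <= p x &
      (\sum_(1 <= x <oo) (p x)%:E)%E = 1%E].

Definition standing_decreasing (p : nat -> R) : Prop :=
  (forall x, (1 <= x)%N -> p x.+1 <= p x) /\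
  (\forall n \near \oo, 0 < p n.+1 /\ p n.+1 < p n).

Definition is_extension (p : nat -> R) (phi : R -> R) : Prop :=
  [/\ forall x : nat, (1 <= x)%N -> phi x%:R = (p x)^-1,
      {within `[(1 : R), +oo[, continuous phi} &
      exists A : R, {in `[A, +oo[ &, {homo phi : x y / x < y}}].

(* [phi] need not be injective on [1, +oo[, but any value that is large enough
   has exactly one preimage there, which [pinv] returns. *)
Definition phi_inv (phi : R -> R) : R -> R := pinv `[(1 : R), +oo[ phi.

Definition non_critical (phi : R -> R) (g : R) : Prop :=
  (forall la : R, 0 < la ->
     phi_inv phi (n%:R * la) / phi_inv phi n%:R @[n --> \oo] --> la `^ g) /\
  (forall e : R, 0 < e -> exists C x0 : R, forall (n : nat) (la : R),
     0 < la -> x0 <= n%:R -> x0 <= n%:R * la ->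
     phi_inv phi (n%:R * la) / phi_inv phi n%:R
       <= C * Num.max (la `^ (g - e)) (la `^ (g + e))).

(* a n = b n [1 + o(1)]; in particular a n is eventually finite. *)
Definition eq_1o1 (a : nat -> \bar R) (b : nat -> R) : Prop :=
  exists2 e : nat -> R, e n @[n --> \oo] --> (0 : R) &
    \forall n \near \oo, a n = (b n * (1 + e n))%:E.

End Distribution.

Section Probability.
Context {R : realType} {d : measure_display} {T : measurableType d}.
Variable P : probability T R.

Definition mutually_independent {d' : measure_display} {T' : measurableType d'}
    (I : choiceType) (D : set I) (X : I -> T -> T') : Prop :=
  forall (J : seq I) (B : I -> set T'),
    uniq J -> (forall j, j \in J -> D j) -> (forall j, measurable (B j)) ->
    P (\bigcap_(j in [set` J]) (X j @^-1` B j))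
      = (\prod_(j <- J) P (X j @^-1` B j))%E.

Definition iid (p : nat -> R) (xi : nat -> {RV P >-> nat}) : Prop :=
  mutually_independent [set n | (1 <= n)%N] (fun n => xi n : T -> nat) /\
  (forall n x, (1 <= n)%N -> distribution P (xi n) [set x] = (p x)%:E).

Definition mean (xi : nat -> {RV P >-> nat}) (F : (nat -> nat) -> nat) : \bar R :=
  ('E_P[fun w => (F (xi^~ w))%:R])%E.

End Probability.

(* Main.v *)
Require Import Defs.
From HB Require Import structures.
From mathcomp Require Import all_boot all_order all_algebra.
From mathcomp Require Import all_classical all_reals all_analysis.
From mathcomp Require Import measurable_realfun.
From mathcomp Require Import zify lra ring.

Set Implicit Arguments.
Unset Strict Implicit.
Unset Printing Implicit Defensive.

Import Order.TTheory GRing.Theory Num.Theory.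
Import numFieldNormedType.Exports.

Local Open Scope classical_set_scope.
Local Open Scope ring_scope.

(** Every statistic of the theorem is, up to an error of at most two, a function
    of the word xi_1 ... xi_n, and is built from _censuses_: [census m l Phi w] is
    the number of states x visited at least m times by w without its last letter,
    such that the first l <= m visits, each recorded as the pair (letter before,
    letter after), pass the test Phi. The out-degree of x is the number of
    distinct second components of all these pairs, and its degree, unless x is
    the first or the last letter, the number of distinct components. States with
    exactly l visits are obtained by subtracting the census with threshold l + 1
    from the one with threshold l.

    _Means._ Around the visits to x the other letters look like independent
    letters of law pi, so the mean of a census should be the product of
    [pair_mean l Phi], the probability that l independent pairs pass the test, and
    of the mean number of states visited at least m times. The lower bound
    [mean_census_ge], with an error that does not depend on n, is proved one state at a
    time by induction on l; the same bound for the negated test gives the upper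
    bound [mean_census_le].

    _Almost sure limits._ Blanking one letter affects at most three states, and a
    state is sensitive to at most 3 m positions. By the Efron-Stein inequality the
    variance of a census is therefore at most 9 m times the mean range
    ([census_variance]). Since only the first l visits are tested, a census is
    nondecreasing in time. Chebyshev's inequality at the times when the mean range
    passes the squares, and interpolation between these times, give a strong law
    with the mean range as normalization ([monotone_slln], [census_slln]).

    _Growth of the means._ The mean number of states visited at least m + 1 times
    is a sum of binomial tails. Writing a tail as an integral of its density and
    exchanging sum and integral gives the integral over y > 0 of a density that
    converges to y^m e^-y / m!, times the number of states of mass at least
    y / n. By [phi_inv_count] this number is the integer part of
    phi^-1 (n / y), which non-criticality compares with phi^-1 (n) y^-gamma.
    Dominated convergence yields the limit Gamma (m + 1 - gamma) / m!
    ([mean_repeats_phi_inv]). Differences of consecutive limits are the r_l.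

    _Sums over the number of visits._ The proportion of visited states that are
    visited at least L times tends to [repeat_ratio g L], and this vanishes as L
    grows; truncating the sum over l at L therefore squeezes the statistics that do
    not fix the number of visits ([rate_full_census]). The constants are
    identified by [SsumE]: S_{k,l} is the probability that l independent letters
    take exactly k values, and l pairs are 2 l letters. *)

(** * Means over words of independent letters *)

Section LetterMean.
Context {R : realType} (mu : probability nat R).

Definition letter_mean (f : nat -> R) : R := \int[mu]_a f a.

Definition bounded_by (C : R) (f : nat -> R) := forall a, `|f a| <= C.

Lemma bounded_integrable C f : bounded_by C f -> mu.-integrable setT (EFin \o f).
Proof.
move=> bf.
apply: measurable_bounded_integrable => //.
  exact: (fin_num_fun_lty (fin_num_measure mu)).
exists C; split; first exact: num_real.
by move=> M CM x _ /=; rewrite (le_trans (bf x))// ltW.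
Qed.

Lemma letter_meanD C D f h : bounded_by C f -> bounded_by D h ->
  letter_mean (fun a => f a + h a) = letter_mean f + letter_mean h.
Proof. by move=> /bounded_integrable ? /bounded_integrable ?; exact: RintegralD. Qed.

Lemma letter_meanZ C f c : bounded_by C f ->
  letter_mean (fun a => c * f a) = c * letter_mean f.
Proof. by move=> /bounded_integrable ?; exact: RintegralZl. Qed.

Lemma letter_mean_cst c : letter_mean (fun=> c) = c.
Proof. rewrite /letter_mean Rintegral_cst// -[RHS]mulr1; congr (_ * _).
exact: (congr1 fine (@probability_setT _ _ _ mu)). Qed.

Lemma letter_mean_le C D f h : bounded_by C f -> bounded_by D h ->
  (forall a, f a <= h a) -> letter_mean f <= letter_mean h.
Proof. by move=> /bounded_integrable ? /bounded_integrable ? ?; apply: le_Rintegral. Qed.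

Lemma letter_mean_norm C f : bounded_by C f -> `|letter_mean f| <= C.
Proof.
move=> bf; rewrite -(letter_mean_cst C); apply: le_trans.
  by apply: le_normr_Rintegral => //; exact: bounded_integrable bf.
apply: (@letter_mean_le C C) => // a; first by rewrite normr_id.
by rewrite ger0_norm// (le_trans _ (bf a)).
Qed.

Lemma letter_mean_ge0 f : (forall a, 0 <= f a) -> 0 <= letter_mean f.
Proof. by move=> f0; apply: Rintegral_ge0. Qed.

Lemma letter_mean1 a c : letter_mean (fun b => (b == a)%:R * c) = fine (mu [set a]) * c.
Proof.
have -> : letter_mean (fun b => (b == a)%:R * c) = c * letter_mean (fun b => (b == a)%:R).
  rewrite -(@letter_meanZ 1) => [|b]; last by case: (_ == _); rewrite normr_nat.
  by congr letter_mean; apply/funext => b; rewrite mulrC.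
rewrite mulrC; congr (_ * _); rewrite /letter_mean.
have -> : (fun b => (b == a)%:R : R) = \1_[set a].
  by apply/funext => b; rewrite indicE; congr (nat_of_bool _)%:R;
     apply/eqP/idP => [->|]; [exact: mem_set|move/set_mem].
by rewrite /Rintegral integral_indic// setIT.
Qed.

Lemma letter_mean_cvg C (f_ : nat -> nat -> R) f : (forall K, bounded_by C (f_ K)) ->
  (forall a, f_ K a @[K --> \oo] --> f a) ->
  letter_mean (f_ K) @[K --> \oo] --> letter_mean f.
Proof.
move=> bf cf; have bl : bounded_by C f.
  by move=> a; apply: (ler_cvg_to (cvg_norm (cf a)) (cvg_cst C)); apply: nearW => K; exact: bf.
apply: fine_cvg; rewrite fineK; last exact: integrable_fin_num (bounded_integrable bl).
have bC : bounded_by `|C| (fun=> C) by [].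
apply: (@dominated_cvg _ _ _ mu _ _ (fun K a => (f_ K a)%:E) _ (EFin \o (fun=> C))) => //.
- by move=> a _; apply: cvg_EFin; [exact: nearW|exact: cf].
- exact: bounded_integrable bC.
- by move=> K a _; rewrite lee_fin; exact: bf.
Qed.

End LetterMean.

Section WordMean.
Context {R : realType} (mu : probability nat R).
Local Notation E1 := (letter_mean mu).

(** Iterated one-letter integrals stand for the product measure, so that
    statements about words are proved by induction on their length. *)
Fixpoint word_mean (n : nat) (F : seq nat -> R) : R :=
  if n is n'.+1 then E1 (fun a => word_mean n' (fun w => F (a :: w))) else F [::].

Definition word_bounded n (F : seq nat -> R) (C : R) :=
  forall w, size w = n -> `|F w| <= C.

Lemma word_boundedS n F C a : word_bounded n.+1 F C ->
  word_bounded n (fun w => F (a :: w)) C.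
Proof. by move=> bF w sw; apply: bF; rewrite /= sw. Qed.

Lemma word_mean_norm n F C : word_bounded n F C -> `|word_mean n F| <= C.
Proof.
elim: n F => [|n IH] F bF /=; first exact: bF.
by apply: letter_mean_norm => a; apply: IH; exact: word_boundedS.
Qed.

Lemma eq_word_mean n F G : (forall w, size w = n -> F w = G w) ->
  word_mean n F = word_mean n G.
Proof.
elim: n F G => [|n IH] F G FG /=; first exact: FG.
congr letter_mean; apply/funext => a; apply: IH => w sw; apply: FG.
by rewrite /= sw.
Qed.

Lemma word_meanD n F G C D : word_bounded n F C -> word_bounded n G D ->
  word_mean n (fun w => F w + G w) = word_mean n F + word_mean n G.
Proof.
elim: n F G => [//|n IH] F G bF bG /=.
rewrite -(@letter_meanD _ mu C D).
- by congr letter_mean; apply/funext => a; apply: IH; exact: word_boundedS.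
- by move=> a; apply: word_mean_norm; exact: word_boundedS.
- by move=> a; apply: word_mean_norm; exact: word_boundedS.
Qed.

Lemma word_meanZ n F C c : word_bounded n F C ->
  word_mean n (fun w => c * F w) = c * word_mean n F.
Proof.
elim: n F => [//|n IH] F bF /=.
rewrite -(@letter_meanZ _ mu C).
- by congr letter_mean; apply/funext => a; apply: IH; exact: word_boundedS.
- by move=> a; apply: word_mean_norm; exact: word_boundedS.
Qed.

Lemma word_mean_cst n c : word_mean n (fun=> c) = c.
Proof. by elim: n => [//|n IH] /=; under eq_fun do rewrite IH; exact: letter_mean_cst. Qed.

Lemma word_mean_le n F G C D : word_bounded n F C -> word_bounded n G D ->
  (forall w, size w = n -> F w <= G w) -> word_mean n F <= word_mean n G.
Proof.
elim: n F G => [|n IH] F G bF bG FG /=; first exact: FG.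
apply: (@letter_mean_le _ mu C D).
- by move=> a; apply: word_mean_norm; exact: word_boundedS.
- by move=> a; apply: word_mean_norm; exact: word_boundedS.
- move=> a; apply: IH; [exact: word_boundedS|exact: word_boundedS|].
  by move=> w sw; apply: FG; rewrite /= sw.
Qed.

Lemma word_mean_ge0 n F : (forall w, size w = n -> 0 <= F w) -> 0 <= word_mean n F.
Proof.
elim: n F => [|n IH] F F0 /=; first exact: F0.
by apply: letter_mean_ge0 => a; apply: IH => w sw; apply: F0; rewrite /= sw.
Qed.

Lemma word_mean_sum n (I : Type) (r : seq I) (F : I -> seq nat -> R) C :
  (forall i, word_bounded n (F i) C) ->
  word_mean n (fun w => \sum_(i <- r) F i w) = \sum_(i <- r) word_mean n (F i).
Proof.
move=> bF; elim: r => [|i r IH].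
  by rewrite big_nil -[RHS](word_mean_cst n); apply: eq_word_mean => w _; rewrite big_nil.
rewrite big_cons -IH -(@word_meanD n _ _ C (C *+ size r)) //.
  by apply: eq_word_mean => w _; rewrite big_cons.
move=> w sw; rewrite (le_trans (ler_norm_sum _ _ _))//.
rewrite (@le_trans _ _ (\sum_(j <- r) C))//; first by apply: ler_sum => j _; exact: bF.
by rewrite big_const_seq count_predT iter_addr addr0.
Qed.

Lemma word_mean_take n F : word_mean n.+1 (fun w => F (take n w)) = word_mean n F.
Proof.
elim: n F => [|n IH] F /=.
  by rewrite letter_mean_cst.
by congr letter_mean; apply/funext => a; rewrite -IH /=.
Qed.

Lemma word_bounded_sqr n F C : word_bounded n F C -> word_bounded n (fun w => F w ^+ 2) (C ^+ 2).
Proof.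
move=> bF w sw; rewrite normrX lerXn2r ?nnegrE ?bF//.
by rewrite (le_trans _ (bF w sw)).
Qed.

Lemma word_boundedB n F G C D : word_bounded n F C -> word_bounded n G D ->
  word_bounded n (fun w => F w - G w) (C + D).
Proof.
move=> bF bG w sw; rewrite (le_trans (ler_normB _ _))// lerD ?bF ?bG//.
Qed.

Lemma word_boundedD n F G C D : word_bounded n F C -> word_bounded n G D ->
  word_bounded n (fun w => F w + G w) (C + D).
Proof.
move=> bF bG w sw; rewrite (le_trans (ler_normD _ _))// lerD ?bF ?bG//.
Qed.

Lemma word_boundedZ c n F C : word_bounded n F C ->
  word_bounded n (fun w => c * F w) (`|c| * C).
Proof. by move=> bF w sw; rewrite normrM ler_wpM2l ?bF. Qed.

Lemma word_meanB n F G C D : word_bounded n F C -> word_bounded n G D ->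
  word_mean n (fun w => F w - G w) = word_mean n F - word_mean n G.
Proof.
move=> bF bG; rewrite -mulN1r -(word_meanZ _ bG).
rewrite -(word_meanD bF (word_boundedZ (-1) bG)).
by apply: eq_word_mean => w _; rewrite mulN1r.
Qed.

Lemma word_mean_sqrB n F C c : word_bounded n F C ->
  word_mean n (fun w => (F w - c) ^+ 2) =
  word_mean n (fun w => F w ^+ 2) - 2 * c * word_mean n F + c ^+ 2.
Proof.
move=> bF.
have b1 : word_bounded n (fun w => (- (2 * c)) * F w) (`|- (2 * c)| * C) by exact: word_boundedZ.
have bc : word_bounded n (fun=> c ^+ 2) (`|c ^+ 2|) by [].
have -> : word_mean n (fun w => (F w - c) ^+ 2) =
   word_mean n (fun w => F w ^+ 2 + ((- (2 * c)) * F w + c ^+ 2)).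
  by apply: eq_word_mean => w _; ring.
rewrite (word_meanD (word_bounded_sqr bF) (word_boundedD b1 bc)).
by rewrite (word_meanD b1 bc) (word_meanZ _ bF) word_mean_cst; ring.
Qed.

Lemma word_mean_variance n F C : word_bounded n F C ->
  word_mean n (fun w => (F w - word_mean n F) ^+ 2) =
  word_mean n (fun w => F w ^+ 2) - word_mean n F ^+ 2.
Proof. by move=> bF; rewrite (word_mean_sqrB _ bF); ring. Qed.

(** Mean squares are smallest around the mean. In the Efron-Stein inequality c
    is the value of f at one letter, which makes the last term a mean of squared
    increments. *)
Lemma letter_mean_sqr C f c : bounded_by C f ->
  E1 (fun a => f a ^+ 2) <= E1 f ^+ 2 + E1 (fun a => (f a - c) ^+ 2).
Proof.
move=> bf; have := @word_mean_sqrB 1 (fun w => f (head 0%N w)) C c (fun w _ => bf _).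
by rewrite /= => ->; have := sqr_ge0 (E1 f - c); rewrite sqrrB => h; nra.
Qed.

Lemma word_mean_cvg n C (F_ : nat -> seq nat -> R) F : (forall K, word_bounded n (F_ K) C) ->
  (forall w, F_ K w @[K --> \oo] --> F w) ->
  word_mean n (F_ K) @[K --> \oo] --> word_mean n F.
Proof.
elim: n F_ F => [|n IH] F_ F bF cF; first exact: cF.
apply: (@letter_mean_cvg _ mu C) => [K a|a].
  by apply: word_mean_norm; exact: word_boundedS.
by apply: IH => [K|w]; [exact: word_boundedS|exact: cF].
Qed.

Lemma word_mean_jensen n F C : word_bounded n F C ->
  word_mean n F ^+ 2 <= word_mean n (fun w => F w ^+ 2).
Proof.
move=> bF; rewrite -subr_ge0 -(word_mean_variance bF).
by apply: word_mean_ge0 => w _; exact: sqr_ge0.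
Qed.

(** The letter 0 is not a state: blanking removes a possible visit and creates
    none. *)
Definition blank (i : nat) (w : seq nat) := set_nth 0%N w i 0%N.

Lemma size_blank n i w : (i < n)%N -> size w = n -> size (blank i w) = n.
Proof. by move=> ilt sw; rewrite size_set_nth sw; apply/maxn_idPr. Qed.

(** After the first letter is integrated out, [letter_mean_sqr] bounds the
    variance of the conditional mean by the effect of blanking that letter, and
    Jensen's inequality moves the square inside the mean over the other letters.
    The increments are taken with respect to a fixed letter instead of an
    independent copy. *)
Lemma efron_stein n F C : word_bounded n F C ->
  word_mean n (fun w => F w ^+ 2) <= word_mean n F ^+ 2 +
    \sum_(i < n) word_mean n (fun w => (F w - F (blank i w)) ^+ 2).
Proof.
elim: n F => [|n IH] F bF; first by rewrite big_ord0 addr0.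
rewrite big_ord_recl /=.
have bFa a : word_bounded n (fun w => F (a :: w)) C by exact: word_boundedS.
pose g a := word_mean n (fun w => F (a :: w)).
have bg : bounded_by C g by move=> a; apply: word_mean_norm.
have C0 : 0 <= C by rewrite (le_trans _ (bg 0%N)).
have bg2 : bounded_by (C ^+ 2) (fun a => g a ^+ 2).
  by move=> a; rewrite normrX lerXn2r ?nnegrE// bg.
pose S a := \sum_(i < n) word_mean n (fun w => (F (a :: w) - F (a :: blank i w)) ^+ 2).
have bt a i : (i < n)%N ->
    `|word_mean n (fun w => (F (a :: w) - F (a :: blank i w)) ^+ 2)| <= (C + C) ^+ 2.
  move=> iltn; apply: word_mean_norm; apply: word_bounded_sqr; apply: word_boundedB => //.
  by move=> w sw; apply: bF; rewrite /= (size_blank iltn).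
have bS : bounded_by ((C + C) ^+ 2 *+ n) S.
  move=> a; rewrite (le_trans (ler_norm_sum _ _ _))//.
  rewrite -[X in _ *+ X]card_ord -sumr_const; apply: ler_sum => i _; exact: bt.
have -> : \sum_(i < n) E1 (fun a => word_mean n (fun w =>
    (F (a :: w) - F (blank (lift ord0 i) (a :: w))) ^+ 2)) = E1 S.
  exact: (esym (@word_mean_sum 1 _ (index_enum 'I_n) (fun i w => word_mean n (fun v =>
    (F (head 0%N w :: v) - F (head 0%N w :: blank i v)) ^+ 2)) _ (fun i w _ => bt _ _ (ltn_ord i)))).
have h1 : E1 (fun a => word_mean n (fun w => F (a :: w) ^+ 2)) <=
    E1 (fun a => g a ^+ 2) + E1 S.
  rewrite -(letter_meanD mu bg2 bS).
  apply: (@letter_mean_le _ _ (C ^+ 2) (C ^+ 2 + (C + C) ^+ 2 *+ n)).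
  - by move=> a; apply: word_mean_norm; exact: word_bounded_sqr.
  - by move=> a; rewrite (le_trans (ler_normD _ _))// lerD.
  by move=> a; exact: IH.
apply: (le_trans h1); rewrite addrA lerD2r.
apply: (le_trans (letter_mean_sqr (g 0%N) bg)); rewrite lerD2l.
apply: (@letter_mean_le _ _ ((C + C) ^+ 2) ((C + C) ^+ 2)).
- move=> a; rewrite normrX lerXn2r ?nnegrE// ?addr_ge0//.
  by rewrite (le_trans (ler_normB _ _))// lerD.
- move=> a; apply: word_mean_norm; apply: word_bounded_sqr; exact: (word_boundedB (bFa a) (bFa 0%N)).
move=> a; rewrite /g -(word_meanB (bFa a) (bFa 0%N)).
apply: (word_mean_jensen (C := C + C)); exact: (word_boundedB (bFa a) (bFa 0%N)).
Qed.

End WordMean.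

(** * Visits, their neighbours, and the influence of one letter *)

Section Neighbours.
Local Open Scope nat_scope.

(** A visit at the last position has no successor yet and is left out; p plays
    the role of the letter preceding the word, so that a visit at the first
    position has a predecessor. *)
Fixpoint neighbours (x p : nat) (w : seq nat) : seq (nat * nat) :=
  if w is h :: t then
    if t is b :: _ then (if h == x then [:: (p, b)] else [::]) ++ neighbours x h t
    else [::]
  else [::].

Definition visit_times (x : nat) (w : seq nat) : seq nat :=
  [seq j <- iota 0 (size w).-1 | nth 0 w j == x].

Lemma neighboursE x p w : neighbours x p w =
  [seq (nth 0 (p :: w) j, nth 0 w j.+1) | j <- visit_times x w].
Proof.
elim: w p => [//|h [//|b t] IH] p.
rewrite [LHS]/= -/(neighbours x h (b :: t)) IH /visit_times /=.
rewrite -[1]addn0 iotaDl filter_map.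
by case: (h == x) => /=; [congr cons|]; rewrite -[RHS]map_comp.
Qed.

Lemma size_neighbours x p w : size (neighbours x p w) = count_mem x (take (size w).-1 w).
Proof.
elim: w p => [//|h [//|b t] IH] p.
by rewrite [LHS]/= size_cat IH /=; case: (h == x).
Qed.

(** Looking at the first l visits only, with l <= m, makes the property persist
    when letters are appended to the word. *)
Definition fits (m l : nat) (Phi : pred (seq (nat * nat))) (x p : nat) (w : seq nat) :=
  (m <= size (neighbours x p w)) && Phi (take l (neighbours x p w)).

Definition letter_bound (w : seq nat) : nat := (\max_(a <- w) a).+1.

Definition census m l Phi (w : seq nat) : nat :=
  \sum_(1 <= x < letter_bound w) fits m l Phi x 0 w.

Definition repeats m (w : seq nat) : nat :=
  \sum_(1 <= x < letter_bound w) (m <= count_mem x w).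

Lemma mem_letter_bound w x : x \in w -> x < letter_bound w.
Proof. by move=> xw; rewrite ltnS; rewrite (leq_bigmax_seq _ xw). Qed.

Lemma sum_widen_zero (f : nat -> nat) A B : A <= B ->
  (forall x, A <= x -> f x = 0) -> \sum_(1 <= x < B) f x = \sum_(1 <= x < A) f x.
Proof.
move=> AB f0; have [A0|A0] := posnP A.
  by rewrite A0 [RHS]big_geq// big1// => x _; rewrite f0// A0.
rewrite (big_cat_nat (n := A))//= [X in _ + X]big1_seq ?addn0// => x.
by rewrite mem_index_iota => /andP[_ /andP[Ax _]]; exact: f0.
Qed.

Lemma fits_mem m l Phi x p w : 0 < m -> fits m l Phi x p w -> x \in w.
Proof.
move=> m0 /andP[h _]; have := leq_trans m0 h.
by rewrite size_neighbours -has_count has_pred1 => /mem_take.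
Qed.

Lemma censusE m l Phi w K : 0 < m -> letter_bound w <= K ->
  census m l Phi w = \sum_(1 <= x < K) fits m l Phi x 0 w.
Proof.
move=> m0 wK; rewrite (sum_widen_zero wK)// => x wx.
by apply/eqP; rewrite eqb0; apply/negP => /(fits_mem m0) /mem_letter_bound; rewrite ltnNge wx.
Qed.

Lemma repeatsE m w K : 0 < m -> letter_bound w <= K ->
  repeats m w = \sum_(1 <= x < K) (m <= count_mem x w).
Proof.
move=> m0 wK; rewrite (sum_widen_zero wK)// => x wx.
apply/eqP; rewrite eqb0 -ltnNge; apply: leq_ltn_trans m0.
have /count_memPn -> // : x \notin w.
by apply/negP => /mem_letter_bound; rewrite ltnNge wx.
Qed.

Lemma sum_eq_le1 n (f : nat -> nat) j : injective f -> \sum_(i < n) (f i == j) <= 1.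
Proof.
move=> fi; elim: n => [|n IH]; first by rewrite big_ord0.
rewrite big_ord_recr /=; case: eqP => [fn|_]; last by rewrite addn0.
rewrite big1// => i _; apply/eqP; rewrite eqb0; apply/eqP => fij.
by have := ltn_ord i; rewrite (fi i n) ?ltnn// fn.
Qed.

Lemma sum_mem_le n (f : nat -> nat) (V : seq nat) : injective f ->
  \sum_(i < n) (f i \in V) <= size V.
Proof.
move=> fi; elim: V => [|a V IH]; first by rewrite big1.
apply: (@leq_trans (\sum_(i < n) ((f i == a) + (f i \in V)))).
  by apply: leq_sum => i _; rewrite inE; case: (_ == _); case: (_ \in _).
by rewrite big_split /= -[(size V).+1]add1n leq_add// sum_eq_le1.
Qed.

Lemma sum_eq_range_le1 A B y : \sum_(A <= x < B) (x == y) <= 1.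
Proof.
elim: B => [|B IH]; first by rewrite big_geq.
case: (leqP A B) => AB; last by rewrite big_geq.
rewrite big_nat_recr//=; case: eqP => [<-|_]; last by rewrite addn0.
rewrite big_nat big1// => x /andP[_ xB]; apply/eqP; rewrite eqb0; apply/eqP => xe.
by rewrite xe ltnn in xB.
Qed.

Lemma take_filter_predC1 (s : seq nat) m i : i \notin take m s ->
  take m [seq j <- s | j != i] = take m s /\
  (m <= size [seq j <- s | j != i]) = (m <= size s).
Proof.
move=> im; rewrite -{1 3}(cat_take_drop m s) filter_cat.
have -> : [seq j <- take m s | j != i] = take m s.
  by apply/all_filterP/allP => j jm /=; apply/eqP => ji; rewrite -ji jm in im.
case: (leqP m (size s)) => ms.
  by rewrite size_cat size_takel// leq_addr take_cat size_takel// ltnn subnn take0 cats0.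
by rewrite drop_oversize ?cats0 ?(ltnW ms)// take_oversize ?(ltnW ms)// take_oversize ?(ltnW ms)//
  leqNgt ms.
Qed.

Lemma visit_times_blank x i w : 0 < x -> i < size w ->
  visit_times x (blank i w) = [seq j <- visit_times x w | j != i].
Proof.
move=> x0 iw; rewrite /visit_times (size_blank iw erefl) -filter_predI.
apply: eq_filter => j /=; rewrite nth_set_nth /=.
by case: (eqVneq j i) => [_|//]; rewrite eq_sym; case: eqP x0 => // ->.
Qed.

(** The positions that decide [fits]: removing a later visit leaves at least m
    visits and the first l pairs unchanged. *)
Definition early m x w := take m (visit_times x w).

(** A letter is read by [fits] only as an early visit or as the neighbour of
    one. *)
Lemma fits_blank m l Phi x i w : l <= m -> 0 < x -> i < size w ->
  i \notin early m x w -> i \notin map S (early m x w) -> i.+1 \notin early m x w ->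
  fits m l Phi x 0 (blank i w) = fits m l Phi x 0 w.
Proof.
move=> lm x0 iw i1 i2 i3; rewrite /fits !neighboursE !size_map visit_times_blank//.
have [h1 h2] := take_filter_predC1 i1; rewrite h2; case: (m <= _) => //=.
rewrite -!map_take -[take l _](take_takel _ lm) h1 (take_takel _ lm).
congr (Phi _); apply/eq_in_map => j jl.
have je : j \in early m x w by rewrite /early -(take_takel _ lm) in jl *; exact: mem_take jl.
congr pair.
- case: j je {jl} => [//|j] je /=; rewrite nth_set_nth /=; case: eqP => // ji.
  by rewrite -ji je in i3.
- rewrite nth_set_nth /=; case: eqP => // ji.
  by move: i2; rewrite -ji map_f.
Qed.

Definition affected m x w i : nat :=
  (i \in early m x w) + (i \in map S (early m x w)) + (i.+1 \in early m x w).

Lemma early_nth m x w i : i \in early m x w -> x = nth 0 w i.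
Proof. by move=> /mem_take; rewrite mem_filter => /andP[/eqP]. Qed.

(** An early visit of x at i, i - 1 or i + 1 determines x. *)
Lemma sum_affected_le3 m w i K : \sum_(1 <= x < K) affected m x w i <= 3.
Proof.
rewrite /affected 2!big_split /= -[3]/(1 + 1 + 1) !leq_add//.
- apply: leq_trans (sum_eq_range_le1 1 K (nth 0 w i)); apply: leq_sum => x _.
  by case: (boolP (_ \in _)) => // /early_nth ->; rewrite eqxx.
- apply: leq_trans (sum_eq_range_le1 1 K (nth 0 w i.-1)); apply: leq_sum => x _.
  by case: (boolP (_ \in _)) => // /mapP[j /early_nth -> ->] /=; rewrite eqxx.
- apply: leq_trans (sum_eq_range_le1 1 K (nth 0 w i.+1)); apply: leq_sum => x _.
  by case: (boolP (_ \in _)) => // /early_nth ->; rewrite eqxx.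
Qed.

Lemma size_early_le m x w : size (early m x w) <= m * (1 <= count_mem x w).
Proof.
case: (posnP (count_mem x w)) => [c0|_]; last first.
  by rewrite muln1 size_take; case: ltnP => // /ltnW.
rewrite muln0 leqn0 size_eq0 /early; apply/eqP.
suff -> : visit_times x w = [::] by [].
apply/eqP; rewrite -(negbK (_ == _)) -has_filter; apply/hasPn => j.
rewrite mem_iota add0n => /andP[_ jw]; apply/eqP => jx.
have : x \in w by rewrite -jx mem_nth//; case: (size w) jw => [|k] //=; exact: ltnW.
by rewrite -has_pred1 has_count c0.
Qed.

Lemma sum_affected_le m x w n :
  \sum_(i < n) affected m x w i <= 3 * m * (1 <= count_mem x w).
Proof.
rewrite /affected 2!big_split /= -mulnA; apply: (@leq_trans (3 * size (early m x w))); last first.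
  by rewrite leq_mul2l size_early_le.
rewrite -[3]/(1 + 1 + 1) !mulnDl !mul1n !leq_add//.
- exact: (@sum_mem_le n id).
- by rewrite -(size_map S (early m x w)); exact: (@sum_mem_le n id).
- by apply: (@sum_mem_le n S); exact: succn_inj.
Qed.

Lemma letter_bound_blank i w : i < size w -> letter_bound (blank i w) <= letter_bound w.
Proof.
move=> iw; rewrite ltnS; apply/bigmax_leqP_seq => a aw _.
have /(nthP 0)[j jw <-] := aw; rewrite nth_set_nth /=; case: eqP => // ji.
rewrite (size_blank iw erefl) in jw.
by rewrite (@leq_bigmax_seq _ w xpredT id)// mem_nth.
Qed.

End Neighbours.

Section CensusSensitivity.
Context {R : realDomainType}.

Lemma census_blank_sqr m l Phi w i : (0 < m)%N -> (l <= m)%N -> (i < size w)%N ->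
  ((census m l Phi w)%:R - (census m l Phi (blank i w))%:R : R) ^+ 2 <=
  (3 * \sum_(1 <= x < letter_bound w) affected m x w i)%N%:R.
Proof.
move=> m0 lm iw; set A := (\sum_(1 <= x < _) _)%N.
have hA : `|(census m l Phi w)%:R - (census m l Phi (blank i w))%:R : R| <= A%:R.
  rewrite (@censusE m l Phi (blank i w) (letter_bound w))//; last exact: letter_bound_blank.
  rewrite /census !natr_sum -sumrB (le_trans (ler_norm_sum _ _ _))//.
  apply: ler_sum_nat => x /andP[x0 _]; rewrite /affected.
  have d1 : `|(fits m l Phi x 0 w)%:R - (fits m l Phi x 0 (blank i w))%:R : R| <= 1.
    by case: (fits _ _ _ _ _ _); case: (fits _ _ _ _ _ _);
      rewrite ?subrr ?subr0 ?sub0r ?normrN ?normr0 ?normr1.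
  case: (boolP (i \in early m x w)) => i1; first by rewrite (le_trans d1)// ler1n.
  case: (boolP (i \in map S (early m x w))) => i2; first by rewrite (le_trans d1)// ler1n.
  case: (boolP (i.+1 \in early m x w)) => i3; first by rewrite (le_trans d1)// ler1n.
  by rewrite fits_blank// subrr normr0.
rewrite -real_normK ?num_real//; apply: (@le_trans _ _ (A%:R ^+ 2)).
  by rewrite lerXn2r// nnegrE.
by rewrite -natrX ler_nat leq_mul2r /A sum_affected_le3 orbT.
Qed.

(** A change is bounded by the number of affected states, hence its square by
    three times that number; the positions affecting a given state are at most
    3 m. *)
Lemma census_sensitivity m l Phi w : (0 < m)%N -> (l <= m)%N ->
  \sum_(i < size w) ((census m l Phi w)%:R - (census m l Phi (blank i w))%:R : R) ^+ 2 <=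
  (9 * m * repeats 1 w)%N%:R.
Proof.
move=> m0 lm.
apply: (@le_trans _ _ (\sum_(i < size w)
    (3 * \sum_(1 <= x < letter_bound w) affected m x w i)%N%:R)).
  by apply: ler_sum => i _; apply: census_blank_sqr.
rewrite -natr_sum ler_nat -big_distrr /= exchange_big /= -[9%N]/(3 * 3)%N -!mulnA leq_mul2l /=.
rewrite mulnA /repeats big_distrr /=; apply: leq_sum => x _; exact: sum_affected_le.
Qed.

End CensusSensitivity.

(** * Means of censuses *)

Section BinomialTail.
Context {R : realType}.

(** The probability of at least m successes in n independent trials, by
    conditioning on the first trial. *)
Fixpoint binom_tail (q : R) (n m : nat) : R :=
  match m, n with
  | 0%N, _ => 1
  | _.+1, 0%N => 0
  | m'.+1, n'.+1 => (1 - q) * binom_tail q n' m + q * binom_tail q n' m'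
  end.

Lemma binom_tail0 q n : binom_tail q n 0 = 1. Proof. by case: n. Qed.

Lemma binom_tail01 q n m : 0 <= q <= 1 -> 0 <= binom_tail q n m <= 1.
Proof.
move=> q01; elim: n m => [|n IH] [|m] /=; rewrite ?ler01 ?lexx//.
have /andP[a0 a1] := IH m.+1; have /andP[b0 b1] := IH m; case/andP: q01 => q0 q1.
apply/andP; split; first by rewrite addr_ge0// mulr_ge0// subr_ge0.
by nra.
Qed.

Lemma binom_tail_decr q n m : 0 <= q <= 1 -> binom_tail q n m.+1 <= binom_tail q n m.
Proof.
move=> q01; elim: n m => [|n IH] m; first by case: m => //=; rewrite ler01.
case: m => [|m] /=; last first.
  by case/andP: q01 => q0 q1; rewrite lerD// ler_wpM2l// ?subr_ge0.
have /andP[a0 a1] := binom_tail01 n 1 q01; case/andP: q01 => q0 q1.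
by rewrite binom_tail0; nra.
Qed.

Lemma binom_tail_incr q n n' m : 0 <= q <= 1 -> (n <= n')%N ->
  binom_tail q n m <= binom_tail q n' m.
Proof.
move=> q01; elim: n' => [|k IH]; first by rewrite leqn0 => /eqP ->.
rewrite leq_eqVlt => /orP[/eqP->//|]; rewrite ltnS => /IH /le_trans; apply.
case: m {IH} => [|m]; first by rewrite !binom_tail0.
have := binom_tail_decr k m q01; case/andP: q01 => q0 q1 /= h; nra.
Qed.

End BinomialTail.

Section LetterMeanUnit.
Context {R : realType} (mu : probability nat R).
Local Notation E1 := (letter_mean mu).
Definition letter_prob (x : nat) : R := fine (mu [set x]).
Local Notation q := letter_prob.

Definition unit_fun (f : nat -> R) := forall a, 0 <= f a <= 1.

Lemma unit_bounded f : unit_fun f -> bounded_by 1 f.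
Proof. by move=> uf a; have /andP[f0 f1] := uf a; rewrite ger0_norm. Qed.

Lemma unit_letter_mean f : unit_fun f -> 0 <= E1 f <= 1.
Proof.
move=> uf; rewrite letter_mean_ge0 /=; last by move=> a; case/andP: (uf a).
by rewrite (le_trans (ler_norm _))// letter_mean_norm//; exact: unit_bounded.
Qed.

Lemma letter_mean_eq x c : E1 (fun a => (a == x)%:R * c) = q x * c.
Proof. exact: letter_mean1. Qed.

Lemma letter_prob01 x : 0 <= q x <= 1.
Proof.
rewrite -[q x]mulr1 -letter_mean_eq; apply: unit_letter_mean => a.
by rewrite mulr1; case: (_ == _); rewrite ?lexx ?ler01.
Qed.

Lemma bounded_eqM x c : bounded_by `|c| (fun a => (a == x)%:R * c : R).
Proof. by move=> a; case: (_ == _); rewrite ?mul1r ?mul0r ?normr0. Qed.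

Lemma bounded_neqM x C f : bounded_by C f -> bounded_by C (fun a => (a != x)%:R * f a : R).
Proof.
by move=> bf a; case: (_ == _); rewrite ?mul1r ?mul0r ?normr0// (le_trans _ (bf a)).
Qed.

Lemma letter_mean_split x C f : bounded_by C f ->
  E1 f = E1 (fun a => (a != x)%:R * f a) + q x * f x.
Proof.
move=> bf; rewrite -letter_mean_eq -(letter_meanD mu (@bounded_neqM x _ _ bf) (bounded_eqM x (f x))).
congr letter_mean; apply/funext => a; case: eqP => [->|_]; rewrite ?mul1r ?mul0r ?add0r ?addr0//.
Qed.

Lemma letter_mean_neq x f : unit_fun f -> E1 f - q x <= E1 (fun a => (a != x)%:R * f a).
Proof.
move=> uf; rewrite (letter_mean_split x (unit_bounded uf)) lerBlDr lerD2l.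
by have /andP[q0 _] := letter_prob01 x; have /andP[f0 f1] := uf x; rewrite ler_piMr.
Qed.

Lemma letter_mean_neq_cst x c : E1 (fun a => (a != x)%:R * c) = (1 - q x) * c.
Proof.
have bc : bounded_by `|c| (fun=> c) by move=> a.
have := letter_mean_split x bc; rewrite letter_mean_cst => h; apply: (addIr (q x * c)); rewrite -h; ring.
Qed.

End LetterMeanUnit.

Section CensusMean.
Context {R : realType} (mu : probability nat R).
Local Notation E1 := (letter_mean mu).
Local Notation q := (letter_prob mu).
Local Notation B n m x := (binom_tail (q x) n m).

Lemma bool_bounded n (F : seq nat -> bool) : word_bounded n (fun w => (F w)%:R : R) 1.
Proof. by move=> w _; case: (F w); rewrite ?normr1 ?normr0. Qed.

Lemma word_mean_bool01 n (F : seq nat -> bool) : 0 <= word_mean mu n (fun w => (F w)%:R) <= 1.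
Proof.
rewrite word_mean_ge0//= (le_trans (ler_norm _))//.
by apply: word_mean_norm; exact: bool_bounded.
Qed.

Lemma word_mean_count n m x :
  word_mean mu n (fun w => (m <= count_mem x w)%N%:R) = B n m x.
Proof.
elim: n m => [|n IH] [|m] //=.
  by under eq_fun do rewrite word_mean_cst; rewrite letter_mean_cst.
have -> : (fun a => word_mean mu n (fun w => (m < (a == x) + count_mem x w)%N%:R)) =
    (fun a => if a == x then B n m x else B n m.+1 x).
  apply/funext => a; rewrite -!IH; case: (a == x); apply: eq_word_mean => w _.
    by rewrite add1n ltnS.
  by rewrite add0n.
have bt k : `|B n k x| <= 1.
  by have /andP[h0 h1] := binom_tail01 n k (letter_prob01 mu x); rewrite ger0_norm.
rewrite (@letter_mean_split _ mu x 1); last by move=> a; case: ifP.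
rewrite eqxx; congr (_ + _); rewrite -letter_mean_neq_cst; congr letter_mean.
by apply/funext => a; case: eqP => //; rewrite !mul0r.
Qed.

(** The probability that l independent pairs of letters pass the test. *)
Fixpoint pair_mean (l : nat) (Phi : pred (seq (nat * nat))) : R :=
  if l is l'.+1 then
    E1 (fun p => E1 (fun b => pair_mean l' (fun z => Phi ((p, b) :: z))))
  else (Phi [::])%:R.

(** The same probability on the event that none of the letters is x. There the
    letter following a visit is not a visit itself, so that the pairs read at
    different visits involve different letters. *)
Fixpoint pair_mean_avoiding (x l : nat) (Phi : pred (seq (nat * nat))) : R :=
  if l is l'.+1 then
    E1 (fun p => (p != x)%:R * E1 (fun b => (b != x)%:R *
      pair_mean_avoiding x l' (fun z => Phi ((p, b) :: z))))
  else (Phi [::])%:R.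

Lemma unit_neqM (x : nat) (f : nat -> R) : unit_fun f -> unit_fun (fun a => (a != x)%:R * f a).
Proof. by move=> uf a; case: (_ != _); rewrite ?mul1r// mul0r lexx ler01. Qed.

Lemma pair_mean01 l Phi : 0 <= pair_mean l Phi <= 1.
Proof.
elim: l Phi => [|l IH] Phi /=; first by case: (Phi _); rewrite ?lexx ?ler01.
by apply: unit_letter_mean => p; apply: unit_letter_mean => b.
Qed.

Lemma pair_mean_avoiding01 x l Phi : 0 <= pair_mean_avoiding x l Phi <= 1.
Proof.
elim: l Phi => [|l IH] Phi /=; first by case: (Phi _); rewrite ?lexx ?ler01.
apply: unit_letter_mean; apply: unit_neqM => p.
by apply: unit_letter_mean; apply: unit_neqM => b.
Qed.

Lemma pair_meanC l Phi : pair_mean l Phi + pair_mean l (predC Phi) = 1.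
Proof.
elim: l Phi => [|l IH] Phi /=; first by case: (Phi _); rewrite ?addr0 ?add0r.
have u1 Psi p : unit_fun (fun b => pair_mean l (fun z => Psi ((p, b) :: z))).
  by move=> b; exact: pair_mean01.
have u2 Psi : unit_fun (fun p => E1 (fun b => pair_mean l (fun z => Psi ((p, b) :: z)))).
  by move=> p; exact: unit_letter_mean.
rewrite -(letter_meanD mu (unit_bounded (u2 Phi)) (unit_bounded (u2 (predC Phi)))).
rewrite -[RHS](letter_mean_cst mu); congr letter_mean; apply/funext => p.
rewrite -(letter_meanD mu (unit_bounded (u1 Phi p)) (unit_bounded (u1 (predC Phi) p))).
rewrite -[RHS](letter_mean_cst mu); congr letter_mean; apply/funext => b.
exact: IH.
Qed.

(** A union bound: each of the 2 l letters equals x with probability q x. *)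
Lemma pair_mean_avoiding_ge x l Phi :
  pair_mean l Phi - (2 * l)%:R * q x <= pair_mean_avoiding x l Phi.
Proof.
elim: l Phi => [|l IH] Phi /=; first by rewrite mul0r subr0.
have /andP[q0 _] := letter_prob01 mu x.
pose G p := E1 (fun b => (b != x)%:R *
  pair_mean_avoiding x l (fun z => Phi ((p, b) :: z))).
have uG : unit_fun G.
  move=> p; apply: unit_letter_mean; apply: unit_neqM => b; exact: pair_mean_avoiding01.
apply: (le_trans _ (letter_mean_neq mu x uG)).
rewrite lerBrDr -addrA.
pose H p := E1 (fun b => pair_mean l (fun z => Phi ((p, b) :: z))).
have uH : unit_fun H by move=> p; apply: unit_letter_mean => b; exact: pair_mean01.
have -> : - ((2 * l.+1)%:R * q x) + q x = - ((2 * l).+1%:R * q x).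
  by rewrite mulnS -[in RHS]natr1 -[in LHS](addn1 1) !natrD; ring.
set c := - _.
rewrite -[c](letter_mean_cst mu).
have bc : bounded_by `|c| (fun=> c) by move=> a.
rewrite -(letter_meanD mu (unit_bounded uH) bc).
apply: (@letter_mean_le _ _ (1 + `|c|) 1).
- by move=> a; rewrite (le_trans (ler_normD _ _))// lerD2r; exact: (unit_bounded uH).
- exact: unit_bounded.
move=> p; rewrite /G.
have uJ : unit_fun (fun b => pair_mean_avoiding x l (fun z => Phi ((p, b) :: z))).
  by move=> b; exact: pair_mean_avoiding01.
apply: (le_trans _ (letter_mean_neq mu x uJ)); rewrite lerBrDr -addrA.
have -> : c + q x = - ((2 * l)%:R * q x) by rewrite /c -natr1; ring.
have uE : unit_fun (fun b => pair_mean l (fun z => Phi ((p, b) :: z))).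
  by move=> b; exact: pair_mean01.
set c' := - _; rewrite /H -[c'](letter_mean_cst mu).
have bc' : bounded_by `|c'| (fun=> c') by move=> a.
rewrite -(letter_meanD mu (unit_bounded uE) bc').
apply: (@letter_mean_le _ _ (1 + `|c'|) 1).
- by move=> a; rewrite (le_trans (ler_normD _ _))// lerD2r; exact: (unit_bounded uE).
- exact: (unit_bounded uJ).
by move=> b; exact: IH.
Qed.

Definition fits_mean (x p n m l : nat) Phi : R :=
  word_mean mu n (fun w => (fits m l Phi x p w)%:R).

Lemma fits_mean01 x p n m l Phi : 0 <= fits_mean x p n m l Phi <= 1.
Proof. exact: word_mean_bool01. Qed.

Lemma fits0E m Phi x p w : fits m 0 Phi x p w = (m <= count_mem x (take (size w).-1 w))%N && Phi [::].
Proof. by rewrite /fits size_neighbours take0. Qed.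

Lemma fits_mean0 x p n m Phi : fits_mean x p n m 0 Phi = B n.-1 m x * (Phi [::])%:R.
Proof.
rewrite /fits_mean; case: n => [|n] /=.
  by rewrite /fits/= leqn0; case: m => [|m] /=; rewrite ?mul1r ?mul0r//; case: (Phi _).
rewrite -word_mean_count -word_mean_take mulrC -(@word_meanZ _ _ _ _ 1); last first.
  by move=> w _; case: (_ <= _)%N; rewrite ?normr1 ?normr0.
rewrite -[LHS]/(word_mean mu n.+1 (fun w => (fits m 0 Phi x p w)%:R)); apply: eq_word_mean => w sw; rewrite fits0E sw /=.
by rewrite andbC; case: (Phi _); rewrite ?mul1r ?mul0r.
Qed.

Lemma fits_mean_other x p h n m l Phi : h != x ->
  word_mean mu n.+1 (fun w => (fits m l Phi x p (h :: w))%:R) = fits_mean x h n.+1 m l Phi.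
Proof.
move=> hx; apply: eq_word_mean => -[//|b t] _.
by rewrite /fits /= (negbTE hx).
Qed.

Lemma fits_mean_hit x p b n m l Phi : b != x ->
  word_mean mu n (fun t => (fits m.+1 l.+1 Phi x p (x :: b :: t))%:R) =
  fits_mean x b n m l (fun z => Phi ((p, b) :: z)).
Proof.
move=> bx; apply: eq_word_mean => t _.
by rewrite /fits /= eqxx /= (negbTE bx); case: t.
Qed.

Lemma unit_fits x n m l Phi : unit_fun (fun p => fits_mean x p n m l Phi).
Proof. by move=> p; exact: fits_mean01. Qed.

Lemma fits_mean_skip x p n m l Phi :
  E1 (fun h => (h != x)%:R * fits_mean x h n.+1 m l Phi) <= fits_mean x p n.+2 m l Phi.
Proof.
rewrite -[leRHS]/(E1 (fun h => word_mean mu n.+1 (fun w => (fits m l Phi x p (h :: w))%:R))).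
apply: (@letter_mean_le _ _ 1 1).
- exact/unit_bounded/unit_neqM/unit_fits.
- by move=> a; apply: word_mean_norm; exact: bool_bounded.
move=> h; case: eqP => [_|/eqP hx]; first by rewrite mul0r; have /andP[] := word_mean_bool01 n.+1 (fun w => fits m l Phi x p (h :: w)).
by rewrite mul1r -(fits_mean_other p).
Qed.

(** Either the first letter h is not x, and the search goes on behind h; or it is a
    visit, and if the next letter b is not x the pair read is (p, b) and the search
    goes on behind b. *)
Lemma fits_mean_step x p n m l Phi : p != x ->
  E1 (fun h => (h != x)%:R * fits_mean x h n.+1 m.+1 l.+1 Phi) +
  q x * E1 (fun b => (b != x)%:R * fits_mean x b n m l (fun z => Phi ((p, b) :: z)))
  <= fits_mean x p n.+2 m.+1 l.+1 Phi.
Proof.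
move=> px; rewrite [leRHS]/fits_mean.
have -> : word_mean mu n.+2 (fun w => (fits m.+1 l.+1 Phi x p w)%:R) =
   E1 (fun h => word_mean mu n.+1 (fun w => (fits m.+1 l.+1 Phi x p (h :: w))%:R)) by [].
have bE : bounded_by 1 (fun h => word_mean mu n.+1 (fun w => (fits m.+1 l.+1 Phi x p (h :: w))%:R)).
  by move=> h; apply: word_mean_norm; exact: bool_bounded.
rewrite (letter_mean_split mu x bE); apply: lerD.
  have u := @unit_fits x n.+1 m.+1 l.+1 Phi.
  apply: (@letter_mean_le _ _ 1 1); [exact/unit_bounded/unit_neqM|exact: bounded_neqM|].
  move=> h; case: eqP => [_|/eqP hx]; first by rewrite !mul0r.
  by rewrite fits_mean_other.
have /andP[q0 _] := letter_prob01 mu x; rewrite ler_wpM2l//=.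
apply: (@letter_mean_le _ _ 1 1).
- by apply: unit_bounded; apply: unit_neqM => b; exact: fits_mean01.
- by move=> h; apply: word_mean_norm; exact: bool_bounded.
move=> b; case: eqP => [_|/eqP bx].
  by rewrite mul0r; have /andP[] := word_mean_bool01 n (fun w => fits m.+1 l.+1 Phi x p [:: x, b & w]).
by rewrite mul1r (fits_mean_hit p n m l Phi bx).
Qed.

(** Averaging over the preceding letter p makes it independent of the rest. The
    induction on n follows the recursion of [binom_tail]. *)
Lemma fits_mean_avg x l :
  (forall p n m Phi, (l <= m)%N ->
    B (n - 2 - 2 * l)%N m x * pair_mean_avoiding x l Phi <= fits_mean x p n m l Phi) ->
  forall n m Phi, (l < m)%N ->
    B (n - 1 - 2 * l.+1)%N m x * pair_mean_avoiding x l.+1 Phi <=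
    E1 (fun p => (p != x)%:R * fits_mean x p n m l.+1 Phi).
Proof.
move=> IHl n [//|m] Phi; rewrite ltnS => lm.
have E0 k : 0 <= E1 (fun p => (p != x)%:R * fits_mean x p k m.+1 l.+1 Phi).
  by apply: letter_mean_ge0 => p; rewrite mulr_ge0//; have /andP[] := fits_mean01 x p k m.+1 l.+1 Phi.
elim/ltn_ind: n => -[|[|n]] IHn.
- by rewrite /= mul0r.
- by rewrite /= mul0r.
case: (leqP (2 * l.+1) n) => ln; last first.
  by rewrite (_ : (n.+2 - 1 - 2 * l.+1 = 0)%N) /= ?mul0r//; lia.
have -> : (n.+2 - 1 - 2 * l.+1 = (n - 2 * l.+1).+1)%N by lia.
have := IHn n.+1 (ltnSn _); rewrite subSS subn0 => IHn1.
set k := (n - 2 * l.+1)%N in IHn1 *.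
have kE : (n - 2 - 2 * l)%N = k by rewrite /k; lia.
pose J := pair_mean_avoiding x l.+1 Phi.
pose K p := E1 (fun b => (b != x)%:R * pair_mean_avoiding x l (fun z => Phi ((p, b) :: z))).
have uK : unit_fun K.
  move=> p; apply: unit_letter_mean; apply: unit_neqM => b; exact: pair_mean_avoiding01.
have /andP[q0 q1] := letter_prob01 mu x.
have /andP[b0 b1] := binom_tail01 k m (letter_prob01 mu x).
have low p : p != x ->
    B k m.+1 x * J + q x * B k m x * K p <= fits_mean x p n.+2 m.+1 l.+1 Phi.
  move=> px; apply: (le_trans _ (fits_mean_step n m l Phi px)); apply: lerD; first exact: IHn1.
  have bJ : bounded_by 1 (fun b => (b != x)%:R *
      pair_mean_avoiding x l (fun z => Phi ((p, b) :: z))).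
    by apply: unit_bounded; apply: unit_neqM => b; exact: pair_mean_avoiding01.
  rewrite -mulrA ler_wpM2l// /K -(letter_meanZ mu _ bJ).
  apply: (@letter_mean_le _ _ 1 1).
  - move=> b; rewrite normrM ger0_norm// -[leRHS]mulr1 ler_pM//.
  - by apply: unit_bounded; apply: unit_neqM => b; exact: fits_mean01.
  move=> b; rewrite mulrCA; case: eqP => [_|_]; first by rewrite !mul0r.
  by rewrite !mul1r -kE; exact: IHl.
have bK : bounded_by 1 (fun p => (p != x)%:R * K p) by exact/unit_bounded/unit_neqM.
rewrite -/J; have -> : B k.+1 m.+1 x * J = E1 (fun p => (p != x)%:R * (B k m.+1 x * J) +
    (q x * B k m x) * ((p != x)%:R * K p)).
  rewrite (@letter_meanD _ mu `|B k m.+1 x * J| `|q x * B k m x|).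
  - by rewrite letter_mean_neq_cst (letter_meanZ _ _ bK) -/(pair_mean_avoiding x l.+1 Phi) -/J /=; ring.
  - by move=> a; case: (_ != _); rewrite ?mul1r ?mul0r ?normr0.
  - by move=> a; rewrite normrM ler_piMr//; exact: bK.
apply: (@letter_mean_le _ _ (`|B k m.+1 x * J| + `|q x * B k m x|) 1).
- move=> a; rewrite (le_trans (ler_normD _ _))// lerD//.
    by case: (_ != _); rewrite ?mul1r ?mul0r ?normr0.
  by rewrite normrM ler_piMr//; exact: bK.
- exact/unit_bounded/unit_neqM/unit_fits.
move=> p; case: eqP => [_|/eqP px]; first by rewrite !mul0r mulr0 addr0.
by rewrite !mul1r; exact: low.
Qed.

(** As long as the pairs avoid x, having m visits and passing the test are
    independent, at the cost of the letters consumed by the pairs. *)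
Lemma fits_mean_ge x l p n m Phi : (l <= m)%N ->
  B (n - 2 - 2 * l)%N m x * pair_mean_avoiding x l Phi <= fits_mean x p n m l Phi.
Proof.
elim: l p n m Phi => [|l IHl] p n m Phi lm.
  rewrite fits_mean0 /= ler_wpM2r//; apply: binom_tail_incr; [exact: letter_prob01|lia].
have L0 k : 0 <= fits_mean x p k m l.+1 Phi by case/andP: (fits_mean01 x p k m l.+1 Phi).
case: n => [|[|n]]; try by case: m lm L0 => [//|m] lm L0; rewrite /= mul0r.
exact: le_trans (@fits_mean_avg x l IHl n.+1 m Phi lm) (fits_mean_skip x p n m l.+1 Phi).
Qed.

Lemma sum_count_le (w : seq nat) A K : (\sum_(A <= x < K) count_mem x w <= size w)%N.
Proof.
elim: w => [|a w IH]; first by rewrite big1.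
rewrite /= big_split /= -[leqRHS]add1n leq_add//.
by under eq_bigr do rewrite eq_sym; exact: sum_eq_range_le1.
Qed.

Lemma repeats_le_size m w : (0 < m)%N -> (repeats m w <= size w)%N.
Proof.
move=> m0; apply: leq_trans (sum_count_le w 1 (letter_bound w)).
apply: leq_sum => x _; case: (leqP m _) => // h; exact: leq_trans m0 h.
Qed.

Lemma sum_range_le (f : nat -> nat) A K : (A <= K)%N ->
  (\sum_(1 <= x < A) f x <= \sum_(1 <= x < K) f x)%N.
Proof.
move=> AK; have [->|A0] := posnP A; first by rewrite big_geq.
by rewrite [leqRHS](big_cat_nat (n := A))//= leq_addr.
Qed.

Lemma census_ge m l Phi w K : (0 < m)%N ->
  (\sum_(1 <= x < K) fits m l Phi x 0 w <= census m l Phi w)%N.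
Proof.
move=> m0; rewrite (@censusE m l Phi w (maxn K (letter_bound w)))// ?leq_maxr//.
by apply: sum_range_le; rewrite leq_maxl.
Qed.

Lemma repeats_ge m w K : (0 < m)%N ->
  (\sum_(1 <= x < K) (m <= count_mem x w) <= repeats m w)%N.
Proof.
move=> m0; rewrite (@repeatsE m w (maxn K (letter_bound w)))// ?leq_maxr//.
by apply: sum_range_le; rewrite leq_maxl.
Qed.

Lemma letter_bound_take n w : (letter_bound (take n w) <= letter_bound w)%N.
Proof.
rewrite ltnS; apply/bigmax_leqP_seq => a /mem_take aw _.
by rewrite (@leq_bigmax_seq _ w xpredT id).
Qed.

(** The pairs either pass the test or its negation, which turns lower bounds
    valid for all tests into upper bounds. *)
Lemma censusC m l Phi w : (0 < m)%N ->
  (census m l Phi w + census m l (predC Phi) w = repeats m (take (size w).-1 w))%N.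
Proof.
move=> m0; rewrite (@repeatsE m _ (letter_bound w))//; last exact: letter_bound_take.
rewrite /census -big_split /=; apply: eq_bigr => x _.
rewrite -(size_neighbours x 0) /fits /=; case: (_ <= _)%N => //=.
by case: (Phi _).
Qed.

Lemma repeats_cons m a w : (0 < m)%N ->
  (repeats m w <= repeats m (a :: w) <= (repeats m w).+1)%N.
Proof.
move=> m0; set K := maxn (letter_bound w) (letter_bound (a :: w)).
rewrite (@repeatsE m w K) ?leq_maxl// (@repeatsE m _ K) ?leq_maxr//; apply/andP; split.
  by apply: leq_sum => x _ /=; case: (leqP m (count_mem x w)) => // h;
    rewrite (leq_trans h)// leq_addl.
rewrite -[leqRHS]add1n; apply: (@leq_trans (\sum_(1 <= x < K) ((x == a) + (m <= count_mem x w)))); last first.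
  by rewrite big_split /= leq_add// sum_eq_range_le1.
apply: leq_sum => x _ /=; rewrite eq_sym; case: eqP => //= _; exact/(leq_trans (leq_b1 _)).
Qed.

Lemma census_le_size m l Phi w : (0 < m)%N -> (census m l Phi w <= size w)%N.
Proof.
move=> m0; apply: (@leq_trans (repeats m (take (size w).-1 w))).
  by rewrite -(censusC l Phi w m0) leq_addr.
by rewrite (leq_trans (repeats_le_size _ m0))// size_take; case: ltnP => // /ltnW.
Qed.

Definition mean_repeats n m : R := word_mean mu n (fun w => (repeats m w)%:R).
Definition mean_census n m l Phi : R := word_mean mu n (fun w => (census m l Phi w)%:R).

Lemma repeats_bounded n m : (0 < m)%N -> word_bounded n (fun w => (repeats m w)%:R : R) n%:R.
Proof. by move=> m0 w <-; rewrite normr_nat ler_nat repeats_le_size. Qed.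

Lemma census_bounded n m l Phi : (0 < m)%N ->
  word_bounded n (fun w => (census m l Phi w)%:R : R) n%:R.
Proof. by move=> m0 w <-; rewrite normr_nat ler_nat census_le_size. Qed.

Lemma mean_repeatsS n m : (0 < m)%N ->
  mean_repeats n m <= mean_repeats n.+1 m <= mean_repeats n m + 1.
Proof.
move=> m0; rewrite /mean_repeats.
have bc a : word_bounded n (fun w => (repeats m (a :: w))%:R : R) n.+1%:R.
  by move=> w sw; apply: (repeats_bounded m0); rewrite /= sw.
have bn := @repeats_bounded n m m0.
have bE : bounded_by n.+1%:R (fun a => word_mean mu n (fun w => (repeats m (a :: w))%:R)).
  by move=> a; exact: word_mean_norm.
apply/andP; split.
  rewrite -(letter_mean_cst mu (word_mean _ n _)) /=.
  apply: (@letter_mean_le _ _ n%:R n.+1%:R) => // a; first exact: word_mean_norm.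
  apply: (@word_mean_le _ _ _ _ _ n%:R n.+1%:R) => // w _.
  by rewrite ler_nat; case/andP: (repeats_cons a w m0).
have b1 : word_bounded n (fun=> 1 : R) 1 by move=> w _; rewrite normr1.
rewrite -(letter_mean_cst mu (_ + 1)) /=.
apply: (@letter_mean_le _ _ n.+1%:R (n%:R + 1)) => // a.
  by rewrite (le_trans (ler_normD _ _))// normr1 lerD2r word_mean_norm.
rewrite -[X in _ + X](word_mean_cst mu n) -(word_meanD mu bn b1).
apply: (@word_mean_le _ _ _ _ _ n.+1%:R (n%:R + 1)) => //; first exact: word_boundedD.
by move=> w _; rewrite natr1 ler_nat; case/andP: (repeats_cons a w m0).
Qed.

Lemma sum_binom_tail_le K n m : (0 < m)%N ->
  \sum_(1 <= x < K) B n m x <= mean_repeats n m.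
Proof.
move=> m0; rewrite /mean_repeats.
under eq_bigr do rewrite -word_mean_count.
rewrite -(@word_mean_sum _ _ _ _ _ _ 1); last by move=> x; exact: bool_bounded.
apply: (@word_mean_le _ _ _ _ _ (\sum_(1 <= x < K) 1) n%:R).
- move=> w _; rewrite (le_trans (ler_norm_sum _ _ _))//; apply: ler_sum => x _.
  by rewrite normr_nat; case: (_ <= _)%N; rewrite ?ler01.
- exact: repeats_bounded.
by move=> w _; rewrite -natr_sum ler_nat repeats_ge.
Qed.

(** For a given word the counts are eventually constant in K; dominated convergence. *)
Lemma sum_binom_tail_cvg n m : (0 < m)%N ->
  \sum_(1 <= x < K) B n m x @[K --> \oo] --> mean_repeats n m.
Proof.
move=> m0; pose F K (w : seq nat) : R := (\sum_(1 <= x < K) (m <= count_mem x w))%N%:R.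
have -> : (fun K => \sum_(1 <= x < K) B n m x) = (fun K => word_mean mu n (F K)).
  apply/funext => K; under eq_bigr do rewrite -word_mean_count.
  rewrite -(@word_mean_sum _ _ _ _ _ _ 1); last by move=> x; exact: bool_bounded.
  by apply: eq_word_mean => w _; rewrite /F natr_sum.
apply: (@word_mean_cvg _ _ _ n%:R) => [K w <-|w].
  by rewrite normr_nat ler_nat (leq_trans (repeats_ge _ _ m0))// repeats_le_size.
apply: cvg_near_cst; exists (letter_bound w) => // K wK.
by rewrite /F -(repeatsE m0 wK).
Qed.

Lemma sum_letter_prob_le1 K : \sum_(1 <= x < K) q x <= 1.
Proof.
apply: (@le_trans _ _ (\sum_(1 <= x < K) B 1 1 x)).
  by apply: ler_sum => x _ /=; rewrite mulr0 add0r mulr1.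
rewrite (le_trans (sum_binom_tail_le _ _ _))//.
rewrite (le_trans (ler_norm _))// -[1]/(1%:R); apply: word_mean_norm; exact: repeats_bounded.
Qed.

(** [fits_mean_ge] summed over the states; the errors (2 l) q x add up to at
    most 2 l because the probabilities sum to at most one. *)
Lemma mean_census_ge n m l Phi : (0 < m)%N -> (l <= m)%N ->
  pair_mean l Phi * mean_repeats (n - 2 - 2 * l)%N m - (2 * l)%:R <= mean_census n m l Phi.
Proof.
move=> m0 lm; set k := (n - 2 - 2 * l)%N.
have /andP[z0 z1] := pair_mean01 l Phi.
have cK : pair_mean l Phi * (\sum_(1 <= x < K) B k m x) - (2 * l)%:R @[K --> \oo] -->
    pair_mean l Phi * mean_repeats k m - (2 * l)%:R.
  apply: cvgB; last exact: cvg_cst.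
  by apply: cvgMr; exact: sum_binom_tail_cvg.
rewrite -(cvg_lim _ cK)//; apply: limr_le; first by apply/cvg_ex; eexists; exact: cK.
apply: nearW => K.
apply: (@le_trans _ _ (\sum_(1 <= x < K) fits_mean x 0 n m l Phi)); last first.
  rewrite /fits_mean -(@word_mean_sum _ _ _ _ _ _ 1); last by move=> x; exact: bool_bounded.
  apply: (@word_mean_le _ _ _ _ _ (\sum_(1 <= x < K) 1) n%:R).
  - move=> w _; rewrite (le_trans (ler_norm_sum _ _ _))//; apply: ler_sum => x _.
    by rewrite normr_nat; case: (fits _ _ _ _ _ _); rewrite ?ler01.
  - exact: census_bounded.
  by move=> w _; rewrite -natr_sum ler_nat census_ge.
apply: (@le_trans _ _ (\sum_(1 <= x < K) (pair_mean l Phi * B k m x - (2 * l)%:R * q x))).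
  rewrite sumrB -!mulr_sumr lerD2l lerN2 -[leRHS]mulr1 ler_wpM2l//.
  exact: sum_letter_prob_le1.
apply: ler_sum => x _; apply: le_trans (fits_mean_ge x 0 n Phi lm).
have /andP[b0 b1] := binom_tail01 k m (letter_prob01 mu x).
have := pair_mean_avoiding_ge x l Phi => h.
apply: (@le_trans _ _ (B k m x * (pair_mean l Phi - (2 * l)%:R * q x))); last by rewrite ler_wpM2l.
rewrite mulrBr mulrC lerD2l lerN2 ler_piMl// mulr_ge0//.
by case/andP: (letter_prob01 mu x).
Qed.

(** The lower bound for the negated test, subtracted from the total [censusC]. *)
Lemma mean_census_le n m l Phi : (0 < m)%N -> (l <= m)%N ->
  mean_census n m l Phi <=
  mean_repeats n.-1 m - (1 - pair_mean l Phi) * mean_repeats (n - 2 - 2 * l)%N m + (2 * l)%:R.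
Proof.
move=> m0 lm; have h := mean_census_ge n (predC Phi) m0 lm.
have := pair_meanC l Phi => hZ.
have E : mean_census n m l Phi + mean_census n m l (predC Phi) = mean_repeats n.-1 m.
  rewrite /mean_census -(word_meanD mu (@census_bounded n m l Phi m0) (@census_bounded n m l (predC Phi) m0)).
  case: n {h} => [|n]; first by rewrite /mean_repeats /= -natrD censusC.
  rewrite /mean_repeats -(word_mean_take mu n); apply: eq_word_mean => w sw.
  by rewrite -natrD censusC// sw.
have -> : 1 - pair_mean l Phi = pair_mean l (predC Phi) by rewrite -hZ; ring.
by rewrite -E; nra.
Qed.

End CensusMean.

(** * A strong law for nondecreasing counts of small variance *)

Section CensusVariance.
Context {R : realType} (mu : probability nat R).

(** The Efron-Stein bound with [census_sensitivity]. A variance of the order of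
    the mean is what the strong law needs. *)
Lemma census_variance n m l Phi : (0 < m)%N -> (l <= m)%N ->
  word_mean mu n (fun w => ((census m l Phi w)%:R - mean_census mu n m l Phi) ^+ 2) <=
  (9 * m)%:R * mean_repeats mu n 1.
Proof.
move=> m0 lm; have bc := @census_bounded R n m l Phi m0.
have bd i : (i < n)%N -> word_bounded n
    (fun w => ((census m l Phi w)%:R - (census m l Phi (blank i w))%:R : R) ^+ 2) ((n%:R + n%:R) ^+ 2).
  move=> ilt; apply: word_bounded_sqr; apply: word_boundedB => // w sw.
  by apply: bc; exact: size_blank.
rewrite (word_mean_variance mu bc).
rewrite lerBlDl; apply: (le_trans (efron_stein mu bc)); rewrite lerD2l.
rewrite -(word_meanZ mu _ (@repeats_bounded R n 1 isT)).
have E : \sum_(i < n) word_mean mu n (fun w =>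
    ((census m l Phi w)%:R - (census m l Phi (blank i w))%:R) ^+ 2) =
  word_mean mu n (fun w => \sum_(i < n)
    ((census m l Phi w)%:R - (census m l Phi (blank i w))%:R) ^+ 2).
  rewrite (@word_mean_sum _ mu n _ (index_enum 'I_n) (fun i w =>
    ((census m l Phi w)%:R - (census m l Phi (blank i w))%:R) ^+ 2) ((n%:R + n%:R) ^+ 2))//.
  by move=> i; exact: bd.
rewrite E.
apply: (@word_mean_le _ _ _ _ _ (\sum_(i < n) (n%:R + n%:R) ^+ 2) (`|(9 * m)%:R| * n%:R)).
- move=> w sw; rewrite (le_trans (ler_norm_sum _ _ _))//; apply: ler_sum => i _; exact: bd.
- by apply: word_boundedZ; exact: repeats_bounded.
by move=> w sw; have := census_sensitivity (R := R) Phi w m0 lm; rewrite sw -natrM.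
Qed.

End CensusVariance.

Section MonotoneInterpolation.
Context {R : realType}.
Variables (m : nat -> R) (m_unb : m n @[n --> \oo] --> +oo).
Hypotheses (m0 : m 0%N < 1) (m_incr : {homo m : i j / (i <= j)%N >-> i <= j}).
Hypothesis m_step : forall n, m n.+1 <= m n + 1.

Let reach j : exists n, j.+1%:R ^+ 2 <= m n.
Proof.
move/cvgryPge : m_unb => /(_ (j.+1%:R ^+ 2)) [N _ h]; exists N; exact: (h N (leqnn N)).
Qed.

(** The squares are sparse enough for their inverses to be summable and dense
    enough for consecutive ones to be equivalent. *)
Definition milestone j := ex_minn (reach j).

Lemma milestone_ge j : j.+1%:R ^+ 2 <= m (milestone j).
Proof. by rewrite /milestone; case: ex_minnP. Qed.

Lemma milestone_le j n : j.+1%:R ^+ 2 <= m n -> (milestone j <= n)%N.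
Proof. by rewrite /milestone; case: ex_minnP => k _; apply. Qed.

Lemma milestone_lt j n : m n < j.+1%:R ^+ 2 -> (n < milestone j)%N.
Proof.
rewrite ltNge => h; rewrite ltnNge; apply/negP => h2; case/negP: h.
exact: le_trans (milestone_ge j) (m_incr h2).
Qed.

Lemma milestone_bound j : m (milestone j) <= j.+1%:R ^+ 2 + 1.
Proof.
have : (0 < milestone j)%N.
  apply: milestone_lt; apply: (lt_le_trans m0).
  by rewrite -natrX ler1n expn_gt0.
case E : (milestone j) => [//|k] _; apply: (le_trans (m_step k)); rewrite lerD2r ltW// ltNge.
by apply/negP => /milestone_le; rewrite E ltnn.
Qed.

Lemma milestone_unb : milestone j @[j --> \oo] --> \oo.
Proof.
apply/cvgnyPge => A.
have [k hk] : exists k, m A < k.+1%:R ^+ 2.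
  exists (Num.truncn `|m A|); apply: (le_lt_trans (ler_norm _)).
  apply: (lt_le_trans (truncnS_gt _)); rewrite -natrX ler_nat; exact: leq_pmulr.
exists k => // j /= kj; apply/ltnW/milestone_lt; apply: (lt_le_trans hk).
by rewrite lerXn2r ?nnegrE ?ler_nat.
Qed.

Lemma ratio_cvg1 : (j.+2%:R / j.+1%:R : R) @[j --> \oo] --> (1 : R).
Proof.
have -> : (fun j => j.+2%:R / j.+1%:R : R) = (fun j => 1 + j.+1%:R^-1).
  apply/funext => j; have : (j.+1%:R : R) != 0 by rewrite pnatr_eq0.
  by move=> h; rewrite -(natr1 j.+1) mulrDl divff// mul1r.
rewrite -[X in _ --> X]addr0; apply: cvgD; first exact: cvg_cst.
exact: cvg_harmonic.
Qed.

(** Between two consecutive milestones x lies between its values there, and m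
    between two consecutive squares. *)
Lemma monotone_interpolation (x : nat -> R) (c : R) :
  (forall n, 0 <= x n) -> {homo x : i j / (i <= j)%N >-> i <= j} ->
  x (milestone j) / j.+1%:R ^+ 2 @[j --> \oo] --> c ->
  x n / m n @[n --> \oo] --> c.
Proof.
move=> x0 xm xc.
(* J n is the last milestone passed at time n: (J n + 1)^2 <= m n < (J n + 2)^2 *)
pose J n := (Num.truncn (Num.sqrt (m n))).-1.
pose y j := x (milestone j) / j.+1%:R ^+ 2.
have Jb n : 1 <= m n -> (J n).+1%:R ^+ 2 <= m n < (J n).+2%:R ^+ 2.
  move=> mn1; have s1 : 1 <= Num.sqrt (m n) by rewrite -sqrtr1 ler_sqrt// (le_trans ler01).
  have t1 : (0 < Num.truncn (Num.sqrt (m n)))%N by rewrite truncn_ge_nat// (le_trans ler01).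
  have m0' : 0 <= m n by rewrite (le_trans ler01).
  rewrite /J prednK// -{2 3}(sqr_sqrtr m0').
  have /andP[ha hb] := truncn_itv (sqrtr_ge0 (m n)).
  by rewrite lerXn2r ?nnegrE ?sqrtr_ge0//= ltrXn2r ?nnegrE ?sqrtr_ge0.
have near1 : \forall n \near \oo, 1 <= m n by move/cvgryPge : m_unb; exact.
have J_unb : J n @[n --> \oo] --> \oo.
  apply/cvgnyPge => A; move/cvgryPge : m_unb => /(_ (A.+1%:R ^+ 2)).
  apply: filterS2 near1 => n mn1 hA; have /andP[_ h] := Jb n mn1.
  have := le_lt_trans hA h; rewrite -!natrX ltr_nat ltn_sqr; lia.
have J1_unb : (J n).+1 @[n --> \oo] --> \oo.
  apply/cvgnyPge => A; move/cvgnyPge : J_unb => /(_ A); apply: filterS => n; exact: leqW.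
have ratio2 : ((J n).+2%:R / (J n).+1%:R : R) ^+ 2 @[n --> \oo] --> (1 : R).
  have h : (j.+2%:R / j.+1%:R : R) ^+ 2 @[j --> \oo] --> (1 : R).
    by rewrite -[X in _ --> X]mulr1; apply: cvgM; exact: ratio_cvg1.
  exact: (cvg_comp _ _ J_unb h).
apply: (@squeeze_cvgr _ _ _ _
  (fun n => y (J n) * (((J n).+2%:R / (J n).+1%:R) ^+ 2)^-1)
  (fun n => y (J n).+1 * ((J n).+2%:R / (J n).+1%:R) ^+ 2)).
- apply: filterS near1 => n mn1; have /andP[h1 h2] := Jb n mn1.
  have p1 : 0 < (J n).+1%:R :> R by [].
  have p2 : 0 < (J n).+2%:R :> R by [].
  have mp : 0 < m n by rewrite (lt_le_trans ltr01).
  apply/andP; split.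
    have -> : y (J n) * (((J n).+2%:R / (J n).+1%:R) ^+ 2)^-1 =
        x (milestone (J n)) / (J n).+2%:R ^+ 2.
      by rewrite /y; field; rewrite ?gt_eqF//.
    rewrite ler_pM ?invr_ge0 ?sqr_ge0//; first by apply: xm; exact: milestone_le.
    by rewrite lef_pV2 ?posrE ?exprn_gt0// ltW.
  have -> : y (J n).+1 * ((J n).+2%:R / (J n).+1%:R) ^+ 2 =
      x (milestone (J n).+1) / (J n).+1%:R ^+ 2.
    by rewrite /y; field; rewrite ?gt_eqF//.
  rewrite ler_pM ?invr_ge0 ?(ltW mp)//; first by apply/xm/ltnW; exact: milestone_lt.
  by rewrite lef_pV2 ?posrE ?exprn_gt0.
- rewrite -[X in _ --> X]mulr1; apply: cvgM; first exact: (cvg_comp _ _ J_unb xc).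
  by rewrite -[X in _ --> X]invr1; apply: cvgV; rewrite ?oner_neq0.
- rewrite -[X in _ --> X]mulr1; apply: cvgM => //; exact: (cvg_comp _ _ J1_unb xc).
Qed.

Lemma milestone_mean (a : nat -> R) (c : R) : a n / m n @[n --> \oo] --> c ->
  a (milestone j) / j.+1%:R ^+ 2 @[j --> \oo] --> c.
Proof.
move=> ac.
have mr : m (milestone j) / j.+1%:R ^+ 2 @[j --> \oo] --> (1 : R).
  apply: (@squeeze_cvgr _ _ _ _ (fun=> 1) (fun j => 1 + j.+1%:R^-1)).
  - apply: nearW => j; have p1 : 0 < j.+1%:R ^+ 2 :> R by rewrite exprn_gt0.
    rewrite ler_pdivlMr// mul1r milestone_ge ler_pdivrMr//=.
    apply: (le_trans (milestone_bound j)); rewrite mulrDl mul1r lerD2l expr2 mulKf ?pnatr_eq0//.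
    by rewrite ler1n.
  - exact: cvg_cst.
  - rewrite -[X in _ --> X]addr0; apply: cvgD; first exact: cvg_cst.
    exact: cvg_harmonic.
have -> : (fun j => a (milestone j) / j.+1%:R ^+ 2) =
  (fun j => (a (milestone j) / m (milestone j)) * (m (milestone j) / j.+1%:R ^+ 2)).
  apply/funext => j; have mp : 0 < m (milestone j).
    by rewrite (lt_le_trans _ (milestone_ge j))// exprn_gt0.
  by rewrite mulrA divfK// gt_eqF.
rewrite -[X in _ --> X]mulr1; apply: cvgM => //; exact: (cvg_comp _ _ milestone_unb ac).
Qed.

End MonotoneInterpolation.

Section AlmostSure.
Context {R : realType} {d : measure_display} {T : measurableType d}.
Variable P : probability T R.

(** The sum of the squares has a finite mean, so it is almost surely finite and
    its terms tend to 0. *)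
Lemma ae_cvg0_of_summable_sqr (Y : nat -> T -> R) (b : nat -> R) :
  (forall j, measurable_fun setT (Y j)) ->
  (forall j, (\int[P]_w ((Y j w) ^+ 2)%:E <= (b j)%:E)%E) ->
  (\sum_(j <oo) (b j)%:E < +oo)%E ->
  \forall w \ae P, Y j w @[j --> \oo] --> (0 : R).
Proof.
move=> mY Yb bfin.
pose f j w : \bar R := ((Y j w) ^+ 2)%:E.
have m2 j : measurable_fun setT (f j).
  by apply/measurable_EFinP; exact: measurable_funX.
have p2 j w : (0 <= f j w)%E by rewrite lee_fin sqr_ge0.
pose S w : \bar R := (\sum_(j <oo) f j w)%E.
have mS : measurable_fun setT S by exact: ge0_emeasurable_sum.
have iS : P.-integrable setT S.
  apply/integrableP; split=> //.
  under eq_integral => w _ do rewrite gee0_abs ?nneseries_ge0//.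
  rewrite integral_nneseries//; apply: le_lt_trans bfin; apply: lee_nneseries => [j _ _|j _].
    by apply: integral_ge0 => w _.
  exact: Yb.
have := integrable_ae measurableT iS; apply: filterS => w /(_ I) fw.
have cw : cvgn (series (fun j => (Y j w) ^+ 2)).
  apply: nnseries_is_cvg; first by move=> i; exact: sqr_ge0.
  by rewrite ltey_eq fw.
have h := cvg_series_cvg_0 cw.
apply/cvgr0Pnorm_lt => e e0; move/cvgr0Pnorm_lt: h => /(_ (e ^+ 2)).
rewrite exprn_gt0// => /(_ isT); apply: filterS => j.
by rewrite normrX ltr_pXn2r ?nnegrE// ltW.
Qed.

Lemma summable_inv_sqr (C : R) : 0 <= C ->
  (\sum_(j <oo) (C / j.+1%:R ^+ 2)%:E < +oo)%E.
Proof.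
move=> C0.
apply: (@le_lt_trans _ _ (C * 2)%:E); last exact: ltry.
apply: lime_le.
  by apply: is_cvg_nneseries => n _ _; rewrite lee_fin divr_ge0// sqr_ge0.
apply: nearW => n; rewrite sumEFin lee_fin.
(* telescoping, since 1 / (x + 1)^2 <= 1 / x - 1 / (x + 1) *)
suff h : \sum_(0 <= j < n.+1) C / j.+1%:R ^+ 2 <= C * (2 - n.+1%:R^-1).
  apply: (@le_trans _ _ (\sum_(0 <= j < n.+1) C / j.+1%:R ^+ 2)).
    by rewrite big_nat_recr//= lerDl divr_ge0// sqr_ge0.
  by rewrite (le_trans h)// ler_wpM2l// gerBl invr_ge0.
elim: n => [|n IH].
  by rewrite big_nat1 expr1n !divr1 ler_peMr// invr1; lra.
rewrite big_nat_recr//=; apply: (le_trans (lerD IH (lexx _))).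
rewrite -mulrDr ler_wpM2l//.
have p1 : 0 < n.+1%:R :> R by [].
have -> : n.+2%:R = n.+1%:R + 1 :> R by rewrite natr1.
set x := n.+1%:R in p1 *.
rewrite -subr_ge0.
have -> : 2 - (x + 1)^-1 - (2 - x^-1 + ((x + 1) ^+ 2)^-1) = (x * (x + 1) ^+ 2)^-1.
  by field; rewrite !gt_eqF// addr_gt0.
by rewrite invr_ge0 mulr_ge0 ?sqr_ge0// ltW.
Qed.

(** At the j-th milestone the variance is of order j^2 and the squared
    normalization is j^4, which leaves a summable series. *)
Lemma monotone_slln (X : nat -> T -> R) (m a : nat -> R) (c C : R) :
  m n @[n --> \oo] --> +oo -> m 0%N < 1 -> {homo m : i j / (i <= j)%N >-> i <= j} ->
  (forall n, m n.+1 <= m n + 1) ->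
  (forall n, measurable_fun setT (X n)) -> (forall n w, 0 <= X n w) ->
  (forall w, {homo X^~ w : i j / (i <= j)%N >-> i <= j}) ->
  0 <= C -> (forall n, (\int[P]_w ((X n w - a n) ^+ 2)%:E <= (C * (m n + 1))%:E)%E) ->
  a n / m n @[n --> \oo] --> c ->
  \forall w \ae P, X n w / m n @[n --> \oo] --> c.
Proof.
move=> m_unb m0 m_incr m_step mX X0 X_incr C0 varX am.
pose N := milestone m_unb.
pose Y j w := (X (N j) w - a (N j)) / j.+1%:R ^+ 2.
have h : \forall w \ae P, Y j w @[j --> \oo] --> (0 : R).
  apply: (@ae_cvg0_of_summable_sqr Y (fun j => (3 * C) / j.+1%:R ^+ 2)).
  - move=> j; apply: measurable_funM => //; exact: measurable_funB.
  - move=> j.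
    have p1 : 0 < j.+1%:R ^+ 2 :> R by rewrite exprn_gt0.
    have x0 : j.+1%:R != 0 :> R by rewrite pnatr_eq0.
    have -> : (fun w => ((Y j w) ^+ 2)%:E) =
        (fun w => ((j.+1%:R ^+ 4)^-1%:E * ((X (N j) w - a (N j)) ^+ 2)%:E)%E).
      by apply/funext => w; rewrite -EFinM /Y; congr EFin; move: (j.+1%:R) x0 => x x0; field.
    have mq : measurable_fun setT (fun w => ((X (N j) w - a (N j)) ^+ 2)%:E).
      by apply/measurable_EFinP/measurable_funX/measurable_funB.
    have q0 w : setT w -> (0 <= ((X (N j) w - a (N j)) ^+ 2)%:E)%E.
      by rewrite lee_fin sqr_ge0.
    rewrite (ge0_integralZl_EFin P measurableT q0 mq)//.
    apply: (le_trans (lee_wpmul2l _ (varX _))); first by rewrite lee_fin invr_ge0 exprn_ge0.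
    rewrite -EFinM lee_fin.
    have hb := milestone_bound m_unb m0 m_incr m_step j.
    have q1 : 1 <= j.+1%:R ^+ 2 :> R by rewrite -natrX ler1n expn_gt0.
    have -> : 3 * C / j.+1%:R ^+ 2 = (j.+1%:R ^+ 4)^-1 * (C * (3 * j.+1%:R ^+ 2)).
      by move: (j.+1%:R) x0 => x x0; field.
    rewrite ler_wpM2l ?invr_ge0 ?exprn_ge0// ler_wpM2l//.
    by rewrite -/(N j) in hb; lra.
  - by apply: summable_inv_sqr; rewrite mulr_ge0.
apply: filterS h => w hw.
apply: (monotone_interpolation (m_unb := m_unb)) => //.
have -> : (fun j => X (milestone m_unb j) w / j.+1%:R ^+ 2) =
    (fun j => Y j w + a (N j) / j.+1%:R ^+ 2).
  by apply/funext => j; rewrite /Y -mulrDl subrK.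
rewrite -[X in _ --> X]add0r; apply: cvgD => //.
exact: milestone_mean.
Qed.

End AlmostSure.

(** * Words read along a path of independent letters *)

Section LetterSeries.
Context {R : realType} (mu : probability nat R).

(** Countable additivity over the singletons. *)
Lemma letter_mean_series C f : bounded_by C f -> (forall a, 0 <= f a) ->
  (letter_mean mu f)%:E = (\sum_(a <oo) (letter_prob mu a * f a)%:E)%E.
Proof.
move=> bf f0; have fi := bounded_integrable mu bf.
rewrite /letter_mean /Rintegral fineK; last exact: integrable_fin_num.
have E : \bigcup_a [set a] = [set: nat] by apply/seteqP; split => // a _; exists a.
have h := @ge0_integral_bigcup _ nat R mu (fun a => [set a]) (EFin \o f).
rewrite /= E in h; rewrite h//; last 2 first.
- by move=> x _; rewrite lee_fin.
- by move=> i j _ _ [x [<- <-]].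
apply: eq_eseriesr => a _; rewrite (eq_integral (cst (f a)%:E)); last first.
  by move=> x /[!inE] ->.
rewrite integral_cst//= muleC EFinM; congr (_ * _)%E.
by rewrite /letter_prob fineK// fin_num_measure.
Qed.

End LetterSeries.

Section PathWord.
Context {R : realType} {d : measure_display} {T : measurableType d}.
Variable P : probability T R.
Variables (p : nat -> R) (xi : nat -> {RV P >-> nat}) (xi_iid : iid p xi).

Definition letter_law : probability nat R := distribution P (xi 1%N).

Lemma letter_law_prob x : letter_prob letter_law x = p x.
Proof. exact: (congr1 fine (xi_iid.2 1%N x isT)). Qed.

Definition path_word (s : nat -> nat) n : seq nat := [seq s i | i <- iota 1 n].

Lemma size_path_word s n : size (path_word s n) = n.
Proof. by rewrite size_map size_iota. Qed.

Definition cylinder (u : seq nat) : set T := [set w | path_word (xi^~ w) (size u) = u].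

Lemma cylinderE u : cylinder u =
  \bigcap_(j in [set` iota 1 (size u)]) ((xi j : T -> nat) @^-1` [set nth 0%N u j.-1]).
Proof.
apply/seteqP; split => w /=.
  move=> <- j /=; rewrite mem_iota size_path_word => /andP[j1 jn].
  rewrite (nth_map 0%N) ?size_iota; last by case: j j1 jn => [//|j] _; rewrite add1n ltnS.
  by rewrite nth_iota ?add1n ?prednK//; case: j j1 jn => [//|j] _; rewrite add1n ltnS.
move=> h; apply: (@eq_from_nth _ 0%N); rewrite size_path_word// => i iu.
rewrite (nth_map 0%N) ?size_iota// nth_iota// add1n.
by apply: (h i.+1); rewrite /= mem_iota add1n ltnS.
Qed.

Lemma measurable_cylinder u : measurable (cylinder u).
Proof.
rewrite cylinderE; apply: fin_bigcap_measurable; first exact: finite_seq.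
by move=> j _; rewrite -[X in measurable X]setTI; exact: measurable_funPT.
Qed.

Lemma cylinder_prob u : P (cylinder u) = (\prod_(a <- u) p a)%:E.
Proof.
rewrite cylinderE; have := xi_iid.1 (iota 1 (size u)) (fun j => [set nth 0%N u j.-1]).
move=> -> //; [|exact: iota_uniq|by move=> j; rewrite mem_iota => /andP[]].
rewrite (big_nth 0%N) -prodEFin /index_iota subn0 (iotaDl 1 0) big_map.
apply: eq_bigr => i _.
by have := xi_iid.2 i.+1 (nth 0%N u i) isT.
Qed.

Lemma measurable_path_fun d' (U : measurableType d') n (F : seq nat -> U) :
  measurable_fun setT (fun w => F (path_word (xi^~ w) n)).
Proof.
move=> _ B _; rewrite setTI.
have -> : (fun w => F (path_word (xi^~ w) n)) @^-1` B =
   \bigcup_(u : seq nat) (if (F u \in B) && (size u == n) then cylinder u else set0).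
  apply/seteqP; split => w /=.
    move=> h; exists (path_word (xi^~ w) n) => //.
    by rewrite mem_set// size_path_word eqxx /cylinder /= size_path_word.
  move=> [u _]; case: ifP => // /andP[/set_mem Fu /eqP <-].
  by rewrite /cylinder/= => ->.
apply: countable_bigcupT_measurable; first exact: countableP.
by move=> u; case: ifP => // _; exact: measurable_cylinder.
Qed.

Lemma path_wordS s n : path_word s n.+1 = rcons (path_word s n) (s n.+1).
Proof. by rewrite /path_word -[X in iota _ X]addn1 iotaD map_cat cats1 add1n. Qed.

Lemma cylinder_split u : cylinder u = \bigcup_a cylinder (rcons u a).
Proof.
apply/seteqP; split => w /=.
  move=> h; exists (xi (size u).+1 w) => //.
  by rewrite /cylinder/= size_rcons path_wordS h.
move=> [a _]; rewrite /cylinder/= size_rcons path_wordS => /rcons_inj [-> _].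
by [].
Qed.

(** Splitting a cylinder according to the next letter reproduces the recursion of
    [word_mean]; independence enters through [cylinder_prob]. *)
Lemma cylinder_mean u n (F : seq nat -> R) C :
  (forall v, size v = n -> 0 <= F (u ++ v)) -> word_bounded n (fun v => F (u ++ v)) C ->
  (\int[P]_(w in cylinder u) (F (path_word (xi^~ w) (size u + n)))%:E =
  (\prod_(a <- u) p a * word_mean letter_law n (fun v => F (u ++ v)))%:E)%E.
Proof.
elim: n u => [|n IH] u F0 bF.
  rewrite addn0 /= cats0 (eq_integral (cst (F u)%:E)); last by move=> w /[!inE] ->.
  rewrite integral_cst; last exact: measurable_cylinder.
  by rewrite [X in (_ * X)%E](cylinder_prob u) -EFinM mulrC.
rewrite [X in integral _ X](cylinder_split u).
rewrite ge0_integral_bigcup; last 4 first.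
- by move=> a; exact: measurable_cylinder.
- by apply: measurable_funTS; apply/measurable_EFinP; exact: measurable_path_fun.
- move=> w; rewrite -cylinder_split => uw; rewrite lee_fin.
  have -> : path_word (xi^~ w) (size u + n.+1) = u ++ [seq xi i w | i <- iota (1 + size u) n.+1].
    by rewrite /path_word iotaD map_cat -/(path_word _ _) uw.
  by apply: F0; rewrite size_map size_iota.
- move=> a b _ _ [w [ha hb]].
  have := ha; rewrite /cylinder /= size_rcons => ha'.
  by have := hb; rewrite /cylinder /= size_rcons ha' => /rcons_inj /(congr1 snd).
have bE : bounded_by C (fun a => word_mean letter_law n (fun v => F (u ++ a :: v))).
  by move=> a; apply: word_mean_norm => v sv; apply: bF; rewrite /= sv.
have E0 a : 0 <= word_mean letter_law n (fun v => F (u ++ a :: v)).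
  by apply: word_mean_ge0 => v sv; apply: F0; rewrite /= sv.
have p0 a : 0 <= p a.
  by rewrite -letter_law_prob; case/andP: (letter_prob01 letter_law a).
rewrite EFinM (letter_mean_series letter_law bE E0) -nneseriesZl; last first.
  by move=> a _; rewrite lee_fin mulr_ge0// letter_law_prob.
apply: eq_eseriesr => a _.
have := IH (rcons u a); rewrite size_rcons addSnnS => ->.
- rewrite -EFinM letter_law_prob -cats1 big_cat big_seq1 mulrA; congr ((_ * _)%:E).
  by apply: eq_word_mean => v _; rewrite -catA.
- by move=> v sv; rewrite cat_rcons; apply: F0; rewrite /= sv.
- by move=> v sv; rewrite cat_rcons; apply: bF; rewrite /= sv.
Qed.

Lemma path_mean n (F : seq nat -> R) C :
  (forall v, size v = n -> 0 <= F v) -> word_bounded n F C ->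
  (\int[P]_w (F (path_word (xi^~ w) n))%:E = (word_mean letter_law n F)%:E)%E.
Proof.
move=> F0 bF; have := @cylinder_mean [::] n F C F0 bF.
by rewrite big_nil mul1r => <-; congr integral; apply/seteqP; split.
Qed.

End PathWord.

(** * The strong law for censuses *)

Section RatioLimits.
Context {R : realType}.

Lemma squeeze_ratio (h m : nat -> R) (s : R) :
  m n @[n --> \oo] --> +oo ->
  (forall e : R, 0 < e -> exists f g (a b : R),
    [/\ f n / m n @[n --> \oo] --> a, g n / m n @[n --> \oo] --> b,
        forall n, f n <= h n <= g n, s - e <= a & b <= s + e]) ->
  h n / m n @[n --> \oo] --> s.
Proof.
move=> moo hyp; apply/cvgrPdist_lt => e e0.
have e20 : 0 < e / 2 by rewrite divr_gt0.
have [f [g [a [b [fa gb fhg sa bs]]]]] := hyp _ e20.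
have m0 : \forall n \near \oo, 0 < m n by move/cvgryPgt : moo; exact.
have h1 : \forall n \near \oo, a - e / 2 < f n / m n.
  by apply: (cvgr_gt _ fa); rewrite ltrBlDr ltrDl.
have h2 : \forall n \near \oo, g n / m n < b + e / 2.
  by apply: (cvgr_lt _ gb); rewrite ltrDl.
apply: filterS3 m0 h1 h2 => n mn n1 n2.
have /andP[fh hg] := fhg n.
have h3 : f n / m n <= h n / m n by rewrite ler_pM2r ?invr_gt0.
have h4 : h n / m n <= g n / m n by rewrite ler_pM2r ?invr_gt0.
by rewrite ltr_norml; apply/andP; split; lra.
Qed.

Lemma bounded_difference_ratio (u f m : nat -> R) (v C : R) :
  m n @[n --> \oo] --> +oo -> (forall n, `|u n - f n| <= C) ->
  f n / m n @[n --> \oo] --> v -> u n / m n @[n --> \oo] --> v.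
Proof.
move=> moo uf fv.
have m0 : \forall n \near \oo, 0 < m n by move/cvgryPgt : moo; exact.
have c0 (D : R) : D / m n @[n --> \oo] --> (0 : R).
  by rewrite -(mulr0 D); apply: cvgMr; apply/gtr0_cvgV0.
apply: (@squeeze_cvgr _ _ _ _ (fun n => f n / m n - C / m n) (fun n => f n / m n + C / m n)).
- apply: filterS m0 => n mn; rewrite -mulrBl -mulrDl !ler_pM2r ?invr_gt0//.
  by move: (uf n); rewrite ler_norml => /andP[? ?]; apply/andP; split; lra.
- by rewrite -[X in _ --> X]subr0; apply: cvgB.
- by rewrite -[X in _ --> X]addr0; apply: cvgD.
Qed.

Lemma ratio_of_ratios (u v m : nat -> R) (a b : R) :
  m n @[n --> \oo] --> +oo -> b != 0 ->
  u n / m n @[n --> \oo] --> a -> v n / m n @[n --> \oo] --> b ->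
  u n / v n @[n --> \oo] --> a / b.
Proof.
move=> moo b0 ua vb.
have h : (u n / m n) * (v n / m n)^-1 @[n --> \oo] --> a / b.
  by apply: cvgM => //; exact: cvgV.
apply: cvg_trans h; apply: near_eq_cvg.
have m0 : \forall n \near \oo, 0 < m n by move/cvgryPgt : moo; exact.
apply: filterS m0 => n mn /=.
by rewrite invfM invrK mulrACA mulVf ?mulr1// gt_eqF.
Qed.

End RatioLimits.

Section CensusMonotone.
Local Open Scope nat_scope.

Lemma neighbours_rcons x p w a : exists s, neighbours x p (rcons w a) = neighbours x p w ++ s.
Proof.
elim: w p => [|h t IH] p; first by exists [::].
case: t IH => [|b t] IH; first by exists (neighbours x p [:: h; a]).
have [s hs] := IH h; exists s.
rewrite -[LHS]/((if h == x then [:: (p, b)] else [::]) ++ neighbours x h (rcons (b :: t) a)).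
by rewrite hs catA.
Qed.

Lemma fits_rcons m l Phi x p w a : l <= m -> fits m l Phi x p w -> fits m l Phi x p (rcons w a).
Proof.
move=> lm; have [s hs] := neighbours_rcons x p w a.
rewrite /fits hs size_cat => /andP[h1 h2]; rewrite (leq_trans h1) ?leq_addr//=.
by rewrite takel_cat// (leq_trans lm).
Qed.

Lemma census_rcons m l Phi w a : 0 < m -> l <= m ->
  census m l Phi w <= census m l Phi (rcons w a).
Proof.
move=> m0 lm; set K := maxn (letter_bound w) (letter_bound (rcons w a)).
rewrite (@censusE m l Phi w K) ?leq_maxl// (@censusE m l Phi (rcons w a) K) ?leq_maxr//.
apply: leq_sum => x _; case: (boolP (fits m l Phi x 0 w)) => // h.
by rewrite (fits_rcons a lm h).
Qed.

Lemma census_path_incr m l Phi s : 0 < m -> l <= m ->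
  {homo (fun n => census m l Phi (path_word s n)) : i j / i <= j}.
Proof.
move=> m0 lm i j; elim: j => [|j IH]; first by rewrite leqn0 => /eqP ->.
rewrite leq_eqVlt => /orP[/eqP -> //|]; rewrite ltnS => /IH /leq_trans; apply.
by rewrite path_wordS; exact: census_rcons.
Qed.

End CensusMonotone.

Section CensusLimit.
Context {R : realType} {d : measure_display} {T : measurableType d}.
Variable P : probability T R.
Variables (p : nat -> R) (xi : nat -> {RV P >-> nat}) (xi_iid : iid p xi).
Local Notation mu := (letter_law xi).

Definition mean_range n : R := mean_repeats mu n 1.

Hypothesis mean_range_unb : mean_range n @[n --> \oo] --> +oo.
Variable c : nat -> R.
Hypothesis mean_repeats_cvg : forall m, (0 < m)%N ->
  mean_repeats mu n m / mean_range n @[n --> \oo] --> c m.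

Lemma mean_repeats_incr m : (0 < m)%N ->
  {homo (fun n => mean_repeats mu n m) : i j / (i <= j)%N >-> i <= j}.
Proof.
move=> m0 i j; elim: j => [|j IH]; first by rewrite leqn0 => /eqP ->.
rewrite leq_eqVlt => /orP[/eqP -> //|]; rewrite ltnS => /IH /le_trans; apply.
by have /andP[] := mean_repeatsS mu j m0.
Qed.

Lemma mean_repeats_sub m n k : (0 < m)%N ->
  mean_repeats mu n m <= mean_repeats mu (n - k) m + k%:R.
Proof.
move=> m0; elim: k => [|k IH]; first by rewrite subn0 addr0.
apply: (le_trans IH); rewrite subnS -natr1 addrA [leRHS]addrAC lerD2r.
case: (n - k)%N => [|j] /=; first by rewrite lerDl.
by have /andP[] := mean_repeatsS mu j m0.
Qed.

(** Both bounds on the mean of a census involve the means at times that differ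
    from n by a constant, and the mean number of repeatedly visited states
    grows by at most one at each step. *)
Lemma mean_census_cvg m l Phi : (0 < m)%N -> (l <= m)%N ->
  mean_census mu n.+1 m l Phi / mean_range n @[n --> \oo] --> pair_mean mu l Phi * c m.
Proof.
move=> m0 lm; set z := pair_mean mu l Phi; set C : R := ((2 * l) + (1 + 2 * l))%:R.
have /andP[z0 z1] := pair_mean01 mu l Phi.
have dist n : z * mean_repeats mu n m - C <= mean_census mu n.+1 m l Phi
    <= z * mean_repeats mu n m + C.
  have lo := mean_census_ge mu n.+1 Phi m0 lm.
  have up := mean_census_le mu n.+1 Phi m0 lm.
  have sb := @mean_repeats_sub m n (1 + 2 * l) m0.
  have e : (n.+1 - 2 - 2 * l = n - (1 + 2 * l))%N by lia.
  rewrite e -/z /= in lo up; rewrite /C natrD.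
  have sb' := @mean_repeats_incr m m0 _ _ (leq_subr (1 + 2 * l) n).
  set b' := mean_repeats mu (n - (1 + 2 * l))%N m in lo up sb sb'.
  set b := mean_repeats mu n m in up sb sb' *.
  have k0 : 0 <= (1 + 2 * l)%:R :> R by [].
  rewrite -/z in z0 z1; set k := (1 + 2 * l)%:R in sb k0 *.
  have q0 : 0 <= b' + k - b by rewrite subr_ge0.
  have p1 : 0 <= z * (b' + k - b) by exact: mulr_ge0.
  have p2 : 0 <= (1 - z) * (b' + k - b) by rewrite mulr_ge0// subr_ge0.
  have p3 : 0 <= z * k by exact: mulr_ge0.
  have p4 : 0 <= (1 - z) * k by rewrite mulr_ge0// subr_ge0.
  apply/andP; split; nra.
have zc : z * mean_repeats mu n m / mean_range n @[n --> \oo] --> z * c m.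
  under eq_fun do rewrite -mulrA.
  by apply: cvgMr; exact: mean_repeats_cvg.
apply: (bounded_difference_ratio (C := C) mean_range_unb _ zc) => n.
by have /andP[? ?] := dist n; rewrite ler_distl; apply/andP; split.
Qed.

Lemma census_slln m l Phi : (0 < m)%N -> (l <= m)%N ->
  \forall w \ae P, (census m l Phi (path_word (xi^~ w) n.+1))%:R / mean_range n
    @[n --> \oo] --> pair_mean mu l Phi * c m.
Proof.
move=> m0 lm.
apply: (@monotone_slln R d T P
  (fun n w => (census m l Phi (path_word (xi^~ w) n.+1))%:R) mean_range
  (fun n => mean_census mu n.+1 m l Phi) _ (9 * m)%:R) => //.
- rewrite /mean_range /mean_repeats /= /repeats /letter_bound big_nil big_geq//.
- exact: mean_repeats_incr.
- by move=> n; have /andP[] := mean_repeatsS mu n (ltn0Sn 0).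
- move=> n; exact: (@measurable_path_fun _ _ _ _ xi _ _ n.+1 (fun v => (census m l Phi v)%:R : R)).
- by move=> w i j ij; rewrite ler_nat; apply: census_path_incr.
- move=> n; have bc := @census_bounded R n.+1 m l Phi m0.
  have ba : word_bounded n.+1 (fun=> mean_census mu n.+1 m l Phi) n.+1%:R.
    by move=> w _; exact: word_mean_norm.
  have h := @path_mean R d T P p xi xi_iid n.+1
    (fun v => ((census m l Phi v)%:R - mean_census mu n.+1 m l Phi) ^+ 2) _ _
    (word_bounded_sqr (word_boundedB bc ba)).
  rewrite h; last by move=> v _; exact: sqr_ge0.
  rewrite lee_fin; apply: (le_trans (census_variance mu n.+1 Phi m0 lm)).
  by rewrite ler_wpM2l//; have /andP[] := mean_repeatsS mu n (ltn0Sn 0).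
- exact: mean_census_cvg.
Qed.

End CensusLimit.

(** * The Gamma function *)

Section DerivativeIntegral.
Context {R : realType}.
Local Notation leb := (@lebesgue_measure R).

Lemma is_derive_continuous (F : R -> R) (x df : R) : is_derive x 1 F df -> {for x, continuous F}.
Proof. by move=> [dF _]; apply: differentiable_continuous; exact/derivable1_diffP. Qed.

Lemma is_derive_ext (f h : R -> R) (x df dh : R) :
  is_derive x 1 f df -> f =1 h -> df = dh -> is_derive x 1 h dh.
Proof. by move=> fd /funext <- <-. Qed.

Lemma integral_derivative (f F : R -> R) (a b : R) : a < b ->
  (forall x, a <= x <= b -> is_derive x 1 F (f x)) ->
  (forall x, a <= x <= b -> {for x, continuous f}) ->
  (\int[leb]_(x in `[a, b]) (f x)%:E = (F b - F a)%:E)%E.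
Proof.
move=> ab dF cf; rewrite EFinB; apply: continuous_FTC2 => //.
- apply: continuous_in_subspaceT => x /[!inE]/=; rewrite in_itv/=; exact: cf.
- split.
  + move=> x; rewrite in_itv/= => /andP[ax xb].
    by apply: (@ex_derive _ _ _ _ _ _ _ (dF x _)); rewrite !ltW.
  + apply/cvg_at_right_filter; apply: (is_derive_continuous (dF a _)).
    by rewrite lexx ltW.
  + apply/cvg_at_left_filter; apply: (is_derive_continuous (dF b _)).
    by rewrite lexx ltW.
- move=> x; rewrite in_itv/= => /andP[ax xb]; rewrite derive1E.
  have h : is_derive x 1 F (f x) by apply: dF; rewrite !ltW.
  exact: derive_val.
Qed.

End DerivativeIntegral.

Section GammaFunction.
Context {R : realType}.
Local Notation leb := (@lebesgue_measure R).

Lemma powRD_gt0 (t r s : R) : 0 < t -> t `^ (r + s) = t `^ r * t `^ s.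
Proof. by move=> t0; rewrite powRD// (gt_eqF t0) implybT. Qed.

Definition gamma_kernel (s t : R) : R := t `^ (s - 1) * expR (- t).

Lemma gamma_kernel_ge0 s t : 0 <= gamma_kernel s t.
Proof. by rewrite mulr_ge0 ?powR_ge0 ?expR_ge0. Qed.

Lemma measurable_gamma_kernel s (D : set R) : measurable_fun D (gamma_kernel s).
Proof.
apply: measurable_funTS; apply: measurable_funM; first exact: measurable_powR.
by apply: measurableT_comp => //; exact: measurable_expR.
Qed.

Lemma is_derive_expRN (x : R) : is_derive x 1 (fun t : R => expR (- t)) (- expR (- x)).
Proof.
have h : is_derive (- x) 1 expR (expR (- x)) by exact: is_derive_expR.
have := @is_derive1_comp R expR -%R x (expR (- x)) (- 1) h (is_deriveNid x 1).
by rewrite mulrN1.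
Qed.

Lemma is_derive_gamma_kernel (s x : R) : 0 < x ->
  is_derive x 1 (gamma_kernel s) ((s - 1) * gamma_kernel (s - 1) x - gamma_kernel s x).
Proof.
move=> x0.
have h1 := is_derive1_powR (s - 1) x0; have h2 := is_derive_expRN x.
apply: (is_derive_ext (@is_deriveM _ _ _ _ x 1 _ _ h1 h2)) => //.
rewrite /gamma_kernel /GRing.scale /=; ring.
Qed.

Lemma gamma_kernel_continuous s x : 0 < x -> {for x, continuous (gamma_kernel s)}.
Proof. by move=> x0; exact: (is_derive_continuous (is_derive_gamma_kernel s x0)). Qed.

(** Integration by parts is done on these segments, away from the possible
    singularity of the kernel at 0. *)
Definition half_line_exhaustion (n : nat) : set R := `[n.+2%:R^-1, n.+2%:R]%classic.

Lemma half_line_exhaustionE : \bigcup_n half_line_exhaustion n = `]0, +oo[%classic.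
Proof.
apply/seteqP; split => x.
  move=> [n _]; rewrite /half_line_exhaustion /= !in_itv/= andbT => /andP[h _].
  by apply: lt_le_trans h; rewrite invr_gt0.
rewrite /= in_itv/= andbT => x0.
exists (Num.truncn (Num.max x x^-1)) => //.
set n := Num.truncn _; rewrite /half_line_exhaustion /= in_itv/=.
have h : Num.max x x^-1 < n.+2%:R.
  by apply: (lt_trans (truncnS_gt _)); rewrite ltr_nat.
apply/andP; split; last by apply/ltW/(le_lt_trans _ h); rewrite le_max lexx.
rewrite -[leRHS]invrK lef_pV2 ?posrE ?invr_gt0//.
by apply/ltW/(le_lt_trans _ h); rewrite le_max lexx orbT.
Qed.

Lemma half_line_exhaustion_cvg (f : R -> R) : measurable_fun setT f ->
  (forall x, 0 <= f x) ->
  (\int[leb]_(x in half_line_exhaustion n) (f x)%:E)%E @[n --> \oo] -->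
  (\int[leb]_(x in `]0%R, +oo[) (f x)%:E)%E.
Proof.
move=> mf f0; rewrite -half_line_exhaustionE.
apply: ge0_nondecreasing_set_cvg_integral => //.
- move=> n m nm; apply/subsetPset => x; rewrite /half_line_exhaustion /= !in_itv/= => /andP[h1 h2].
  apply/andP; split; last by rewrite (le_trans h2)// ler_nat.
  by apply: le_trans h1; rewrite lef_pV2 ?posrE// ler_nat.
- move=> n; exact: measurable_itv.
- move=> n; apply/measurable_EFinP; exact: measurable_funTS.
- by move=> n x _; rewrite lee_fin.
Qed.

(** Half of the exponential decay absorbs the power. *)
Lemma powR_expR_bound r : 0 <= r -> exists2 C : R, 0 < C &
  forall t, 0 < t -> t `^ r * expR (- t) <= C * expR (- (t / 2)).
Proof.
rewrite le_eqVlt => /predU1P[<-|r0].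
  exists 1 => // t t0; rewrite powRr0 mul1r mul1r ler_expR lerN2; lra.
exists ((2 * r) `^ r); first by rewrite powR_gt0// mulr_gt0.
move=> t t0.
have h : t <= 2 * r * expR (t / (2 * r)).
  have r2 : 0 < 2 * r by rewrite mulr_gt0.
  rewrite mulrC -ler_pdivrMr//; have := expR_ge1Dx (t / (2 * r)); apply: le_trans.
  by rewrite lerDr.
have -> : - (t / 2) = t / 2 - t by lra.
rewrite expRD mulrA ler_wpM2r ?expR_ge0//.
have -> : t / 2 = t / (2 * r) * r by field; rewrite gt_eqF.
rewrite expRM -powRM ?expR_ge0//; last by rewrite mulr_ge0// ltW.
by apply: ge0_ler_powR; rewrite ?nnegrE ?mulr_ge0 ?expR_ge0// ltW.
Qed.

Lemma measurable_exp_half (D : set R) :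
  measurable_fun D (fun t : R => (expR (- (t / 2)))%:E).
Proof.
apply: measurable_funTS; apply/measurable_EFinP; apply: measurableT_comp.
  exact: measurable_expR.
by apply: measurableT_comp => //; apply: measurable_funM.
Qed.

Lemma integral_expRM (r : R) : 0 < r ->
  (\int[leb]_(t in `]0%R, +oo[) (expR (- r * t))%:E = r^-1%:E)%E.
Proof.
move=> r0.
have mf D : measurable_fun D (fun t : R => (r * expR (- r * t))%:E).
  apply: measurable_funTS; apply/measurable_EFinP; apply: measurable_funM => //.
  by apply: measurableT_comp => //; exact: measurable_funM.
have E : (\int[leb]_(t in `]0%R, +oo[) (r * expR (- r * t))%:E = 1)%E.
  rewrite -(integral_exponential_pdf r0) integral_itv_obnd_cbnd// integral_mkcond.
  by apply: eq_integral => t _; rewrite /exponential_pdf !patchE; case: ifP.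
transitivity (\int[leb]_(t in `]0%R, +oo[) (r^-1%:E * (r * expR (- r * t))%:E))%E.
  by apply: eq_integral => t _; rewrite -EFinM mulKf// gt_eqF.
have f0 (t : R) : `]0%R, +oo[%classic t -> (0 <= (r * expR (- r * t))%:E)%E.
  by rewrite lee_fin mulr_ge0 ?expR_ge0// ltW.
rewrite (ge0_integralZl_EFin leb (measurable_itv _) f0 (mf _)) ?E ?mule1//.
by rewrite invr_ge0 ltW.
Qed.

Local Notation G s := (\int[leb]_(t in `]0%R, +oo[) (gamma_kernel s t)%:E)%E.

Lemma gamma_lty_ge1 s : 1 <= s -> (G s < +oo)%E.
Proof.
move=> s1; have [C C0 hC] := @powR_expR_bound (s - 1) (ltac:(by rewrite subr_ge0)).
apply: (@le_lt_trans _ _ (\int[leb]_(t in `]0%R, +oo[) (C%:E * (expR (- (t / 2)))%:E))%E).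
  apply: ge0_le_integral => //.
  - by move=> t _; rewrite lee_fin gamma_kernel_ge0.
  - by apply/measurable_EFinP; exact: measurable_gamma_kernel.
  - by apply: measurable_funeM; exact: measurable_exp_half.
  - by move=> t; rewrite /= in_itv/= andbT => t0; rewrite -EFinM lee_fin hC.
have m1 := @measurable_exp_half `]0%R, +oo[%classic.
have e0 (t : R) : `]0%R, +oo[%classic t -> (0 <= (expR (- (t / 2)))%:E)%E.
  by rewrite lee_fin expR_ge0.
rewrite (ge0_integralZl_EFin leb (measurable_itv _) e0 m1)//; last exact: ltW.
under eq_integral do rewrite -mulNr mulrC mulrN -mulNr.
by rewrite integral_expRM// -EFinM ltry.
Qed.

Lemma gamma_kernel_integrable_seg s a b : 0 < a -> leb.-integrable `[a, b] (EFin \o gamma_kernel s).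
Proof.
move=> a0; apply: continuous_compact_integrable; first exact: segment_compact.
apply: continuous_in_subspaceT => x /[!inE]/=; rewrite in_itv/= => /andP[ax _].
by apply: gamma_kernel_continuous; exact: lt_le_trans ax.
Qed.

Lemma gamma_by_parts s a b : 0 < a -> a < b ->
  (s%:E * \int[leb]_(t in `[a, b]) (gamma_kernel s t)%:E =
  \int[leb]_(t in `[a, b]) (gamma_kernel (s + 1) t)%:E +
    (gamma_kernel (s + 1) b - gamma_kernel (s + 1) a)%:E)%E.
Proof.
move=> a0 ab.
have s1 : s + 1 - 1 = s by rewrite addrK.
have h : (\int[leb]_(t in `[a, b]) (s * gamma_kernel s t - gamma_kernel (s + 1) t)%:E =
    (gamma_kernel (s + 1) b - gamma_kernel (s + 1) a)%:E)%E.
  apply: integral_derivative => //.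
- move=> x /andP[ax _]; have x0 : 0 < x by exact: lt_le_trans ax.
  by apply: (is_derive_ext (is_derive_gamma_kernel (s + 1) x0)) => //; rewrite s1.
- move=> x /andP[ax _]; have x0 : 0 < x by exact: lt_le_trans ax.
  by apply: cvgB; [apply: cvgMr|]; exact: gamma_kernel_continuous.
rewrite -h.
have i1 := @gamma_kernel_integrable_seg s a b a0.
have i2 := @gamma_kernel_integrable_seg (s + 1) a b a0.
have i3 : leb.-integrable `[a, b] (fun t => s%:E * (gamma_kernel s t)%:E)%E by exact: integrableZl.
under [X in (_ + X)%E]eq_integral do rewrite EFinB EFinM.
rewrite integralB//= integralZl//.
by rewrite addeC subeK// integrable_fin_num.
Qed.

Lemma gamma_kernel_cvg_pinfty s : 1 <= s -> gamma_kernel s n.+2%:R @[n --> \oo] --> (0 : R).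
Proof.
move=> s1; have [C C0 hC] := @powR_expR_bound (s - 1) (ltac:(by rewrite subr_ge0)).
apply: (@squeeze_cvgr _ _ _ _ (fun=> 0) (fun n => C * expR (- (n.+2%:R / 2)))).
- by apply: nearW => n; rewrite gamma_kernel_ge0 hC.
- exact: cvg_cst.
- rewrite -(mulr0 C); apply: cvgMr.
  have h : (n.+2%:R / 2 : R) @[n --> \oo] --> +oo.
    apply/cvgryPge => A; near=> n.
    have : 2 * A <= n%:R by near: n; exact: nbhs_infty_ger.
    by have -> : n.+2%:R = n%:R + 2 :> R by [rewrite -natrD addn2]; lra.
  exact: (cvg_comp _ _ h (@cvgr_expR R)).
Unshelve. all: by end_near. Qed.

Lemma gamma_kernel_cvg_0 s : 1 < s -> gamma_kernel s n.+2%:R^-1 @[n --> \oo] --> (0 : R).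
Proof.
move=> s1.
have h0 : (n.+2%:R^-1 : R) @[n --> \oo] --> (0 : R).
  by have := @cvg_harmonic R; rewrite -cvg_shiftS.
have s0 : 0 < s - 1 by rewrite subr_gt0.
apply: (@squeeze_cvgr _ _ _ _ (fun=> 0) (fun n => (n.+2%:R^-1) `^ (s - 1))).
- apply: nearW => n; rewrite gamma_kernel_ge0 /= /gamma_kernel ler_piMr ?powR_ge0// expR_le1 oppr_le0 invr_ge0//.
- exact: cvg_cst.
- apply: ((cvg_at_rightP (fun a => a `^ (s - 1)) 0 0).1 (powR_cvg0 s0)).
  by split => // n; rewrite invr_gt0.
Qed.

(** Stated in the extended reals, so that it also transports finiteness. *)
Lemma gamma_rec s : 0 < s -> G (s + 1) = (s%:E * G s)%E.
Proof.
move=> s0.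
have c1 := @half_line_exhaustion_cvg _ (@measurable_gamma_kernel s setT) (gamma_kernel_ge0 s).
have c2 := @half_line_exhaustion_cvg _ (@measurable_gamma_kernel (s + 1) setT) (gamma_kernel_ge0 (s + 1)).
have cb : (gamma_kernel (s + 1) n.+2%:R - gamma_kernel (s + 1) n.+2%:R^-1)%:E @[n --> \oo] --> 0%:E.
  apply: cvg_EFin; first exact: nearW.
  rewrite /= -[X in _ --> X]subr0; apply: cvgB.
    by apply: gamma_kernel_cvg_pinfty; rewrite lerDr ltW.
  by apply: gamma_kernel_cvg_0; rewrite ltrDr.
have L : (s%:E * \int[leb]_(x in half_line_exhaustion n) (gamma_kernel s x)%:E)%E @[n --> \oo]
    --> (s%:E * G s)%E by apply: cvgeZl.
have M : (\int[leb]_(x in half_line_exhaustion n) (gamma_kernel (s + 1) x)%:E +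
   (gamma_kernel (s + 1) n.+2%:R - gamma_kernel (s + 1) n.+2%:R^-1)%:E)%E @[n --> \oo]
   --> (G (s + 1)%R + 0%:E)%E.
  by apply: cvgeD => //; rewrite fin_num_adde_defl.
rewrite adde0 in M.
rewrite -(cvg_lim _ M)// -(cvg_lim _ L)//; congr (limn _).
apply/funext => n; rewrite gamma_by_parts ?invr_gt0//.
apply: (@lt_trans _ _ 1); last by rewrite ltr1n.
by rewrite invf_lt1// ltr1n.
Qed.

(** For s < 1 the kernel is singular at 0; finiteness comes down from s + 1
    through the recursion. *)
Lemma gamma_lty s : 0 < s -> (G s < +oo)%E.
Proof.
move=> s0; rewrite ltNge leye_eq; apply/eqP => Gy.
have := @gamma_lty_ge1 (s + 1); rewrite gamma_rec// Gy lerDr => /(_ (ltW s0)).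
by rewrite gt0_muley ?lte_fin// ltxx.
Qed.

Lemma gamma_gt0 s : (0 < G s)%E.
Proof.
(* c bounds the kernel from below on [1, 2], whatever the sign of s - 1 *)
set c := Num.min 1 (2 `^ (s - 1)) * expR (- 2).
have c0 : 0 < c by rewrite mulr_gt0 ?expR_gt0// lt_min ltr01 powR_gt0.
apply: (@lt_le_trans _ _ (\int[leb]_(t in `[1%R, 2%R]) cst c%:E t)%E).
  have L : (0 < leb `[1%R, 2%R])%E.
    by rewrite lebesgue_measure_itv/= lte_fin ltr1n /= -EFinD lte_fin; lra.
  by rewrite integral_cst// mule_gt0.
apply: (@le_trans _ _ (\int[leb]_(t in `[1%R, 2%R]) (gamma_kernel s t)%:E)%E).
  apply: ge0_le_integral => //.
  - by move=> t _; rewrite lee_fin ltW.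
  - by apply/measurable_EFinP; exact: measurable_gamma_kernel.
  move=> t; rewrite /= in_itv/= => /andP[t1 t2]; rewrite lee_fin ler_pM ?expR_ge0//.
  - have t0 : 0 < t by rewrite (lt_le_trans ltr01).
    have [s1|s1] := leP 0 (s - 1).
      by rewrite ge_min -{1}(powRr0 t) ler_powR.
    rewrite ge_min; apply/orP; right.
    rewrite -[s - 1]opprK powRN [leRHS]powRN lef_pV2 ?posrE ?powR_gt0//.
    by apply: ge0_ler_powR; rewrite ?nnegrE// ?oppr_ge0 ltW.
  - by rewrite ler_expR lerN2.
apply: ge0_subset_integral => //.
- by apply/measurable_EFinP; exact: measurable_gamma_kernel.
- by move=> t _; rewrite lee_fin gamma_kernel_ge0.
- by move=> t; rewrite /= !in_itv/= andbT => /andP[t1 _]; exact: lt_le_trans t1.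
Qed.

Lemma gamma_kernel_integrable s : 0 < s ->
  leb.-integrable `]0, +oo[ (EFin \o gamma_kernel s).
Proof.
move=> s0; apply/integrableP; split.
  by apply/measurable_EFinP; exact: measurable_gamma_kernel.
under eq_integral => t _ do rewrite gee0_abs ?lee_fin ?gamma_kernel_ge0//.
exact: gamma_lty.
Qed.

Lemma GammaE s : 0 < s -> (Gamma s)%:E = G s.
Proof.
move=> s0; rewrite /Gamma /Rintegral fineK//.
exact: integrable_fin_num (gamma_kernel_integrable s0).
Qed.

Lemma Gamma_gt0 (s : R) : 0 < s -> 0 < Gamma s.
Proof. by move=> s0; rewrite -lte_fin GammaE// gamma_gt0. Qed.

Lemma Gamma_rec (s : R) : 0 < s -> Gamma (s + 1) = s * Gamma s.
Proof.
move=> s0; apply/eqP; rewrite -eqe EFinM !GammaE ?addr_gt0//; apply/eqP; exact: gamma_rec.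
Qed.

Lemma Gamma1 : Gamma 1 = 1 :> R.
Proof.
apply/eqP; rewrite -eqe GammaE//; apply/eqP.
transitivity (\int[leb]_(t in `]0%R, +oo[) (expR (- 1 * t))%:E)%E; last first.
  by rewrite integral_expRM// invr1.
by apply: eq_integral => t _; rewrite /gamma_kernel subrr powRr0 mul1r mulN1r.
Qed.

Lemma Gamma_fact n : Gamma n.+1%:R = n`!%:R :> R.
Proof.
elim: n => [|n IH]; first by rewrite Gamma1.
by rewrite -natr1 Gamma_rec// IH factS natrM.
Qed.

Lemma Gamma_prod (g : R) l : g < 1 -> (0 < l)%N ->
  Gamma (l%:R - g) = (\prod_(1 <= j < l) (j%:R - g)) * Gamma (1 - g).
Proof.
move=> g1; elim: l => [//|[|l] IH] _; first by rewrite big_geq// mul1r.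
rewrite big_nat_recr//= -natr1 addrAC Gamma_rec; last first.
  by rewrite subr_gt0 (lt_le_trans g1)// ler1n.
by rewrite IH// mulrC mulrAC.
Qed.

(** Log-convexity of Gamma between x and x + 1: under the integral it is the
    weighted inequality of the arithmetic and geometric means
    t^s x^(1-s) <= s t + (1-s) x. *)
Lemma Gamma_le_powR (x s : R) : 0 < x -> 0 < s < 1 -> Gamma (x + s) <= x `^ s * Gamma x.
Proof.
move=> x0 /andP[s0 s1].
have bd t : 0 < t -> gamma_kernel (x + s) t <=
    x `^ (s - 1) * (s * gamma_kernel (x + 1) t + (1 - s) * x * gamma_kernel x t).
  move=> t0.
  have amgm : t `^ s * x `^ (1 - s) <= s * t + (1 - s) * x.
    have := @conjugate_powR R (t `^ s) (x `^ (1 - s)) s^-1 (1 - s)^-1.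
    rewrite !invrK -!powRrM !mulfV ?powRr1 ?(ltW t0) ?(ltW x0)//; last 2 first.
      by rewrite subr_eq0 gt_eqF.
      by rewrite gt_eqF.
    rewrite !powR_ge0 !invr_gt0 s0 subr_gt0 s1 => /(_ isT isT isT isT).
    by move=> h; rewrite [s * t]mulrC [(1 - s) * x]mulrC; apply: h; ring.
  have -> : gamma_kernel (x + s) t = t `^ s * gamma_kernel x t.
    rewrite /gamma_kernel mulrA -powRD_gt0//.
    by congr (_ `^ _ * _); ring.
  have -> : gamma_kernel (x + 1) t = t * gamma_kernel x t.
    rewrite /gamma_kernel mulrA; congr (_ * _).
    have -> : x + 1 - 1 = 1 + (x - 1) by ring.
    by rewrite (@powRD_gt0 t 1 (x - 1))// powRr1// ltW.
  rewrite (mulrA s) -mulrDl mulrA ler_wpM2r ?gamma_kernel_ge0//.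
  rewrite -ler_pdivrMl ?powR_gt0// -powRN opprB mulrC.
  exact: amgm.
have x1 : 0 < x + 1 by rewrite addr_gt0.
have i1 := gamma_kernel_integrable x1.
have i2 := gamma_kernel_integrable x0.
have i3 : leb.-integrable `]0, +oo[ (EFin \o (fun t => s * gamma_kernel (x + 1) t)).
  by apply: (integrableZl _ s i1).
have i4 : leb.-integrable `]0, +oo[ (EFin \o (fun t => (1 - s) * x * gamma_kernel x t)).
  by apply: (integrableZl _ ((1 - s) * x) i2).
have i5 : leb.-integrable `]0, +oo[ (EFin \o
    (fun t => s * gamma_kernel (x + 1) t + (1 - s) * x * gamma_kernel x t)).
  by apply: (integrableD _ i3 i4).
have h : Gamma (x + s) <= \int[leb]_(t in `]0, +oo[)
    (x `^ (s - 1) * (s * gamma_kernel (x + 1) t + (1 - s) * x * gamma_kernel x t)).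
  apply: le_Rintegral => //.
  - by apply: gamma_kernel_integrable; rewrite addr_gt0.
  - by apply: (integrableZl _ (x `^ (s - 1)) i5).
  - by move=> t; rewrite /= in_itv/= andbT; exact: bd.
apply: (le_trans h).
rewrite RintegralZl// RintegralD// !RintegralZl//.
rewrite -/(Gamma (x + 1)) -/(Gamma x) Gamma_rec//.
have -> : s * (x * Gamma x) + (1 - s) * x * Gamma x = x * Gamma x by ring.
rewrite mulrA ler_wpM2r ?(ltW (Gamma_gt0 x0))//.
by rewrite mulrC mulr_powRB1// ltW.
Qed.

End GammaFunction.

(** * The limiting proportions *)

Section RepeatRatio.
Context {R : realType}.
Variables (g : R) (g0 : 0 < g) (g1 : g < 1).

Let G1 : 0 < Gamma (1 - g). Proof. by rewrite Gamma_gt0// subr_gt0. Qed.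

Let fact0 n : (n`!%:R : R) != 0. Proof. by rewrite pnatr_eq0 -lt0n fact_gt0. Qed.

Lemma rlimE l : (1 <= l)%N -> rlim g l = g * (\prod_(1 <= j < l) (j%:R - g)) / l`!%:R.
Proof.
move=> l1; rewrite /rlim Gamma_prod// mulrA -mulf_div divff ?mulr1//.
by rewrite gt_eqF.
Qed.

(** The limiting proportion, among the visited states, of those visited at least
    m times. *)
Definition repeat_ratio (m : nat) : R := Gamma (m%:R - g) / ((m.-1)`!%:R * Gamma (1 - g)).

Lemma repeat_ratio_gt0 m : (0 < m)%N -> 0 < repeat_ratio m.
Proof.
move=> m0; rewrite divr_gt0 ?mulr_gt0 ?ltr0n ?fact_gt0 ?Gamma_gt0 ?subr_gt0//.
by rewrite (lt_le_trans g1)// ler1n.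
Qed.

Lemma repeat_ratio1 : repeat_ratio 1 = 1.
Proof. by rewrite /repeat_ratio mul1r divff// gt_eqF. Qed.

Lemma rlim_ratio m : (0 < m)%N -> rlim g m = g / m%:R * repeat_ratio m.
Proof.
case: m => [//|m] _; rewrite /rlim /repeat_ratio factS natrM.
have h1 := fact0 m; have h2 : (m.+1%:R : R) != 0 by rewrite pnatr_eq0.
have h3 : Gamma (1 - g) != 0 by rewrite gt_eqF.
move=> /=; move: (Gamma (m.+1%:R - g)) (Gamma (1 - g)) h3 (m.+1%:R) (m`!%:R) h1 h2 => y z z0 a b b0 a0.
by field; rewrite a0 b0 z0.
Qed.

Lemma repeat_ratioB m : (0 < m)%N -> repeat_ratio m - repeat_ratio m.+1 = rlim g m.
Proof.
move=> m0; rewrite rlim_ratio// /repeat_ratio -(natr1 m).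
have -> : m%:R + 1 - g = (m%:R - g) + 1 by ring.
rewrite Gamma_rec; last by rewrite subr_gt0 (lt_le_trans g1)// ler1n.
case: m m0 => [//|m] _ /=; rewrite factS natrM.
have h1 := fact0 m; have h2 : (m.+1%:R : R) != 0 by rewrite pnatr_eq0.
have h3 : Gamma (1 - g) != 0 by rewrite gt_eqF.
move=> /=; move: (Gamma (m.+1%:R - g)) (Gamma (1 - g)) h3 (m.+1%:R) (m`!%:R) h1 h2 => y z z0 a b b0 a0.
by field; rewrite a0 b0 z0.
Qed.

(** [Gamma_le_powR] shows that it is of order m^-g. *)
Lemma repeat_ratio_cvg0 : repeat_ratio m @[m --> \oo] --> (0 : R).
Proof.
suff h : repeat_ratio n.+2 @[n --> \oo] --> (0 : R).
  by move: h; rewrite (@cvg_shiftS _ (fun n => repeat_ratio n.+1)) cvg_shiftS.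
have g1' : 0 < 1 - g < 1 by rewrite subr_gt0 g1 gtrBl.
have hu : (n.+1%:R^-1 `^ g : R) @[n --> \oo] --> (0 : R).
  apply: ((cvg_at_rightP (fun a => a `^ g) 0 0).1 (powR_cvg0 g0)); split.
    by move=> n; rewrite invr_gt0.
  exact: cvg_harmonic.
apply: (@squeeze_cvgr _ _ _ _ (fun=> 0) (fun n => (Gamma (1 - g))^-1 * n.+1%:R^-1 `^ g)).
- apply: nearW => n; rewrite ltW ?repeat_ratio_gt0//= /repeat_ratio invfM mulrA mulrC ler_wpM2l//.
    by rewrite invr_ge0 ltW.
  have n0 : 0 < n.+1%:R :> R by [].
  have -> : n.+2%:R - g = n.+1%:R + (1 - g) :> R by rewrite -(natr1 n.+1); ring.
  rewrite ler_pdivrMr ?ltr0n ?fact_gt0//.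
  apply: (le_trans (Gamma_le_powR n0 g1')); rewrite Gamma_fact powRD_gt0// powRr1//.
  rewrite [(n.+2.-1)`!]factS natrM -powR_inv1 ?(ltW n0)// -powRrM mulN1r.
  by rewrite le_eqVlt; apply/orP; left; apply/eqP; ring.
- exact: cvg_cst.
- by rewrite -(mulr0 (Gamma (1 - g))^-1); apply: cvgMr.
Qed.

(** [Gamma_le_powR], applied with exponent g and with exponent 1 - g, traps the
    ratio u of the two sides between 1 and 1 + 2 / l. *)
Lemma rlim_asymptotic : exists2 h : nat -> R, h =O_\oo (fun l : nat => l%:R^-1 : R) &
  \forall l \near \oo, rlim g l = g / Gamma (1 - g) * l%:R `^ (- (1 + g)) * (1 + h l).
Proof.
(* by [rlim], u l is the ratio whose deviation from 1 is to be bounded by 2 / l *)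
pose u l : R := Gamma (l%:R - g) * l%:R `^ (1 + g) / l`!%:R.
have bd n : 1 <= u n.+2 <= 1 + 2 / n.+2%:R.
  have n1 : 0 < n.+1%:R :> R by []. have n2 : 0 < n.+2%:R :> R by [].
  have f0 : 0 < n`!%:R :> R by rewrite ltr0n fact_gt0.
  have E2 : n.+2%:R = n.+1%:R + 1 :> R by rewrite natr1.
  apply/andP; split.
    have x0 : 0 < n.+2%:R - g by rewrite E2 -addrA addr_gt0// subr_gt0.
    have gg : 0 < g < 1 by rewrite g0 g1.
    have := Gamma_le_powR x0 gg; rewrite subrK Gamma_fact => h.
    rewrite ler_pdivlMr ?ltr0n ?fact_gt0// mul1r factS natrM powRD_gt0// powRr1 ?(ltW n2)//.
    rewrite mulrCA ler_pM2l//; apply: (le_trans h); rewrite mulrC ler_wpM2l ?(ltW (Gamma_gt0 x0))//.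
    by apply: ge0_ler_powR; rewrite ?nnegrE ?(ltW x0) ?(ltW n2) ?(ltW g0)// gerBl ltW.
  have g1' : 0 < 1 - g < 1 by rewrite subr_gt0 g1 gtrBl.
  have := Gamma_le_powR n1 g1'; rewrite Gamma_fact => h.
  have hE : n.+1%:R + (1 - g) = n.+2%:R - g :> R by rewrite E2; ring.
  rewrite hE in h.
  have up : u n.+2 <= (n.+2%:R / n.+1%:R) `^ g.
    rewrite /u ler_pdivrMr ?ltr0n ?fact_gt0// powRM ?invr_ge0 ?(ltW n1) ?(ltW n2)//.
    rewrite -powR_inv1 ?(ltW n1)// -powRrM mulN1r.
    apply: (@le_trans _ _ (n.+1%:R `^ (1 - g) * n`!%:R * n.+2%:R `^ (1 + g))).
      by rewrite ler_wpM2r ?powR_ge0.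
    rewrite !powRD_gt0// !powRr1 ?(ltW n1) ?(ltW n2)// !factS !natrM; lra.
  apply: (le_trans up).
  apply: (@le_trans _ _ (n.+2%:R / n.+1%:R)).
    by apply: ler1_powR; rewrite ?(ltW g1)// ler_pdivlMr// mul1r ler_nat.
  rewrite E2; set x := n.+1%:R in n1 *.
  have x1 : 1 <= x by rewrite /x ler1n.
  rewrite -subr_ge0; have -> : 1 + 2 / (x + 1) - (x + 1) / x = (x - 1) / (x * (x + 1)).
    by field; rewrite !gt_eqF// addr_gt0.
  by rewrite divr_ge0 ?mulr_ge0 ?subr_ge0 ?addr_ge0 ?(ltW n1).
exists (fun l => u l - 1).
  apply/eqO_exP; exists 2 => //; exists 2%N => // -[|[|n]]//= _.
  have /andP[h1 h2] := bd n.
  by rewrite ger0_norm ?subr_ge0// ger0_norm ?invr_ge0// lerBlDl.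
exists 1%N => // -[//|n] _; rewrite (addrC 1 (_ - 1)) subrK /u /rlim powRN.
have h1 : (n.+1%:R `^ (1 + g) : R) != 0 by rewrite gt_eqF// powR_gt0.
have h2 := fact0 n.+1; have h3 : Gamma (1 - g) != 0 by rewrite gt_eqF.
by field; rewrite h1 h2 h3.
Qed.

End RepeatRatio.

(** * Binomial tails as integrals *)

Section BinomialDensity.
Context {R : realType}.
Local Notation leb := (@lebesgue_measure R).

Definition binom_density (q : R) (n m : nat) : R := 'C(n, m)%:R * q ^+ m * (1 - q) ^+ (n - m).

Lemma binom_tail_q0 n m : binom_tail (0 : R) n.+1 m.+1 = 0.
Proof.
elim: n m => [|n IH] m; first by rewrite /= mulr0 mul0r addr0.
by rewrite -[LHS]/((1 - 0) * binom_tail 0 n.+1 m.+1 + 0 * binom_tail 0 n.+1 m) IH mulr0 mul0r addr0.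
Qed.

Lemma binom_densityS q n m : binom_density q n.+1 m.+1 =
  (1 - q) * binom_density q n m.+1 + q * binom_density q n m.
Proof.
rewrite /binom_density binS subSS natrD !mulrDl.
have -> : 'C(n, m.+1)%:R * q ^+ m.+1 * (1 - q) ^+ (n - m) =
    (1 - q) * ('C(n, m.+1)%:R * q ^+ m.+1 * (1 - q) ^+ (n - m.+1)).
  have [mn|nm] := ltnP m n; last by rewrite bin_small// !mul0r mulr0.
  by rewrite -[in LHS](subnSK mn) (exprS (1 - q)); ring.
by rewrite exprS; ring.
Qed.

Lemma binom_tailB q n m : binom_tail q n m - binom_tail q n m.+1 = binom_density q n m.
Proof.
elim: n m => [|n IH] [|m]; rewrite ?binom_densityS -?IH.
- by rewrite /binom_density /= bin0 expr0 subn0 !mulr1 subr0.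
- by rewrite /binom_density /= bin0n /= !mul0r subr0.
- have := IH 0%N; rewrite binom_tail0 /= !binom_tail0 /binom_density !bin0 !expr0 !subn0 exprS => h.
  have -> : 1 * 1 * ((1 - q) * (1 - q) ^+ n) = (1 - q) * (1 * 1 * (1 - q) ^+ n) by ring.
  by rewrite -h; ring.
- rewrite /=; ring.
Qed.

(** The m+1-st smallest of n + 1 uniform variables has this density at q. *)
Lemma is_derive_binom_tail n m (q : R) :
  is_derive q 1 (fun q => binom_tail q n.+1 m.+1) (n.+1%:R * binom_density q n m).
Proof.
have d1 (x : R) : is_derive x 1 (fun q : R => 1 - q) (- 1).
  by apply: (is_derive_ext (is_deriveB (is_derive_cst (1 : R) x (1 : R)) (is_derive_id x (1 : R)))) => //; rewrite sub0r.
have dM (F G : R -> R) (x a b : R) : is_derive x 1 F a -> is_derive x 1 G b ->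
    is_derive x 1 (fun q => (1 - q) * F q + q * G q) ((G x - F x) + ((1 - x) * a + x * b)).
  move=> dF dG; have hF := is_deriveM (d1 x) dF; have hG := is_deriveM (is_derive_id x (1 : R)) dG.
  apply: (is_derive_ext (is_deriveD hF hG)) => //.
  by rewrite /GRing.scale /=; ring.
elim: n m q => [|n IH] m q.
  case: m => [|m].
    apply: (is_derive_ext (is_derive_id q (1 : R))) => [x|] /=; first by rewrite mulr0 add0r mulr1.
    by rewrite /binom_density bin0 expr0 subn0 expr0 !mulr1.
  apply: (is_derive_ext (is_derive_cst (0 : R) q (1 : R))) => [x|] /=; first by rewrite !mulr0 addr0.
  by rewrite /binom_density bin0n /= !mul0r mulr0.
case: m => [|m].
  have := dM (fun q => binom_tail q n.+1 1) (fun=> 1) q _ _ (IH 0%N q) (is_derive_cst (1 : R) q (1 : R)).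
  move=> h; apply: (is_derive_ext h) => [x|]; first by rewrite /= !binom_tail0.
  have := binom_tailB q n.+1 0; rewrite binom_tail0 => ->.
  rewrite mulr0 addr0 /binom_density !bin0 !expr0 !subn0 exprS -(natr1 n.+1); ring.
have h := dM _ _ q _ _ (IH m.+1 q) (IH m q).
apply: (is_derive_ext h) => // .
rewrite binom_tailB (binom_densityS q n m) -(natr1 n.+1); ring.
Qed.

(** At q = y / (n + 1) the density converges to a Gamma density in y. *)
Definition scaled_density (n m : nat) (y : R) : R := binom_density (y / n.+1%:R) n m.

Lemma binom_density_continuous n m (x : R) : {for x, continuous (fun q => binom_density q n m)}.
Proof.
rewrite /binom_density; apply: cvgM; last first.
  apply: (@continuous_comp _ _ _ (fun q : R => 1 - q) (fun z => z ^+ (n - m))).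
    by apply: cvgB; [exact: cvg_cst|exact: cvg_id].
  exact: exprn_continuous.
by apply: cvgMr; exact: exprn_continuous.
Qed.

Lemma scaled_density_continuous n m (x : R) : {for x, continuous (scaled_density n m)}.
Proof.
apply: (@continuous_comp _ _ _ (fun y : R => y / n.+1%:R) (fun q => binom_density q n m)).
  by apply: cvgMl; exact: cvg_id.
exact: binom_density_continuous.
Qed.

Lemma measurable_scaled_density n m (D : set R) : measurable_fun D (scaled_density n m).
Proof.
apply: measurable_funTS; apply: continuous_measurable_fun => x; exact: scaled_density_continuous.
Qed.

Lemma scaled_density_ge0 n m y : 0 <= y <= n.+1%:R -> 0 <= scaled_density n m y.
Proof.
move=> /andP[y0 yn]; rewrite /scaled_density /binom_density !mulr_ge0// ?exprn_ge0 ?divr_ge0//.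
by rewrite subr_ge0 ler_pdivrMr// mul1r.
Qed.

Lemma binom_tail_integral (p : R) n m : 0 <= p <= 1 ->
  (\int[leb]_(y in `]0%R, +oo[) (scaled_density n m y * (y <= n.+1%:R * p)%R%:R)%:E =
   (binom_tail p n.+1 m.+1)%:E)%E.
Proof.
move=> /andP[p0 p1].
have np0 : 0 <= n.+1%:R * p by rewrite mulr_ge0.
have -> : (\int[leb]_(y in `]0%R, +oo[) (scaled_density n m y * (y <= n.+1%:R * p)%R%:R)%:E =
   \int[leb]_(y in `]0%R, (n.+1%:R * p)%R]) (scaled_density n m y)%:E)%E.
  have -> : `]0%R, (n.+1%:R * p)%R]%classic = (`]0%R, +oo[%classic `&` `]-oo, (n.+1%:R * p)%R]%classic) :> set R.
    by apply/seteqP; split => y; rewrite /= !in_itv/= ?andbT => /andP.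
  rewrite integral_mkcondr; apply: eq_integral => y _; rewrite patchE.
  case: ifPn => [/set_mem|]; first by rewrite /= in_itv/= => ->; rewrite mulr1.
  by move/negP; rewrite inE /= in_itv/= => /negP/negbTE ->; rewrite mulr0.
rewrite integral_itv_obnd_cbnd; last first.
  by apply/measurable_EFinP; exact: measurable_scaled_density.
move: np0; rewrite le_eqVlt => /predU1P[e|np0].
  rewrite -e set_itv1 integral_set1.
  have /eqP : n.+1%:R * p = 0 by rewrite -e.
  by rewrite mulf_eq0 pnatr_eq0 orFb => /eqP ->; rewrite binom_tail_q0.
have dT (x : R) : is_derive x 1 (fun y => binom_tail (y / n.+1%:R) n.+1 m.+1) (scaled_density n m x).
  have h1 : is_derive x 1 (fun y : R => y / n.+1%:R) (n.+1%:R^-1).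
    apply: (is_derive_ext (is_deriveZ (n.+1%:R^-1 : R) (is_derive_id x (1 : R)))).
      by move=> t; rewrite /= /GRing.scale /= mulrC.
    by rewrite /GRing.scale /= mulr1.
  have h2 := @is_derive_binom_tail n m (x / n.+1%:R).
  have h3 := @is_derive1_comp R (fun q => binom_tail q n.+1 m.+1) (fun y : R => y / n.+1%:R) x _ _ h2 h1; apply: (is_derive_ext h3) => //.
  rewrite /scaled_density mulrAC mulfV ?mul1r// pnatr_eq0//.
rewrite (integral_derivative np0 (fun x _ => dT x)); last first.
  by move=> x _; exact: scaled_density_continuous.
by rewrite mul0r binom_tail_q0 subr0 mulrAC divff ?mul1r// pnatr_eq0.
Qed.

End BinomialDensity.

Section DensityLimit.
Context {R : realType}.

Lemma ffact_le_expn n m : (n ^_ m <= n ^ m)%N.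
Proof.
elim: m => [|m IH]; first by rewrite ffactn0 expn0.
by rewrite ffactnSr expnSr leq_mul// leq_subr.
Qed.

Lemma bin_le_expn n m : ('C(n, m) <= n ^ m)%N.
Proof.
apply: leq_trans (ffact_le_expn n m); rewrite -bin_ffact leq_pmulr//; exact: fact_gt0.
Qed.

(** Bounds 'C(n, m) by n^m and 1 - q by e^-q. The constant e^(m+1) compensates
    for the exponent being n - m instead of n + 1. *)
Lemma scaled_density_le n m (y : R) : 0 <= y <= n.+1%:R ->
  scaled_density n m y <= y ^+ m * (expR m.+1%:R * expR (- y)).
Proof.
move=> /andP[y0 yn]; rewrite /scaled_density /binom_density.
have N0 : 0 < n.+1%:R :> R by [].
have [mn|nm] := leqP m n; last first.
  by rewrite bin_small// !mul0r !mulr_ge0 ?exprn_ge0 ?expR_ge0.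
have x1 : 0 <= 1 - y / n.+1%:R by rewrite subr_ge0 ler_pdivrMr// mul1r.
apply: ler_pM.
- by rewrite mulr_ge0// exprn_ge0// divr_ge0.
- exact: exprn_ge0.
- rewrite expr_div_n mulrA ler_pdivrMr ?exprn_gt0// mulrC ler_wpM2l ?exprn_ge0//.
  rewrite -natrX ler_nat (leq_trans (bin_le_expn n m))//.
  by case: m {mn} => [//|m]; rewrite leq_exp2r.
- apply: (@le_trans _ _ (expR (- (y / n.+1%:R)) ^+ (n - m))).
    by rewrite lerXn2r ?nnegrE ?expR_ge0// (le_trans _ (expR_ge1Dx _)).
  rewrite -expRM_natr -expRD ler_expR natrB//.
  have -> : n%:R - m%:R = n.+1%:R - m.+1%:R :> R by rewrite -(natr1 n) -(natr1 m); ring.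
  have -> : - (y / n.+1%:R) * (n.+1%:R - m.+1%:R) = m.+1%:R * (y / n.+1%:R) - y.
    by have : (n.+1%:R : R) != 0; [rewrite gt_eqF|move: (n.+1%:R) (m.+1%:R) => N M N1; field].
  by rewrite lerD2r ler_piMr// ler_pdivrMr// mul1r.
Qed.

Lemma bin_ratio_cvg m : ('C(n, m)%:R / n.+1%:R ^+ m : R) @[n --> \oo] --> (m`!%:R^-1 : R).
Proof.
elim: m => [|m IH].
  under eq_fun do rewrite bin0 expr0 divr1; rewrite fact0 invr1; exact: cvg_cst.
have r1 : ((n - m)%:R / n.+1%:R : R) @[n --> \oo] --> (1 : R).
  have h : (1 - m.+1%:R * n.+1%:R^-1 : R) @[n --> \oo] --> (1 : R).
    rewrite -[X in _ --> X]subr0 -(mulr0 m.+1%:R); apply: cvgB; first exact: cvg_cst.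
    by apply: cvgMr; exact: cvg_harmonic.
  apply: cvg_trans h; apply: near_eq_cvg; exists m => // n /= mn.
  rewrite natrB// -(natr1 m); have n0 : (n%:R + 1 : R) != 0 by rewrite natr1 pnatr_eq0.
  by rewrite -(natr1 n); field.
have -> : (fun n => 'C(n, m.+1)%:R / n.+1%:R ^+ m.+1 : R) =
  (fun n => ('C(n, m)%:R / n.+1%:R ^+ m) * ((n - m)%:R / n.+1%:R) * m.+1%:R^-1).
  apply/funext => n; have n0 : (n.+1%:R : R) != 0 by rewrite pnatr_eq0.
  have m0 : (m.+1%:R : R) != 0 by rewrite pnatr_eq0.
  have : m.+1%:R * 'C(n, m.+1)%:R = (n - m)%:R * 'C(n, m)%:R :> R by rewrite -!natrM mul_bin_left.
  move: (n.+1%:R) (m.+1%:R) n0 m0 => N M n0 m0 h; rewrite exprS.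
  have -> : 'C(n, m.+1)%:R = (n - m)%:R * 'C(n, m)%:R / M :> R by rewrite -h mulrAC divff// mul1r.
  by field; rewrite ?n0 ?m0 ?expf_neq0.
have -> : (m.+1)`!%:R^-1 = m`!%:R^-1 * 1 * m.+1%:R^-1 :> R.
  by rewrite factS natrM invfM mulr1 mulrC.
by apply: cvgMl; apply: cvgM.
Qed.

Lemma one_minus_pow_cvg m (y : R) : 0 < y ->
  ((1 - y / n.+1%:R) ^+ (n - m) : R) @[n --> \oo] --> expR (- y).
Proof.
move=> y0.
have hc : (y * n.+1%:R^-1 : R) @[n --> \oo] --> (0 : R).
  by rewrite -(mulr0 y); apply: cvgMr; exact: cvg_harmonic.
apply: (@squeeze_cvgr _ _ _ _
  (fun n => expR (- (y / (1 - y * n.+1%:R^-1))))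
  (fun n => expR (- y + m.+1%:R * (y * n.+1%:R^-1)))).
- near=> n.
  have N0 : 0 < n.+1%:R :> R by [].
  have yn : y < n.+1%:R.
    by apply: (@lt_le_trans _ _ n%:R); [near: n; exact: nbhs_infty_gtr|rewrite ler_nat].
  have mn : (m <= n)%N by near: n; exact: nbhs_infty_ge.
  set x := y * n.+1%:R^-1.
  have x0 : 0 < x by rewrite mulr_gt0 ?invr_gt0.
  have x1 : x < 1 by rewrite ltr_pdivrMr// mul1r.
  have x10 : 0 < 1 - x by rewrite subr_gt0.
  have e : x * n.+1%:R = y by rewrite /x divfK// gt_eqF.
  apply/andP; split.
    apply: (@le_trans _ _ ((1 - x) ^+ n.+1)); last first.
      by rewrite ler_wiXn2l ?(ltW x10)// ?gerBl ?(ltW x0)// (leq_trans (leq_subr _ _)).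
    have -> : - (y / (1 - x)) = - (x / (1 - x)) * n.+1%:R.
      by rewrite mulNr [in RHS]mulrAC e.
    rewrite expRM_natr lerXn2r ?nnegrE ?expR_ge0 ?(ltW x10)//.
    rewrite expRN -[leRHS]invrK lef_pV2 ?posrE ?invr_gt0 ?expR_gt0//.
    have := expR_ge1Dx (x / (1 - x)); apply: le_trans.
    by rewrite le_eqVlt; apply/orP; left; apply/eqP; field; rewrite gt_eqF.
  apply: (@le_trans _ _ (expR (- x) ^+ (n - m))).
    by rewrite lerXn2r ?nnegrE ?expR_ge0 ?(ltW x10)// (le_trans _ (expR_ge1Dx _)).
  rewrite -expRM_natr ler_expR natrB//.
  have -> : n%:R - m%:R = n.+1%:R - m.+1%:R :> R by rewrite -(natr1 n) -(natr1 m); ring.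
  by rewrite mulrBr !mulNr e opprK mulrC.
- have h : (- (y / (1 - y * n.+1%:R^-1)) : R) @[n --> \oo] --> - y.
    apply: cvgN; rewrite -[X in _ --> X]mulr1; apply: cvgMr.
    rewrite -[X in _ --> X]invr1; apply: cvgV; first exact: oner_neq0.
    by rewrite -[X in _ --> X]subr0; apply: cvgB => //; exact: cvg_cst.
  exact: (cvg_comp _ _ h (@continuous_expR R (- y))).
- have h : (- y + m.+1%:R * (y * n.+1%:R^-1) : R) @[n --> \oo] --> - y.
    rewrite -[X in _ --> X]addr0 -(mulr0 m.+1%:R); apply: cvgD; first exact: cvg_cst.
    exact: cvgMr.
  exact: (cvg_comp _ _ h (@continuous_expR R (- y))).
Unshelve. all: by end_near. Qed.

(** The Poisson limit of the binomial probabilities. *)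
Lemma scaled_density_cvg m (y : R) : 0 < y ->
  scaled_density n m y @[n --> \oo] --> m`!%:R^-1 * y ^+ m * expR (- y).
Proof.
move=> y0.
have -> : (fun n => scaled_density n m y) =
    (fun n => ('C(n, m)%:R / n.+1%:R ^+ m) * y ^+ m * (1 - y / n.+1%:R) ^+ (n - m)).
  by apply/funext => n; rewrite /scaled_density /binom_density expr_div_n; congr (_ * _); ring.
apply: cvgM; last exact: one_minus_pow_cvg.
by apply: cvgMl; exact: bin_ratio_cvg.
Qed.

End DensityLimit.

(** * Counting states of large mass with the inverse of phi *)

Section InverseCount.
Context {R : realType}.
Variables (p : nat -> R) (phi : R -> R).
Hypotheses (p_pmf : is_pmf p) (p_decr : standing_decreasing p) (phi_ext : is_extension p phi).

Lemma pmf_antitone x y : (1 <= x)%N -> (x <= y)%N -> p y <= p x.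
Proof.
move=> x1; elim: y => [|y IH]; first by rewrite leqn0 => /eqP x0; rewrite x0 in x1.
rewrite leq_eqVlt => /orP[/eqP -> //|]; rewrite ltnS => xy.
by apply: le_trans (IH xy); apply: p_decr.1; exact: leq_trans xy.
Qed.

Lemma pmf_gt0 x : (1 <= x)%N -> 0 < p x.
Proof.
move=> x1; have [_ [N _ hN]] := p_decr.
have [h _] := hN (maxn x N) (leq_maxr _ _).
apply: (lt_le_trans h); apply: pmf_antitone => //.
by apply: leqW; exact: leq_maxl.
Qed.

Lemma pmf_cvg0 : p x @[x --> \oo] --> (0 : R).
Proof.
have [_ p0 p1] := p_pmf.
have h : cvgn (series (fun x => p x.+1)).
  apply: nnseries_is_cvg => [i|]; first exact: p0.
  have := p1; rewrite -(@nneseries_addn _ (fun x => (p x)%:E) 1)//.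
  by under eq_eseriesr do rewrite addn1; move=> ->; rewrite ltry.
by have := cvg_series_cvg_0 h; rewrite (@cvg_shiftS _ p).
Qed.

(** phi increases only from some point B on. The threshold u0 exceeds the maximum
    of phi before B, so that the preimage of any u >= u0 lies in the increasing
    part and separates the states x with phi x <= u from the others. *)
Lemma phi_inv_count : exists2 u0 : R, 0 < u0 & forall u, u0 <= u ->
  1 <= phi_inv phi u /\
  forall x, (1 <= x)%N -> (1 <= u * p x) = (x%:R <= phi_inv phi u).
Proof.
have [phip cphi [A hA]] := phi_ext.
(* phi increases on [B, +oo[ and is continuous on [1, B] *)
pose B := Num.max A 1; have B1 : 1 <= B by rewrite le_max lexx orbT.
have AB : A <= B by rewrite le_max lexx.
have mono : {in `[B, +oo[ &, {homo phi : x y / x < y}}.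
  by move=> x y; rewrite !in_itv/= !andbT => Bx By; apply: hA; rewrite in_itv/= andbT (le_trans AB).
have cB : {within `[1, B], continuous phi}.
  by apply: continuous_subspaceW cphi => z; rewrite /= !in_itv/= andbT => /andP[].
have [c _ hc] := @EVT_max R phi 1 B B1 cB.
exists (Num.max (phi c + 1) 1); first by rewrite lt_max ltr01 orbT.
move=> u; rewrite ge_max => /andP[uc u1].
have u0 : 0 < u by rewrite (lt_le_trans ltr01).
have uB t : 1 <= t <= B -> phi t < u.
  by move=> tB; apply: (le_lt_trans (hc t _)); rewrite ?in_itv//; lra.
have [n [n1 Bn un]] : exists n, [/\ (1 <= n)%N, B <= n%:R & u <= phi n%:R].
  have h1 : \forall n \near \oo, p n < u^-1.
    by move/cvgrPdist_lt : pmf_cvg0 => /(_ u^-1); rewrite invr_gt0 => /(_ u0); apply: filterS => n;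
      rewrite sub0r normrN => h; exact: le_lt_trans (ler_norm _) h.
  have h2 : \forall n \near \oo, B <= n%:R by exact: nbhs_infty_ger.
  have h3 : \forall n \near \oo, (1 <= n)%N by exact: nbhs_infty_ge.
  have [n [[hn1 hn2] hn3]] := @filter_ex _ _ _ _ (filterI (filterI h1 h2) h3).
  exists n; split => //; rewrite phip// -[leLHS]invrK lef_pV2 ?posrE ?invr_gt0 ?pmf_gt0//.
  exact: ltW.
have [v vB phiv] : exists2 v, v \in `[B, n%:R] & phi v = u.
  apply: IVT => //.
    apply: continuous_subspaceW cphi => z; rewrite /= !in_itv/= andbT => /andP[h _].
    exact: le_trans h.
  have hB : phi B < u by apply: uB; rewrite B1 lexx.
  have Bn' : phi B <= phi n%:R by rewrite (le_trans (ltW hB)).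
  by rewrite (min_idPl Bn') (max_idPr Bn') (ltW hB).
pose w := phi_inv phi u.
have surj : set_surj `[1%R, +oo[ [set u] phi.
  move=> _ ->; exists v => //; move: vB; rewrite /= !in_itv/= andbT => /andP[h _]; exact: le_trans h.
have w1 : 1 <= w.
  have : `[1%R, +oo[%classic w by apply: (surjpinv_image_sub surj _); exists u.
  by rewrite /= in_itv/= andbT.
have phiw : phi w = u by apply: (surjpK _ surj); rewrite inE.
have Bw : B < w.
  by rewrite ltNge; apply/negP => wB; have := uB w; rewrite w1 wB phiw ltxx => /(_ isT).
split => // x x1; rewrite -/w.
have -> : (1 <= u * p x) = (phi x%:R <= u).
  by rewrite phip// -ler_pdivrMr ?pmf_gt0// mul1r.
have [xB|Bx] := leP x%:R B.
  by rewrite (ltW (uB _ _)) ?ler1n ?x1// (le_trans xB (ltW Bw)).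
rewrite -phiw; apply/idP/idP => [|]; last first.
  rewrite le_eqVlt => /predU1P[-> //|xw]; apply/ltW/mono => //; by rewrite in_itv/= andbT ltW.
apply: contraTT; rewrite -!ltNge => wx; apply: mono => //; by rewrite in_itv/= andbT ltW.
Qed.

End InverseCount.

(** * Growth of the mean number of repeatedly visited states *)

Section RepeatAsymptotics.
Context {R : realType}.
Local Notation leb := (@lebesgue_measure R).
Variables (p : nat -> R) (phi : R -> R) (g : R) (mu : probability nat R).
Hypotheses (p_pmf : is_pmf p) (p_decr : standing_decreasing p) (phi_ext : is_extension p phi).
Hypotheses (g0 : 0 < g) (g1 : g < 1) (phi_nc : non_critical phi g).
Hypothesis mu_p : forall x, letter_prob mu x = p x.
Local Notation V := (phi_inv phi).

Lemma p_01 x : 0 <= p x <= 1.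
Proof. by rewrite -mu_p letter_prob01. Qed.

Lemma count_below (v : R) : 0 <= v ->
  (\sum_(x <oo) ((x.+1%:R <= v)%R%:R : R)%:E = ((Num.truncn v)%:R)%:E)%E.
Proof.
move=> v0; rewrite (@nneseries_split _ _ 0 (Num.truncn v)); last by move=> k _; rewrite lee_fin.
rewrite add0n eseries0 ?adde0; last first.
  by move=> i iv _; rewrite -truncn_gt_nat ltnNge iv.
rewrite sumEFin big_nat (eq_bigr (fun=> 1)); last first.
  by move=> i /andP[_ iv]; rewrite -truncn_gt_nat iv.
by rewrite -big_nat sumr_const_nat subn0.
Qed.

Definition atom_count (u : R) : R := fine (\sum_(x <oo) ((1 <= u * p x.+1)%R%:R : R)%:E)%E.

Lemma phi_inv_threshold : exists2 u0 : R, 0 < u0 & forall u, u0 <= u ->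
  [/\ 1 <= V u, atom_count u = (Num.truncn (V u))%:R &
   (\sum_(x <oo) ((1 <= u * p x.+1)%R%:R : R)%:E)%E = ((Num.truncn (V u))%:R)%:E].
Proof.
have [u0 u00 hu] := phi_inv_count p_pmf p_decr phi_ext; exists u0 => // u u0u.
have [v1 hc] := hu u u0u.
have E : (\sum_(x <oo) ((1 <= u * p x.+1)%R%:R : R)%:E = ((Num.truncn (V u))%:R)%:E)%E.
  rewrite -count_below ?(le_trans ler01)//; apply: eq_eseriesr => x _.
  by rewrite hc.
by split => //; rewrite /atom_count E.
Qed.

Lemma atom_count_mono u u' : u <= u' ->
  (\sum_(x <oo) ((1 <= u * p x.+1)%R%:R : R)%:E <= \sum_(x <oo) ((1 <= u' * p x.+1)%R%:R : R)%:E)%E.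
Proof.
move=> uu; apply: lee_nneseries => x; first by move=> _; rewrite lee_fin.
move=> _; rewrite lee_fin ler_nat.
case: (boolP (1 <= u * p x.+1)) => // h; rewrite (le_trans h)// ler_wpM2r//.
by case/andP: (p_01 x.+1).
Qed.

Lemma atom_countE u : (\sum_(x <oo) ((1 <= u * p x.+1)%R%:R : R)%:E = (atom_count u)%:E)%E.
Proof.
have [u0 _ hu] := phi_inv_threshold.
rewrite /atom_count fineK// ge0_fin_numE; last by apply: nneseries_ge0 => x _ _; rewrite lee_fin.
have [_ _ E] := hu (Num.max u u0) (ltac:(by rewrite le_max lexx orbT)).
apply: (@le_lt_trans _ _ ((Num.truncn (V (Num.max u u0)))%:R)%:E); last exact: ltry.
by rewrite -E; apply: atom_count_mono; rewrite le_max lexx.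
Qed.

Lemma atom_count_ge0 u : 0 <= atom_count u.
Proof. by rewrite -lee_fin -atom_countE; apply: nneseries_ge0 => x _ _; rewrite lee_fin. Qed.

Lemma atom_count_le u u' : u <= u' -> atom_count u <= atom_count u'.
Proof. by move=> uu; rewrite -lee_fin -!atom_countE; exact: atom_count_mono. Qed.

Lemma phi_inv_unb : V n%:R @[n --> \oo] --> +oo.
Proof.
have [u0 u00 hu] := phi_inv_count p_pmf p_decr phi_ext.
apply/cvgryPge => A.
pose K := (Num.truncn `|A|).+1.
have pK : 0 < p K by exact: (pmf_gt0 p_decr).
have h1 : \forall n \near \oo, u0 <= n%:R by exact: nbhs_infty_ger.
have h2 : \forall n \near \oo, (p K)^-1 <= n%:R by exact: nbhs_infty_ger.
apply: filterS2 h1 h2 => n hn1 hn2; have [_ hc] := hu _ hn1.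
apply: (@le_trans _ _ K%:R); first by apply/ltW/(le_lt_trans (ler_norm _)); exact: truncnS_gt.
by rewrite -hc// -ler_pdivrMr// mul1r.
Qed.

Lemma count_series n m y : 0 < y ->
  ((scaled_density n m y * atom_count (n.+1%:R / y))%:E =
  \sum_(x <oo) (scaled_density n m y * (y <= n.+1%:R * p x.+1)%R%:R : R)%:E)%E.
Proof.
move=> y0; rewrite EFinM -atom_countE -nneseriesZl; last by move=> x _; rewrite lee_fin.
apply: eq_eseriesr => x _; rewrite EFinM; congr (_ * (nat_of_bool _)%:R%:E)%E.
by rewrite mulrAC ler_pdivlMr// mul1r.
Qed.

Lemma scaled_term_ge0 n m x y : 0 < y ->
  0 <= scaled_density n m y * (y <= n.+1%:R * p x.+1)%R%:R.
Proof.
move=> y0; case: (boolP (y <= n.+1%:R * p x.+1)) => [h|_]; last by rewrite mulr0.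
rewrite mulr1 scaled_density_ge0// ltW//= (le_trans h)// ler_piMr//.
by case/andP: (p_01 x.+1).
Qed.

Lemma measurable_scaled_term n m x (D : set R) :
  measurable_fun D (fun y => (scaled_density n m y * (y <= n.+1%:R * p x.+1)%R%:R : R)%:E).
Proof.
apply/measurable_EFinP; apply: measurable_funM; first exact: measurable_scaled_density.
apply: measurable_funTS.
have -> : (fun y : R => (y <= n.+1%:R * p x.+1)%R%:R) = \1_(`]-oo, n.+1%:R * p x.+1]%classic : set R) :> (R -> R).
  by apply/funext => y; rewrite indicE mem_setE in_itv.
exact: measurable_indic.
Qed.

(** The tail of the state x is an integral over y <= (n + 1) p x; summing over x
    under the integral counts the states satisfying this inequality. *)
Lemma mean_repeats_integral n m :
  ((mean_repeats mu n.+1 m.+1)%:E =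
  \int[leb]_(y in `]0%R, +oo[) (scaled_density n m y * atom_count (n.+1%:R / y))%:E)%E.
Proof.
have -> : (\int[leb]_(y in `]0%R, +oo[) (scaled_density n m y * atom_count (n.+1%:R / y))%:E =
   \int[leb]_(y in `]0%R, +oo[)
     \sum_(x <oo) (scaled_density n m y * (y <= n.+1%:R * p x.+1)%R%:R : R)%:E)%E.
  by apply: eq_integral => y /[!inE]; rewrite /= in_itv/= andbT => y0; rewrite count_series.
rewrite integral_nneseries//; last 2 first.
- by move=> x; exact: measurable_scaled_term.
- by move=> x y; rewrite /= in_itv/= andbT => y0; rewrite lee_fin scaled_term_ge0.
under eq_eseriesr do rewrite binom_tail_integral ?p_01// -mu_p.
apply/esym/cvg_lim => //.
have h := @sum_binom_tail_cvg R mu n.+1 m.+1 isT.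
have -> : (fun K => \sum_(0 <= i < K) (binom_tail (letter_prob mu i.+1) n.+1 m.+1)%:E)%E =
   EFin \o (fun K => \sum_(1 <= x < K.+1) binom_tail (letter_prob mu x) n.+1 m.+1).
  by apply/funext => K /=; rewrite sumEFin big_add1.
apply: cvg_EFin; first exact: nearW.
by move: h; rewrite -cvg_shiftS.
Qed.

Lemma measurable_density_count n m :
  measurable_fun (`]0%R, +oo[%classic : set R) (fun y => (scaled_density n m y * atom_count (n.+1%:R / y))%:E).
Proof.
apply: (eq_measurable_fun (fun y => \sum_(x <oo) (scaled_density n m y * (y <= n.+1%:R * p x.+1)%R%:R : R)%:E)%E).
  by move=> y /[!inE]; rewrite /= in_itv/= andbT => y0; rewrite count_series.
have := @ge0_emeasurable_sum _ _ R (`]0%R, +oo[%classic : set R)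
  (fun x y => (scaled_density n m y * (y <= n.+1%:R * p x.+1)%R%:R : R)%:E) xpredT.
apply => [x y|x _]; last exact: measurable_scaled_term.
by rewrite /= in_itv/= andbT => y0 _; rewrite lee_fin scaled_term_ge0.
Qed.

Lemma atom_count_lt1 u : 0 <= u -> u < 1 -> atom_count u = 0.
Proof.
move=> u0 u1; apply: EFin_inj; rewrite -atom_countE eseries0// => x _ _.
rewrite leNgt (le_lt_trans _ u1)//= -[leRHS]mulr1 ler_wpM2l//.
by case/andP: (p_01 x.+1).
Qed.

(** The bound must be integrable at 0 against the Gamma density, hence the
    exponent de < 1. The constant K takes care of the bounded values of n / y,
    which the domination hypothesis does not cover. *)
Lemma atom_count_domination : exists K C de N0 : R,
  [/\ 0 <= K, 0 <= C, de < 1 & forall n y, N0 <= n%:R -> 0 < y ->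
    (V n%:R)^-1 * atom_count (n%:R / y) <= K + C * y `^ (- de)].
Proof.
have [u0 u00 hu] := phi_inv_threshold.
(* g - e >= 0 keeps the smaller power bounded for la <= 1, and g + e < 1 *)
pose e := Num.min g ((1 - g) / 2).
have e0 : 0 < e by rewrite lt_min g0 divr_gt0 ?subr_gt0.
have eg : 0 <= g - e by rewrite subr_ge0 ge_min lexx.
have [C [x0 hC]] := phi_nc.2 _ e0.
pose X := Num.max x0 u0.
have Xx : x0 <= X by rewrite le_max lexx.
have Xu : u0 <= X by rewrite le_max lexx orbT.
exists (atom_count X + `|C|), `|C|, (g + e), X; split => //.
- by rewrite addr_ge0 ?atom_count_ge0.
- have : e <= (1 - g) / 2 by rewrite ge_min lexx orbT.
  by move: g1; lra.
move=> n y Xn y0.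
have [v1 _ _] := hu _ (le_trans Xu Xn).
have v0 : 0 < V n%:R by rewrite (lt_le_trans ltr01).
have K0 : 0 <= `|C| * y `^ (- (g + e)) by rewrite mulr_ge0 ?powR_ge0.
have [Xy|yX] := leP X (n%:R / y); last first.
  rewrite -addrA -[leLHS]addr0; apply: lerD; last by rewrite addr_ge0.
  by apply: le_trans (atom_count_le (ltW yX)); rewrite ler_piMl ?atom_count_ge0 ?invf_le1.
have [w1 -> _] := hu _ (le_trans Xu Xy).
apply: (@le_trans _ _ (V (n%:R / y) / V n%:R)).
  by rewrite mulrC ler_wpM2r ?invr_ge0 ?(ltW v0)// truncn_le (le_trans ler01).
apply: (le_trans (hC n y^-1 _ (le_trans Xx Xn) (le_trans Xx Xy))); first by rewrite invr_gt0.
have -> : y `^ (- (g + e)) = y^-1 `^ (g + e) by rewrite powRN -[in RHS]powR_inv1 ?(ltW y0)// -powRrM mulN1r powRN.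
apply: (@le_trans _ _ (`|C| * (1 + y^-1 `^ (g + e)))); last first.
  by rewrite mulrDr mulr1 lerD2r lerDr atom_count_ge0.
apply: (le_trans (ler_wpM2r _ (ler_norm C))); first by rewrite le_max powR_ge0.
rewrite ler_wpM2l// ge_max lerDr ler01 andbT.
have [y1|y1] := leP y^-1 1.
  rewrite -[leLHS]addr0 lerD ?powR_ge0//.
  by rewrite -[leRHS](powRr0 y^-1) ger_powR ?invr_gt0 ?y0.
by rewrite -[leLHS]add0r lerD// ler_powR ?(ltW y1)// lerD2l (le_trans _ (ltW e0))// oppr_le0 ltW.
Qed.

(** Rounding changes the count by at most one, which V n makes negligible. *)
Lemma atom_count_cvg y : 0 < y ->
  (V n%:R)^-1 * atom_count (n%:R / y) @[n --> \oo] --> y `^ (- g).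
Proof.
move=> y0; have [u0 u00 hu] := phi_inv_threshold.
have iy0 : 0 < y^-1 by rewrite invr_gt0.
have c1 := phi_nc.1 _ iy0.
have c2 : (V n%:R)^-1 @[n --> \oo] --> (0 : R).
  apply/gtr0_cvgV0; last exact: phi_inv_unb.
  have : \forall n \near \oo, u0 <= n%:R by exact: nbhs_infty_ger.
  by apply: filterS => n /hu[v1 _ _]; exact: lt_le_trans v1.
have -> : y `^ (- g) = y^-1 `^ g by rewrite powRN -[in RHS]powR_inv1 ?(ltW y0)// -powRrM mulN1r powRN.
apply: (@squeeze_cvgr _ _ _ _ (fun n => V (n%:R / y) / V n%:R - (V n%:R)^-1) (fun n => V (n%:R / y) / V n%:R)).
- have h1 : \forall n \near \oo, u0 <= n%:R by exact: nbhs_infty_ger.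
  have h2 : \forall n \near \oo, u0 * y <= n%:R by exact: nbhs_infty_ger.
  apply: filterS2 h1 h2 => n n1 n2.
  have n3 : u0 <= n%:R / y by rewrite ler_pdivlMr.
  have [v1 _ _] := hu _ n1; have [w1 -> _] := hu _ n3.
  have v0 : 0 <= (V n%:R)^-1 by rewrite invr_ge0 (le_trans ler01).
  have /andP[t1 t2] := @truncn_itv _ (V (n%:R / y)) (le_trans ler01 w1).
  have -> : V (n%:R / y) / V n%:R - (V n%:R)^-1 = (V n%:R)^-1 * (V (n%:R / y) - 1) by ring.
  rewrite [V (n%:R / y) / _]mulrC; apply/andP; split; apply: ler_wpM2l => //.
  by rewrite lerBlDr natr1 ltW.
- by rewrite -[X in _ --> X]subr0; apply: cvgB.
- exact: c1.
Qed.

(** Dominated convergence in [mean_repeats_integral], after division by V. The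
    dominating function is a combination of two Gamma kernels. *)
Lemma mean_repeats_phi_inv m :
  mean_repeats mu n m.+1 / V n%:R @[n --> \oo] --> Gamma (m.+1%:R - g) / m`!%:R.
Proof.
have [K [C [de [N0 [K0 C0 de1 hdom]]]]] := atom_count_domination.
have [u0 u00 hu] := phi_inv_threshold.
(* the index is shifted by M so that the domination holds from the start *)
pose M := Num.truncn (`|N0| + u0).
have hM n : N0 <= (n + M).+1%:R /\ u0 <= (n + M).+1%:R.
  have h : `|N0| + u0 <= (n + M).+1%:R.
    by apply: (le_trans (ltW (truncnS_gt _))); rewrite ler_nat ltnS leq_addl.
  split; apply: le_trans h.
    by rewrite (le_trans (ler_norm _))// lerDl ltW.
  by rewrite lerDr.
pose F n y := ((V (n + M).+1%:R)^-1 * (scaled_density (n + M) m y * atom_count ((n + M).+1%:R / y)))%:E.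
pose L y := (m`!%:R^-1 * gamma_kernel (m.+1%:R - g) y)%:E.
pose B y := (expR m.+1%:R * (K * gamma_kernel m.+1%:R y + C * gamma_kernel (m.+1%:R - de) y))%:E.
have V0 n : 0 < V (n + M).+1%:R.
  by have [_ h] := hM n; have [v1 _ _] := hu _ h; exact: lt_le_trans v1.
have Fint n : (\int[leb]_(y in `]0%R, +oo[) F n y = (mean_repeats mu (n + M).+1 m.+1 / V (n + M).+1%:R)%:E)%E.
  rewrite mulrC EFinM mean_repeats_integral -ge0_integralZl//.
  - exact: measurable_density_count.
  - move=> y; rewrite /= in_itv/= andbT => y0.
    rewrite count_series//; apply: nneseries_ge0 => x _ _.
    by rewrite lee_fin scaled_term_ge0.
  - by rewrite lee_fin invr_ge0 ltW.
have iS (a : R) s : 0 < s -> leb.-integrable `]0%R, +oo[ (EFin \o (fun y => a * gamma_kernel s y)).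
  by move=> s0; apply: (integrableZl _ a (gamma_kernel_integrable s0)).
have s1 : 0 < m.+1%:R - de :> R by rewrite subr_gt0 (lt_le_trans de1)// ler1n.
have s2 : 0 < m.+1%:R - g :> R by rewrite subr_gt0 (lt_le_trans g1)// ler1n.
have s3 : 0 < m.+1%:R :> R by [].
have Lint : (\int[leb]_(y in `]0%R, +oo[) L y = (Gamma (m.+1%:R - g) / m`!%:R)%:E)%E.
  rewrite mulrC EFinM GammaE// -ge0_integralZl//.
  - by apply/measurable_EFinP; exact: measurable_gamma_kernel.
  - by move=> y _; rewrite lee_fin gamma_kernel_ge0.
have kE s (y : R) : 0 < y -> gamma_kernel s y = y `^ s * y^-1 * expR (- y).
  by move=> y0; rewrite /gamma_kernel powRD ?powR_inv1 ?(ltW y0)//; apply/implyP => _; rewrite gt_eqF.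
have powS (y : R) : 0 < y -> y `^ m.+1%:R * y^-1 = y ^+ m.
  by move=> y0; rewrite powR_mulrn ?(ltW y0)// exprSr mulfK// gt_eqF.
have powB (y : R) s : 0 < y -> y `^ (m.+1%:R - s) * y^-1 = y ^+ m * y `^ (- s).
  move=> y0; rewrite powRD; last by apply/implyP => _; rewrite gt_eqF.
  by rewrite -powS//; ring.
suff h : (fine (\int[leb]_(y in `]0%R, +oo[) F n y)) @[n --> \oo] --> Gamma (m.+1%:R - g) / m`!%:R.
  rewrite -(cvg_shiftn M.+1) /=; apply: cvg_trans h; apply: near_eq_cvg; apply: nearW => n.
  by rewrite Fint /= addnS.
apply: fine_cvg; rewrite -Lint; apply: (@dominated_cvg _ _ _ leb _ _ F L B) => //.
- move=> n; apply: (eq_measurable_fun (fun y => (V (n + M).+1%:R)^-1%:E * (scaled_density (n + M) m y * atom_count ((n + M).+1%:R / y))%:E)%E) => //.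
  by apply: measurable_funeM; exact: measurable_density_count.
- move=> y; rewrite /= in_itv/= andbT => y0; apply: cvg_EFin; first exact: nearW.
  have -> : m`!%:R^-1 * gamma_kernel (m.+1%:R - g) y = (m`!%:R^-1 * y ^+ m * expR (- y)) * y `^ (- g).
    by rewrite kE// powB//; ring.
  have h1 := @scaled_density_cvg R m y y0; rewrite -(cvg_shiftn M) in h1.
  have h2 := atom_count_cvg y0; rewrite -(cvg_shiftn M.+1) in h2.
  apply: cvg_trans (cvgM h1 h2); apply: near_eq_cvg; apply: nearW => n /=.
  by rewrite addnS; ring.
- have : leb.-integrable `]0%R, +oo[ (fun y => (expR m.+1%:R)%:E *
      ((K * gamma_kernel m.+1%:R y)%:E + (C * gamma_kernel (m.+1%:R - de) y)%:E))%E.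
    by apply: integrableZl => //; apply: integrableD => //; exact: iS.
  by [].
- move=> n y; rewrite /= in_itv/= andbT => y0.
  have [N1 N2] := hM n; set N := (n + M).+1 in N1 N2.
  have B0 : 0 <= expR m.+1%:R * (K * gamma_kernel m.+1%:R y + C * gamma_kernel (m.+1%:R - de) y).
    by rewrite mulr_ge0 ?expR_ge0// addr_ge0// mulr_ge0// gamma_kernel_ge0.
  rewrite /F /B -/N; have [yN|Ny] := leP y N%:R; last first.
    rewrite atom_count_lt1 ?divr_ge0 ?(ltW y0) ?ltr_pdivrMr ?mul1r//.
    by rewrite !mulr0 normr0 lee_fin.
  have h1 : 0 <= y <= (n + M).+1%:R by rewrite (ltW y0).
  have d0 := @scaled_density_ge0 R (n + M) m y h1.
  have hle := @scaled_density_le R (n + M) m y h1.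
  have c0 : 0 <= (V N%:R)^-1 * atom_count (N%:R / y).
    by rewrite mulr_ge0 ?atom_count_ge0 ?invr_ge0 ?(ltW (V0 n)).
  have q0 := mulr_ge0 d0 c0.
  rewrite lee_fin mulrCA ger0_norm//.
  apply: (le_trans (ler_pM d0 c0 hle (hdom N y N1 y0))).
  rewrite le_eqVlt; apply/orP; left; apply/eqP.
  by rewrite !kE// powS// powB//; ring.
Qed.

Lemma mean_repeats_unb : mean_repeats mu n 1 @[n --> \oo] --> +oo.
Proof.
have c := @mean_repeats_phi_inv 0.
have G0 : 0 < Gamma (1 - g) by rewrite Gamma_gt0 ?subr_gt0.
rewrite fact0 divr1 in c; apply/cvgryPge => A.
have h1 : \forall n \near \oo, Gamma (1 - g) / 2 < mean_repeats mu n 1 / V n%:R.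
  by apply: (cvgr_gt _ c); rewrite ltr_pdivrMr// mulr_natr mulr2n ltrDl.
have h2 : \forall n \near \oo, Num.max 1 (A / (Gamma (1 - g) / 2)) <= V n%:R.
  by move/cvgryPge : phi_inv_unb; exact.
apply: filterS2 h1 h2 => n; rewrite ge_max => h1 /andP[v1 v2].
have v0 : 0 < V n%:R by rewrite (lt_le_trans ltr01).
move: v2; rewrite ler_pdivrMr ?divr_gt0// => v2; apply: (le_trans v2).
by rewrite mulrC -ler_pdivlMr// ltW.
Qed.

Lemma mean_repeats_ratio m : (0 < m)%N ->
  mean_repeats mu n m / mean_repeats mu n 1 @[n --> \oo] --> repeat_ratio g m.
Proof.
case: m => // m _.
have G0 : 0 < Gamma (1 - g) by rewrite Gamma_gt0 ?subr_gt0.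
have c1 := @mean_repeats_phi_inv 0; rewrite fact0 divr1 in c1.
have c2 : (mean_repeats mu n m.+1 / V n%:R) * (mean_repeats mu n 1 / V n%:R)^-1 @[n --> \oo] -->
    Gamma (m.+1%:R - g) / m`!%:R / Gamma (1 - g).
  by apply: cvgM; [exact: mean_repeats_phi_inv|exact: cvgV (lt0r_neq0 G0) c1].
have -> : repeat_ratio g m.+1 = Gamma (m.+1%:R - g) / m`!%:R / Gamma (1 - g).
  by rewrite /repeat_ratio /= invfM mulrA.
apply: cvg_trans c2; apply: near_eq_cvg.
have : \forall n \near \oo, 1 <= V n%:R by move/cvgryPge : phi_inv_unb; exact.
apply: filterS => n v1 /=.
have v0 : V n%:R != 0 by rewrite gt_eqF// (lt_le_trans ltr01).
by rewrite invfM invrK mulrACA mulVf// mulr1.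
Qed.

End RepeatAsymptotics.

(** * Range and degree statistics as functions of words *)

Section PathWords.
Local Open Scope nat_scope.

Lemma posN_sum (f : nat -> nat) K : (forall x, K <= x -> f x = 0) ->
  \big[addn/0]_(x \in posN) f x = \sum_(1 <= x < K) f x.
Proof.
move=> f0; rewrite (@fsbigE nat 0 _ nat posN (index_iota 1 K) f) ?iota_uniq//.
- rewrite big_seq_cond [RHS]big_seq_cond; apply: eq_bigl => x.
  rewrite mem_index_iota andbT; case: (boolP (1 <= x < K)) => //= /andP[x1 _].
  by rewrite mem_set.
- by move=> x; rewrite /= mem_index_iota => /andP[].
- move=> x x1; rewrite mem_index_iota negb_and -!leqNgt => /orP[|/f0//].
  by rewrite leqNgt -/(is_true _) x1.
Qed.

Lemma nth_path_word s n i : 1 <= i <= n -> nth 0 (0 :: path_word s n) i = s i.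
Proof.
case: i => [//|i] /andP[_ i_n] /=.
by rewrite (nth_map 0) ?size_iota// nth_iota.
Qed.

Lemma take_path_word s n : take n (path_word s n.+1) = path_word s n.
Proof. by rewrite path_wordS -cats1 take_size_cat ?size_path_word. Qed.

Lemma visits_count s n x : visits s n x = count_mem x (path_word s n).
Proof.
rewrite /visits /path_word -sum1_count big_map /index_iota subn1 /=.
by rewrite [RHS]big_mkcond; apply: eq_bigr => i _; case: eqP.
Qed.

Lemma visits_large s n x : letter_bound (path_word s n) <= x -> visits s n x = 0.
Proof.
move=> h; rewrite visits_count; apply/count_memPn/negP => /mem_letter_bound.
by rewrite ltnNge h.
Qed.

Lemma range_ge_repeats s n l : 0 < l -> range_ge s n l = repeats l (path_word s n).
Proof.
move=> l0; rewrite /range_ge (posN_sum (K := letter_bound (path_word s n))).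
  by apply: eq_bigr => x _; rewrite visits_count.
by move=> x /visits_large ->; rewrite leqn0 -leqn0 leqNgt l0.
Qed.

Lemma range_eq_repeats s n l : 0 < l ->
  range_eq s n l + repeats l.+1 (path_word s n) = repeats l (path_word s n).
Proof.
move=> l0; rewrite /range_eq (posN_sum (K := letter_bound (path_word s n))); last first.
  by move=> x /visits_large ->; case: l l0.
rewrite -big_split; apply: eq_bigr => x _; rewrite visits_count /=.
by case: ltngtP.
Qed.

Lemma sum_mem_undup (w : seq nat) K : all (leq 1) w -> letter_bound w <= K ->
  \sum_(1 <= x < K) (x \in w) = size (undup w).
Proof.
move=> w1 wK; rewrite -sum1_size.
rewrite [LHS](eq_bigr (fun x => if x \in w then 1 else 0)); last by move=> x _; case: (_ \in _).
rewrite -big_mkcond -big_filter; apply: perm_big; apply: uniq_perm.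
- by rewrite filter_uniq// iota_uniq.
- exact: undup_uniq.
- move=> x; rewrite mem_filter mem_index_iota mem_undup; case: (boolP (x \in w)) => // xw.
  by rewrite (allP w1 _ xw) (leq_trans (mem_letter_bound xw) wK).
Qed.

Lemma path_word_pos s n : (forall i, 1 <= i -> 0 < s i) -> all (leq 1) (path_word s n).
Proof.
by move=> s0; apply/allP => x /mapP[i]; rewrite mem_iota => /andP[i1 _] ->; exact: s0.
Qed.

Lemma range_size_repeats s n : (forall i, 1 <= i -> 0 < s i) ->
  range_size s n = repeats 1 (path_word s n).
Proof.
move=> s0; rewrite /range_size /index_iota subn1 -(@sum_mem_undup _ (letter_bound (path_word s n)))//.
  by apply: eq_bigr => x _; rewrite -has_count has_pred1.
exact: path_word_pos.
Qed.

End PathWords.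

Section DegreeCensus.
Local Open Scope nat_scope.

Definition exact_census l (Phi : pred (seq (nat * nat))) (w : seq nat) : nat :=
  \sum_(1 <= x < letter_bound w) ((size (neighbours x 0 w) == l) && Phi (neighbours x 0 w)).

Definition full_census (Phi : pred (seq (nat * nat))) (w : seq nat) : nat :=
  \sum_(1 <= x < letter_bound w) Phi (neighbours x 0 w).

Definition successors (z : seq (nat * nat)) : seq nat := [seq a.2 | a <- z].
Definition both_sides (z : seq (nat * nat)) : seq nat := flatten [seq [:: a.1; a.2] | a <- z].

Definition distinct (k : nat) (w : seq nat) : bool := size (undup w) == k.

Lemma neighbours_nil x p w : x \notin w -> neighbours x p w = [::].
Proof.
move=> xw; apply/nilP; rewrite /nilp size_neighbours; apply/eqP/count_memPn.
by apply: contra xw; exact: mem_take.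
Qed.

Lemma sum_bool_gt0 (b : nat -> bool) m n : (1 <= \sum_(m <= i < n) b i) = has b (index_iota m n).
Proof.
by rewrite has_count -sum1_count [X in _ = (0 < X)]big_mkcond.
Qed.

Lemma mem_visit_times s n x j :
  (j \in visit_times x (path_word s n)) = (j.+1 < n) && (s j.+1 == x).
Proof.
rewrite mem_filter mem_iota add0n /= size_path_word andbC.
have -> : (j < n.-1) = (j.+1 < n) by case: n.
case: (ltnP j.+1 n) => // jn.
by have := @nth_path_word s n j.+1; rewrite /= (ltnW jn) => -> //; rewrite andbC.
Qed.

Lemma out_edges_mem s n x y :
  (1 <= out_edges s n x y) = (y \in successors (neighbours x 0 (path_word s n))).
Proof.
rewrite sum_bool_gt0 /successors neighboursE -map_comp.
apply/hasP/mapP => [[i]|[j]].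
  rewrite mem_index_iota => /andP[i1 i_n] /andP[/eqP sx /eqP sy].
  exists i.-1; first by rewrite mem_visit_times prednK// i_n sx eqxx.
  rewrite /= prednK//; have := @nth_path_word s n i.+1.
  by rewrite /= i_n => ->.
rewrite mem_visit_times => /andP[jn /eqP sx] /=.
have := @nth_path_word s n j.+2; rewrite /= jn => -> // ->.
by exists j.+1; rewrite ?mem_index_iota ?jn// sx !eqxx.
Qed.

Lemma sum_posN_mem (w : seq nat) : all (leq 1) w ->
  \big[addn/0]_(y \in posN) (y \in w) = size (undup w).
Proof.
move=> w1; rewrite (posN_sum (K := letter_bound w)) ?sum_mem_undup// => y wy.
by apply/eqP; rewrite eqb0; apply/negP => /mem_letter_bound; rewrite ltnNge wy.
Qed.

Lemma successors_pos s n x : (forall i, 1 <= i -> 0 < s i) ->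
  all (leq 1) (successors (neighbours x 0 (path_word s n))).
Proof.
move=> s0; apply/allP => y; rewrite -out_edges_mem sum_bool_gt0 => /hasP[i _ /andP[_ /eqP <-]].
exact: s0.
Qed.

Lemma out_degree_successors s n x : (forall i, 1 <= i -> 0 < s i) ->
  out_degree s n x = size (undup (successors (neighbours x 0 (path_word s n)))).
Proof.
move=> s0; rewrite -sum_posN_mem; last exact: successors_pos.
by apply: eq_fsbigr => y _; rewrite out_edges_mem.
Qed.

Lemma visits_pred s n x : visits s n.-1 x = size (neighbours x 0 (path_word s n)).
Proof.
rewrite size_neighbours size_path_word visits_count; case: n => [//|n].
by rewrite take_path_word.
Qed.

Lemma out_range_visits_census s n k l : 0 < l -> (forall i, 1 <= i -> 0 < s i) ->
  out_range_visits s n k l = exact_census l (distinct k \o successors) (path_word s n).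
Proof.
move=> l0 s0; rewrite /out_range_visits (posN_sum (K := letter_bound (path_word s n))).
  by apply: eq_bigr => x _; rewrite visits_pred out_degree_successors.
move=> x wx; rewrite visits_pred neighbours_nil; first by case: l l0.
by apply/negP => /mem_letter_bound; rewrite ltnNge wx.
Qed.

Lemma out_range_census s n k : 0 < k -> (forall i, 1 <= i -> 0 < s i) ->
  out_range s n k = full_census (distinct k \o successors) (path_word s n).
Proof.
move=> k0 s0; rewrite /out_range (posN_sum (K := letter_bound (path_word s n))).
  by apply: eq_bigr => x _; rewrite out_degree_successors.
move=> x wx; rewrite out_degree_successors// neighbours_nil; first by case: k k0.
by apply/negP => /mem_letter_bound; rewrite ltnNge wx.
Qed.

(** The visits of a state that is neither the first nor the last letter are at
    inner times, so that each one has both a predecessor and a successor. *)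
Lemma edges_mem s n x y : x != s 1 -> x != s n ->
  (1 <= edges s n x y) = (y \in both_sides (neighbours x 0 (path_word s n))).
Proof.
move=> x1 xn; rewrite sum_bool_gt0 /both_sides neighboursE -map_comp.
apply/hasP/flatten_mapP => [[i]|[j]].
  rewrite mem_index_iota => /andP[i1 i_n] /orP[] /andP[/eqP sx /eqP sy].
    exists i.-1; first by rewrite mem_visit_times prednK// i_n sx eqxx.
    rewrite /= prednK//; have := @nth_path_word s n i.+1.
    by rewrite /= i_n => -> //; rewrite sy !inE eqxx orbT.
  exists i.
    rewrite mem_visit_times sy eqxx andbT ltn_neqAle i_n andbT.
    by apply: contra xn => /eqP <-; rewrite sy.
  by rewrite /= -[nth 0 (_ :: _) i]/(nth 0 (0 :: path_word s n) i) nth_path_word ?i1 1?ltnW// sx inE eqxx.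
rewrite mem_visit_times => /andP[jn /eqP sx] /=.
have j0 : 0 < j by case: j sx {jn} => // sx; rewrite sx eqxx in x1.
have := @nth_path_word s n j.+2; rewrite /= jn => -> //.
rewrite -[nth 0 (_ :: _) j]/(nth 0 (0 :: path_word s n) j) nth_path_word; last first.
  by rewrite j0 (leq_trans _ jn)// leqW.
rewrite !inE => /orP[/eqP ->|/eqP ->].
  by exists j; rewrite ?mem_index_iota ?j0 1?ltnW// sx !eqxx orbT.
by exists j.+1; rewrite ?mem_index_iota ?jn// sx !eqxx.
Qed.

Lemma degree_both_sides s n x : (forall i, 1 <= i -> 0 < s i) -> x != s 1 -> x != s n ->
  degree s n x = size (undup (both_sides (neighbours x 0 (path_word s n)))).
Proof.
move=> s0 x1 xn; rewrite -sum_posN_mem.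
  by apply: eq_fsbigr => y _; rewrite edges_mem.
apply/allP => y; rewrite -edges_mem// sum_bool_gt0 => /hasP[i].
rewrite mem_index_iota => /andP[i1 _] /orP[] /andP[/eqP h1 /eqP h2].
  by rewrite -h2; exact: s0.
by rewrite -h1; exact: s0.
Qed.

Lemma inner_visits_size s n x : x != s 1 ->
  inner_visits s n x = size (neighbours x 0 (path_word s n)).
Proof.
move=> x1; rewrite -visits_pred /visits /inner_visits.
case: n => [|[|n]] /=; [by rewrite !big_geq|by rewrite !big_geq|].
by rewrite [RHS]big_ltn// eq_sym (negbTE x1).
Qed.

Lemma degree_large s n x : letter_bound (path_word s n) <= x -> degree s n x = 0.
Proof.
move=> wx; rewrite /degree fsbig1// => y _; apply/eqP; rewrite eqb0 sum_bool_gt0.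
have xw i : 1 <= i <= n -> s i != x.
  move=> i_n; apply/eqP => sx; suff /mem_letter_bound : x \in path_word s n by rewrite ltnNge wx.
  by apply/mapP; exists i; rewrite ?sx// mem_iota add1n ltnS.
apply/hasPn => i; rewrite mem_index_iota => /andP[i1 i_n].
rewrite (negbTE (xw i _)) ?i1 1?ltnW//= (negbTE (xw i.+1 _))// andbF //.
Qed.

(** At most the two exceptional indices u and v contribute to the difference. *)
Lemma sum_near (a b : nat -> bool) K u v :
  (forall x, x != u -> x != v -> a x = b x) ->
  \sum_(1 <= x < K) a x <= \sum_(1 <= x < K) b x + 2.
Proof.
move=> ab; apply: (@leq_trans (\sum_(1 <= x < K) (b x + ((x == u) + (x == v))))).
  apply: leq_sum => x _; case: (eqVneq x u) => xu; first by rewrite addnCA add1n; case: (a x).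
  case: (eqVneq x v) => xv; first by rewrite addn1; case: (a x).
  by rewrite ab// addn0.
by rewrite !big_split /= leq_add2l -[2]/(1 + 1) leq_add// sum_eq_range_le1.
Qed.

Lemma deg_range_visits_census s n k l : 0 < l -> (forall i, 1 <= i -> 0 < s i) ->
  let F := exact_census l (distinct k \o both_sides) (path_word s n) in
  deg_range_visits s n k l <= F + 2 /\ F <= deg_range_visits s n k l + 2.
Proof.
move=> l0 s0 /=; rewrite /deg_range_visits (posN_sum (K := letter_bound (path_word s n))); last first.
  move=> x wx; suff -> : inner_visits s n x = 0 by case: l l0.
  have := visits_large wx; rewrite /visits /inner_visits => h.
  apply/eqP; rewrite -leqn0 -[leqRHS]h; case: n {wx h} => [|[|n]]; [by rewrite big_geq|by rewrite big_geq|].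
  by rewrite [leqRHS]big_ltn// [in leqRHS]big_nat_recr//= addnCA leq_addr.
by split; apply: (@sum_near _ _ _ (s 1) (s n)) => x x1 xn; rewrite inner_visits_size// degree_both_sides.
Qed.

Lemma deg_range_census s n k : 0 < k -> (forall i, 1 <= i -> 0 < s i) ->
  let F := full_census (distinct k \o both_sides) (path_word s n) in
  deg_range s n k <= F + 2 /\ F <= deg_range s n k + 2.
Proof.
move=> k0 s0 /=; rewrite /deg_range (posN_sum (K := letter_bound (path_word s n))); last first.
  by move=> x wx; rewrite degree_large//; case: k k0.
by split; apply: (@sum_near _ _ _ (s 1) (s n)) => x x1 xn; rewrite /= degree_both_sides.
Qed.

Lemma exact_census_census l Phi w :
  exact_census l Phi w + census l.+1 l Phi w = census l l Phi w.
Proof.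
rewrite -big_split; apply: eq_bigr => x _; rewrite /fits /=.
case: (ltngtP (size (neighbours x 0 w)) l) => [//|//|sl].
by rewrite -sl take_size addn0.
Qed.

Lemma full_census_le_size Phi w : ~~ Phi [::] -> full_census Phi w <= size w.
Proof.
move=> Phi0; apply: (@leq_trans (repeats 1 w)); last exact: repeats_le_size.
apply: leq_sum => x _.
case: (posnP (count_mem x w)) => [/count_memPn xw|_]; last by case: (Phi _).
by rewrite neighbours_nil// (negbTE Phi0).
Qed.

(** Classifying the states by their number of visits; those with at least L
    visits are counted by [repeats]. *)
Lemma exact_census_sum (Phi : pred (seq (nat * nat))) w a L : a <= L -> 0 < L ->
  (forall z, Phi z -> a <= size z) ->
  \sum_(a <= l < L) exact_census l Phi w <= full_census Phi w
    <= \sum_(a <= l < L) exact_census l Phi w + repeats L w.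
Proof.
move=> aL L0 Phi_a; rewrite exchange_big /=.
have E x : \sum_(a <= l < L) ((size (neighbours x 0 w) == l) && Phi (neighbours x 0 w)) =
    (size (neighbours x 0 w) < L) && Phi (neighbours x 0 w) :> nat.
  case: (boolP (Phi _)) => Px; last first.
    by rewrite andbF big1// => l _; rewrite andbF.
  rewrite andbT (eq_bigr (fun l => if l == size (neighbours x 0 w) then 1 else 0)); last first.
    by move=> l _; rewrite andbT eq_sym; case: (_ == _).
  rewrite -big_mkcond sum1_count count_uniq_mem ?iota_uniq// mem_index_iota Phi_a//=.
rewrite (eq_bigr _ (fun x _ => E x)) /full_census /repeats; apply/andP; split.
  by apply: leq_sum => x _; case: (_ < _); case: (Phi _).
rewrite -big_split; apply: leq_sum => x _ /=.
case: (ltnP (size (neighbours x 0 w)) L) => [_|Lx]; first by rewrite leq_addr.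
suff -> : L <= count_mem x w by case: (Phi _).
apply: (leq_trans Lx); rewrite size_neighbours -[X in _ <= count_mem x X](cat_take_drop (size w).-1).
by rewrite count_cat leq_addr.
Qed.

Lemma distinct_successors_size k z : distinct k (successors z) -> k <= size z.
Proof. by move=> /eqP <-; rewrite (leq_trans (size_undup _))// size_map. Qed.

Lemma distinct_both_sides_size k z : distinct k (both_sides z) -> (k.+1)./2 <= size z.
Proof.
move=> /eqP <-; have := size_undup (both_sides z).
have -> : size (both_sides z) = (size z).*2 by elim: z => //= a z; rewrite doubleS => ->.
move: (size _) => m; lia.
Qed.

End DegreeCensus.

Section Locality.
Local Open Scope nat_scope.

(** It makes the statistic a function of the first n letters, hence measurable. *)
Definition local (U : (nat -> nat) -> nat -> nat) : Prop :=
  forall s t n, (forall i, 1 <= i <= n -> s i = t i) -> U s n = U t n.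

Variables (s t : nat -> nat) (n : nat) (st : forall i, 1 <= i <= n -> s i = t i).

Lemma visits_local x : visits s n x = visits t n x.
Proof. by apply: eq_big_nat => i; rewrite ltnS => /st ->. Qed.

Lemma out_degree_local x : out_degree s n x = out_degree t n x.
Proof.
apply: eq_fsbigr => y _; congr (nat_of_bool (1 <= _)); apply: eq_big_nat => i /andP[i1 i_n].
by rewrite !st// ?i1 1?ltnW.
Qed.

End Locality.

Section Locality2.
Local Open Scope nat_scope.

Lemma range_size_local : local range_size.
Proof.
move=> s t n st; congr (size (undup _)); apply/eq_in_map => i.
by rewrite mem_index_iota ltnS; exact: st.
Qed.

Lemma range_eq_local l : local (fun s n => range_eq s n l).
Proof. by move=> s t n st; apply: eq_fsbigr => x _; rewrite (visits_local st). Qed.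

Lemma out_range_local k : local (fun s n => out_range s n k).
Proof. by move=> s t n st; apply: eq_fsbigr => x _; rewrite (out_degree_local st). Qed.

Lemma out_range_visits_local k l : local (fun s n => out_range_visits s n k l).
Proof.
move=> s t n st; apply: eq_fsbigr => x _; rewrite (out_degree_local st).
rewrite (@visits_local s t)// => i /andP[i1 i_n]; apply: st.
by rewrite i1 (leq_trans i_n)// leq_pred.
Qed.

End Locality2.

(** * Growth rates relative to the mean range *)

Section Rates.
Context {R : realType} {d : measure_display} {T : measurableType d}.
Variable P : probability T R.
Variables (p : nat -> R) (xi : nat -> {RV P >-> nat}) (xi_iid : iid p xi).
Hypothesis p0 : p 0%N = 0.
Local Notation mu := (letter_law xi).
Hypothesis mean_range_unb : mean_range xi n @[n --> \oo] --> +oo.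
Variable c : nat -> R.
Hypothesis mean_repeats_cvg : forall m, (0 < m)%N ->
  mean_repeats mu n m / mean_range xi n @[n --> \oo] --> c m.

(** Boundedness on the words of a given length makes the means additive and
    monotone. *)
Definition has_rate (F : seq nat -> nat) (v : R) : Prop :=
  [/\ forall n, exists C, word_bounded n (fun w => (F w)%:R : R) C,
      \forall w \ae P, (F (path_word (xi^~ w) n))%:R / mean_range xi n @[n --> \oo] --> v &
      word_mean mu n (fun w => (F w)%:R) / mean_range xi n @[n --> \oo] --> v].

Lemma le_size_bounded F : (forall w, F w <= size w)%N ->
  forall n, exists C, word_bounded n (fun w => (F w)%:R : R) C.
Proof. by move=> Fs n; exists n%:R => w <-; rewrite normr_nat ler_nat. Qed.

Lemma mean_range_shift : mean_range xi n / mean_range xi n.+1 @[n --> \oo] --> (1 : R).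
Proof.
have moo : mean_range xi n.+1 @[n --> \oo] --> +oo by rewrite (@cvg_shiftS _ (mean_range xi)).
apply: (@bounded_difference_ratio _ _ (fun n => mean_range xi n.+1) _ _ 1) => //.
  move=> n; have /andP[h1 h2] := mean_repeatsS mu n (ltn0Sn 0).
  by rewrite ler_norml; apply/andP; split; rewrite /mean_range; lra.
have m0 : \forall n \near \oo, 0 < mean_range xi n.+1 by move/cvgryPgt : moo; exact.
have h : (fun _ : nat => 1 : R) @ \oo --> (1 : R) by exact: cvg_cst.
apply: cvg_trans h; apply: near_eq_cvg; apply: filterS m0 => n m0.
by rewrite divff// gt_eqF.
Qed.

Lemma ratio_unshift (u : nat -> R) (v : R) : u n.+1 / mean_range xi n @[n --> \oo] --> v ->
  u n / mean_range xi n @[n --> \oo] --> v.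
Proof.
move=> uv; rewrite -(@cvg_shiftS _ (fun n => u n / mean_range xi n)).
have h : (u n.+1 / mean_range xi n) * (mean_range xi n / mean_range xi n.+1) @[n --> \oo] --> v.
  by rewrite -[v]mulr1; apply: cvgM => //; exact: mean_range_shift.
apply: cvg_trans h; apply: near_eq_cvg.
have m0 : \forall n \near \oo, 0 < mean_range xi n by move/cvgryPgt : mean_range_unb; exact.
by apply: filterS m0 => n mn /=; rewrite mulrA divfK// gt_eqF.
Qed.

Lemma rate_census m l Phi : (0 < m)%N -> (l <= m)%N ->
  has_rate (census m l Phi) (pair_mean mu l Phi * c m).
Proof.
move=> m0 lm; split.
- by apply: le_size_bounded => w; exact: census_le_size.
- have h := census_slln xi_iid mean_range_unb mean_repeats_cvg Phi m0 lm.
  by apply: filterS h => w; exact: (@ratio_unshift (fun n => (census m l Phi (path_word (xi^~ w) n))%:R)).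
- apply: (@ratio_unshift (fun n => mean_census mu n m l Phi)).
  exact: (mean_census_cvg mean_range_unb mean_repeats_cvg).
Qed.

Lemma rate_repeats m : (0 < m)%N -> has_rate (repeats m) (c m).
Proof.
move=> m0; split.
- by apply: le_size_bounded => w; exact: repeats_le_size.
- have h := census_slln xi_iid mean_range_unb mean_repeats_cvg xpredT m0 (leq0n m).
  apply: filterS h => w; rewrite /= mul1r; apply: cvg_trans; apply: near_eq_cvg; apply: nearW => n.
  have := censusC 0 xpredT (path_word (xi^~ w) n.+1) m0.
  rewrite size_path_word take_path_word => <-; rewrite (_ : census _ _ (predC _) _ = 0%N) ?addn0//.
  by rewrite /census big1// => x _; rewrite /fits andbF.
- exact: mean_repeats_cvg.
Qed.

Lemma rateD F G H a b : (forall w, H w = F w + G w)%N ->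
  has_rate F a -> has_rate G b -> has_rate H (a + b).
Proof.
move=> HFG [bF asF mF] [bG asG mG]; split.
- move=> n; have [C hC] := bF n; have [D hD] := bG n; exists (C + D) => w sw.
  by rewrite HFG natrD (le_trans (ler_normD _ _))// lerD ?hC ?hD.
- apply: filterS2 asF asG => w cF cG.
  by under eq_fun do rewrite HFG natrD mulrDl; apply: cvgD.
- have -> : (fun n => word_mean mu n (fun w => (H w)%:R) / mean_range xi n) =
     (fun n => word_mean mu n (fun w => (F w)%:R) / mean_range xi n +
               word_mean mu n (fun w => (G w)%:R) / mean_range xi n).
    apply/funext => n; have [C hC] := bF n; have [D hD] := bG n.
    rewrite -mulrDl -(word_meanD mu hC hD); congr (_ / _); apply: eq_word_mean => w _.
    by rewrite HFG natrD.
  exact: cvgD.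
Qed.

Lemma rateB F G H a b : (forall w, H w + G w = F w)%N ->
  has_rate F a -> has_rate G b -> has_rate H (a - b).
Proof.
move=> HFG [bF asF mF] [bG asG mG].
have HE w : (H w)%:R = (F w)%:R - (G w)%:R :> R by rewrite -HFG natrD addrK.
split.
- move=> n; have [C hC] := bF n; have [D hD] := bG n; exists (C + D) => w sw.
  by rewrite HE (le_trans (ler_normB _ _))// lerD ?hC ?hD.
- apply: filterS2 asF asG => w cF cG.
  by under eq_fun do rewrite HE mulrBl; apply: cvgB.
- have -> : (fun n => word_mean mu n (fun w => (H w)%:R) / mean_range xi n) =
     (fun n => word_mean mu n (fun w => (F w)%:R) / mean_range xi n -
               word_mean mu n (fun w => (G w)%:R) / mean_range xi n).
    apply/funext => n; have [C hC] := bF n; have [D hD] := bG n.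
    rewrite -mulrBl -(word_meanB mu hC hD); congr (_ / _); apply: eq_word_mean => w _.
    exact: HE.
  exact: cvgB.
Qed.

Lemma rate0 : has_rate (fun=> 0%N) 0.
Proof.
split.
- by move=> n; exists 0 => w _; rewrite normr0.
- by apply: nearW => w; under eq_fun do rewrite mul0r; exact: cvg_cst.
- by under eq_fun do rewrite word_mean_cst mul0r; exact: cvg_cst.
Qed.

Lemma rate_sum (F : nat -> seq nat -> nat) (v : nat -> R) a L :
  (forall l, (a <= l)%N -> has_rate (F l) (v l)) ->
  has_rate (fun w => \sum_(a <= l < L) F l w)%N (\sum_(a <= l < L) v l).
Proof.
move=> Fv; elim: L => [|L IH].
  by rewrite big_geq//; under eq_fun do rewrite big_geq//; exact: rate0.
have [aL|La] := leqP a L; last first.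
  by rewrite big_geq//; under eq_fun do rewrite big_geq//; exact: rate0.
rewrite big_nat_recr//=; apply: rateD IH (Fv L aL) => w.
by rewrite big_nat_recr.
Qed.

Lemma rate_le F G a b : (forall w, F w <= G w)%N -> has_rate F a -> has_rate G b -> a <= b.
Proof.
move=> FG [bF _ Fa] [bG _ Gb]; apply: (ler_cvg_to Fa Gb).
have m0 : \forall n \near \oo, 0 < mean_range xi n by move/cvgryPgt : mean_range_unb; exact.
apply: filterS m0 => n mn; have [C hC] := bF n; have [D hD] := bG n.
rewrite ler_pM2r ?invr_gt0//; apply: (word_mean_le mu hC hD) => w _.
by rewrite ler_nat.
Qed.

(** Approximations with e = 1 / (j + 1) suffice, so that only countably many
    null sets are discarded. *)
Lemma rate_squeeze H s : (forall n, exists C, word_bounded n (fun w => (H w)%:R : R) C) ->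
  (forall e : R, 0 < e -> exists F G (a b : R),
    [/\ has_rate F a, has_rate G b, forall w, (F w <= H w <= G w)%N, s - e <= a & b <= s + e]) ->
  has_rate H s.
Proof.
move=> bH hyp; split => //.
- have A : forall j, \forall w \ae P, exists f g (a b : R),
    [/\ f n / mean_range xi n @[n --> \oo] --> a, g n / mean_range xi n @[n --> \oo] --> b,
        forall n, f n <= (H (path_word (xi^~ w) n))%:R <= g n, s - j.+1%:R^-1 <= a &
        b <= s + j.+1%:R^-1].
    move=> j; have j0 : 0 < j.+1%:R^-1 :> R by rewrite invr_gt0.
    have [F [G [a [b [[_ F1 _] [_ G1 _] FHG sa bs]]]]] := hyp _ j0.
    apply: filterS2 F1 G1 => w F1 G1.
    exists (fun n => (F (path_word (xi^~ w) n))%:R), (fun n => (G (path_word (xi^~ w) n))%:R), a, b.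
    by split => // n; rewrite !ler_nat.
  move/ae_foralln : A; apply: filterS => w A.
  apply: squeeze_ratio => // e e0.
  have [j je] : exists j : nat, j.+1%:R^-1 < e.
    have : \forall j \near \oo, j.+1%:R^-1 < e by apply: (cvgr_lt (0 : R)) => //; exact: cvg_harmonic.
    by move=> /filter_ex.
  have [f [g [a [b [h1 h2 h3 h4 h5]]]]] := A j; exists f, g, a, b; split => //.
    by rewrite (le_trans _ h4)// lerD2l lerN2 ltW.
  by rewrite (le_trans h5)// lerD2l ltW.
- apply: squeeze_ratio => // e e0.
  have [F [G [a [b [[bF _ F1] [bG _ G1] FHG sa bs]]]]] := hyp _ e0.
  exists (fun n => word_mean mu n (fun w => (F w)%:R)), (fun n => word_mean mu n (fun w => (G w)%:R)), a, b.
  split => // n; have [CF hF] := bF n; have [CG hG] := bG n; have [CH hH] := bH n.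
  apply/andP; split.
    by apply: (word_mean_le mu hF hH) => w _; rewrite ler_nat; case/andP: (FHG w).
  by apply: (word_mean_le mu hH hG) => w _; rewrite ler_nat; case/andP: (FHG w).
Qed.

Lemma rate_exact_census l Phi : (0 < l)%N ->
  has_rate (exact_census l Phi) (pair_mean mu l Phi * (c l - c l.+1)).
Proof.
move=> l0; rewrite mulrBr; apply: (@rateB (census l l Phi) (census l.+1 l Phi)).
- by move=> w; exact: exact_census_census.
- exact: rate_census.
- by apply: rate_census => //; exact: ltnW.
Qed.

Hypothesis c_decr : forall m, (0 < m)%N -> c m.+1 <= c m.
Hypothesis c_ge0 : forall m, (0 < m)%N -> 0 <= c m.
Hypothesis c_cvg0 : c m @[m --> \oo] --> (0 : R).

(** Truncating the number of visits at L leaves an error of rate c L, which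
    tends to 0. *)
Lemma rate_full_census (Phi : pred (seq (nat * nat))) a : (0 < a)%N -> (forall z, Phi z -> (a <= size z)%N) ->
  has_rate (full_census Phi)
    (fine (\sum_(a <= l <oo) (pair_mean mu l Phi * (c l - c l.+1))%:E)%E).
Proof.
move=> a0 Phi_a; pose v l := pair_mean mu l Phi * (c l - c l.+1).
have v0 l : (a <= l)%N -> 0 <= v l.
  move=> al; rewrite mulr_ge0//; first by case/andP: (pair_mean01 mu l Phi).
  by rewrite subr_ge0 c_decr// (leq_trans a0).
pose S L := \sum_(a <= l < L) v l.
have S_incr : {homo S : i j / (i <= j)%N >-> i <= j}.
  move=> i j ij; rewrite /S; have [ai|ia] := leqP a i; last first.
    rewrite big_geq 1?ltnW// big_nat sumr_ge0// => l /andP[al _]; exact: v0.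
  rewrite [leRHS](big_cat_nat (n := i))//= lerDl big_nat sumr_ge0// => l /andP[il _].
  by apply: v0; exact: leq_trans il.
have S_le L : S L <= c a.
  have [aL|La] := leqP a L; last by rewrite /S big_geq 1?ltnW// c_ge0.
  apply: (@le_trans _ _ (\sum_(a <= l < L) (c l - c l.+1))).
    apply: ler_sum_nat => l /andP[al _]; rewrite ler_piMl//.
      by rewrite subr_ge0 c_decr// (leq_trans a0).
    by case/andP: (pair_mean01 mu l Phi).
  rewrite -(opprK (\sum_(a <= l < L) _)) -sumrN.
  under eq_bigr do rewrite opprB.
  by rewrite telescope_sumr// opprB lerBlDr lerDl c_ge0// (leq_trans a0).
have Scvg : S L @[L --> \oo] --> fine (\sum_(a <= l <oo) (v l)%:E)%E.
  have Sc : cvgn S by apply: nondecreasing_is_cvgn => //; exists (c a) => _ [L _ <-].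
  have -> : (\sum_(a <= l <oo) (v l)%:E)%E = (limn S)%:E => //.
  apply/cvg_lim => //.
  have -> : (fun L => \sum_(a <= l < L) (v l)%:E)%E = EFin \o S by apply/funext => L; rewrite /= sumEFin.
  by apply: cvg_EFin => //; exact: nearW.
apply: rate_squeeze.
  apply: le_size_bounded => w; apply: full_census_le_size.
  by apply/negP => /Phi_a; rewrite leqNgt a0.
move=> e e0; set s := fine _ in Scvg *.
have h1 : \forall L \near \oo, s - e <= S L by apply: (cvgr_ge _ Scvg); rewrite ltrBlDr ltrDl.
have h2 : \forall L \near \oo, c L <= e by apply: (cvgr_le _ c_cvg0).
have h3 : \forall L \near \oo, (a <= L)%N by exact: nbhs_infty_ge.
have [L [[L1 L2] L3]] := @filter_ex _ _ _ _ (filterI (filterI h1 h2) h3).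
have L0 : (0 < L)%N by exact: leq_trans L3.
have rS : has_rate (fun w => \sum_(a <= l < L) exact_census l Phi w)%N (S L).
  by apply: rate_sum => l al; apply: rate_exact_census; exact: leq_trans al.
exists (fun w => \sum_(a <= l < L) exact_census l Phi w)%N,
  (fun w => \sum_(a <= l < L) exact_census l Phi w + repeats L w)%N, (S L), (S L + c L).
split => //.
- by apply: rateD rS (rate_repeats L0) => w.
- by move=> w; exact: exact_census_sum.
- rewrite lerD//; have := nondecreasing_cvgn_le S_incr (cvgP _ Scvg) L.
  by rewrite (cvg_lim _ Scvg).
Qed.

Lemma ae_path_pos : \forall w \ae P, forall i, (1 <= i)%N -> (0 < xi i w)%N.
Proof.
apply/ae_foralln => -[|i]; first exact: nearW.
exists (xi i.+1 @^-1` [set 0%N]); split.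
- by rewrite -[X in measurable X]setTI; exact: measurable_funPT.
- have := xi_iid.2 i.+1 0%N isT; by rewrite p0.
- move=> w /=; case: (posnP (xi i.+1 w)) => // h []//.
Qed.

Definition path_rate (U : (nat -> nat) -> nat -> nat) (v : R) : Prop :=
  \forall w \ae P, (U (xi^~ w) n)%:R / mean_range xi n @[n --> \oo] --> v.

Definition mean_rate (U : (nat -> nat) -> nat -> nat) (v : R) : Prop :=
  exists2 e : nat -> R, forall n, mean xi (U^~ n) = (e n)%:E &
    e n / mean_range xi n @[n --> \oo] --> v.

(** Words may contain 0, which is not a state; almost no path does. *)
Lemma rate_path U F v : local U ->
  (forall s n, (forall i, (1 <= i)%N -> (0 < s i)%N) -> U s n = F (path_word s n)) ->
  has_rate F v ->
  path_rate U v /\ mean_rate U v.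
Proof.
move=> locU UF [bF asF mF]; split.
  apply: filterS2 ae_path_pos asF => w wpos; apply: cvg_trans; apply: near_eq_cvg.
  by apply: nearW => n; rewrite UF.
exists (fun n => word_mean mu n (fun w => (F w)%:R)) => // n.
have [C hC] := bF n.
rewrite -(path_mean xi_iid _ hC)//.
rewrite /mean unlock; apply: ge0_ae_eq_integral => //.
- have -> : (fun w => ((U (xi^~ w) n)%:R : R)%:E) =
     (fun w => (fun u => ((U (nth 0%N (0%N :: u)) n)%:R : R)%:E) (path_word (xi^~ w) n)).
    apply/funext => w /=; congr (_%:R%:E); apply: locU => i i_n.
    by rewrite -[RHS]/(nth 0%N (0%N :: path_word (xi^~ w) n) i) nth_path_word.
  exact: (@measurable_path_fun _ _ _ _ xi _ _ n (fun u => ((U (nth 0%N (0%N :: u)) n)%:R : R)%:E)).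
- exact: (@measurable_path_fun _ _ _ _ xi _ _ n (fun u => ((F u)%:R : R)%:E)).
- by apply: filterS ae_path_pos => w wpos _; rewrite UF.
Qed.

(** An error of two is negligible against the mean range. *)
Lemma rate_path_near U F v :
  (forall s n, (forall i, (1 <= i)%N -> (0 < s i)%N) ->
    (U s n <= F (path_word s n) + 2)%N /\ (F (path_word s n) <= U s n + 2)%N) ->
  has_rate F v -> path_rate U v.
Proof.
move=> UF [_ asF _]; apply: filterS2 ae_path_pos asF => w wpos.
apply: (@bounded_difference_ratio _ _ _ _ _ 2) => // n.
have [h1 h2] := UF _ n wpos.
rewrite ler_norml lerBlDr lerNl opprB lerBlDr -!natrD !ler_nat addnC h2 addnC h1//.
Qed.

End Rates.

(** * Sums over tuples and probabilities of words *)

Section TupleSums.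
Context {R : realType}.
Variable mu : probability nat R.
Local Notation q := (letter_prob mu).

Lemma word_mean_esum n (F : seq nat -> R) C :
  (forall w, size w = n -> 0 <= F w) -> word_bounded n F C ->
  (word_mean mu n F)%:E = (\esum_(t in [set: n.-tuple nat])
    ((\prod_(j < n) q (tnth t j)) * F t)%:E)%E.
Proof.
elim: n F C => [|n IH] F C F0 bF.
  have -> : [set: 0.-tuple nat] = [set [tuple]] by apply/seteqP; split => // t _; exact: tuple0.
  by rewrite esum_set1 ?big_ord0 ?mul1r// lee_fin F0.
have q0 a : 0 <= q a by case/andP: (letter_prob01 mu a).
have bFa a : word_bounded n (fun w => F (a :: w)) C by exact: word_boundedS.
have F0a a : forall w, size w = n -> 0 <= F (a :: w) by move=> w sw; apply: F0; rewrite /= sw.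
have hb : bounded_by C (fun a => word_mean mu n (fun w => F (a :: w))).
  by move=> a; exact: word_mean_norm.
have h0 a : 0 <= word_mean mu n (fun w => F (a :: w)) by apply: word_mean_ge0; exact: F0a.
rewrite [word_mean _ _ _]/= (letter_mean_series mu hb h0).
rewrite nneseries_esumT; last by move=> a; rewrite lee_fin mulr_ge0.
transitivity (\esum_(a in [set: nat]) \esum_(t in [set: n.-tuple nat])
    ((\prod_(j < n) q (tnth t j)) * (q a * F (a :: t)))%:E)%E.
  apply: eq_esum => a _; rewrite -(word_meanZ mu (q a) (bFa a)).
  apply: (IH _ (`|q a| * C)); last exact: word_boundedZ.
  by move=> w sw; rewrite mulr_ge0// F0a.
rewrite esum_esum; last first.
  by move=> a t _ _; rewrite lee_fin !mulr_ge0 ?prodr_ge0 ?F0a ?size_tuple.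
have E : set_bij ([set: nat] `*`` (fun=> [set: n.-tuple nat])) [set: n.+1.-tuple nat]
    (fun k => cons_tuple k.1 k.2).
  split => //.
  - move=> [a t] [b u] _ _ /= h; have := congr1 val h => /= -[-> tu].
    by congr pair; exact: val_inj.
  - move=> t _; exists (thead t, behead_tuple t) => //=.
    by rewrite [RHS]tuple_eta.
rewrite [RHS](reindex_esum _ _ _ _ E); apply: eq_esum => -[a t] _ /=; congr (_%:E).
rewrite big_ord_recl tnth0 mulrCA mulrA; congr (_ * _ * _).
by apply: eq_bigr => j _; rewrite tnthS.
Qed.

Lemma pair_mean_both_sides l (Q : seq nat -> bool) :
  pair_mean mu l (Q \o both_sides) = word_mean mu l.*2 (fun w => (Q w)%:R).
Proof.
elim: l Q => [//|l IH] Q; rewrite doubleS /=.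
congr letter_mean; apply/funext => a; congr letter_mean; apply/funext => b.
exact: (IH (fun w => Q [:: a, b & w])).
Qed.

(** The predecessors integrate out. *)
Lemma pair_mean_successors l (Q : seq nat -> bool) :
  pair_mean mu l (Q \o successors) = word_mean mu l (fun w => (Q w)%:R).
Proof.
elim: l Q => [//|l IH] Q; rewrite /= letter_mean_cst.
congr letter_mean; apply/funext => b; exact: (IH (fun w => Q (b :: w))).
Qed.

Variable p : nat -> R.
Hypotheses (mu_p : forall x, q x = p x) (p0 : p 0%N = 0).

(** Tuples that contain 0 carry no mass. *)
Lemma SsumE k l : Ssum p k l = word_mean mu l (fun w => (distinct k w)%:R).
Proof.
have b1 : word_bounded l (fun w => (distinct k w)%:R : R) 1 by exact: bool_bounded.
apply: EFin_inj; rewrite /Ssum -[RHS]fineK//; congr (fine _)%:E.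
rewrite (word_mean_esum _ b1)// [LHS]esum_mkcond; apply: eq_esum => t _.
case: ifPn => [/set_mem[_ /eqP tk]|/negP tk].
  by rewrite /distinct tk mulr1; congr (_%:E); apply: eq_bigr => j _; rewrite mu_p.
case: (boolP (distinct k t)) => [/eqP dk|_]; last by rewrite mulr0.
have [j jt] : exists j, tnth t j = 0%N.
  apply: contra_notP tk => /forallNP tj; apply/mem_set; split => // j.
  by rewrite /posN /= lt0n; apply/eqP/tj.
by rewrite (bigD1 j)//= jt mu_p p0 !mul0r.
Qed.

Lemma Ssum_gt0 k l : (forall x, (1 <= x)%N -> 0 < p x) -> (1 <= k)%N -> (k <= l)%N -> 0 < Ssum p k l.
Proof.
move=> ppos k1 kl; rewrite SsumE -lte_fin.
have b1 : word_bounded l (fun w => (distinct k w)%:R : R) 1 by exact: bool_bounded.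
rewrite (word_mean_esum _ b1)//.
(* one tuple of positive mass with k distinct entries *)
pose w := nseq (l - k) 1%N ++ iota 1 k.
have sw : size w == l by rewrite size_cat size_iota size_nseq subnK.
pose t := Tuple sw.
have dt : distinct k t.
  rewrite /distinct undup_cat (undup_id (iota_uniq 1 k)) (eq_in_filter (a2 := pred0)).
    by rewrite filter_pred0 size_iota.
  by move=> x; rewrite mem_undup mem_nseq => /andP[_ /eqP ->]; rewrite mem_iota /= add1n ltnS k1.
have tpos j : 0 < q (tnth t j).
  rewrite mu_p; apply: ppos; have : tnth t j \in w by exact: mem_tnth.
  rewrite mem_cat mem_iota mem_nseq => /orP[/andP[_ /eqP ->]//|/andP[]//].
apply: (@lt_le_trans _ _ ((\prod_(j < l) q (tnth t j)) * (distinct k t)%:R)%:E).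
  by rewrite dt mulr1 lte_fin prodr_gt0.
apply: esum_ge; exists [set t]; first by split => //; exact: finite_set1.
by rewrite fsbig_set1.
Qed.

End TupleSums.

(** * Limits of the range and degree statistics *)

Section Consequences.
Context {R : realType} {d : measure_display} {T : measurableType d}.
Variable P : probability T R.
Variable xi : nat -> {RV P >-> nat}.
Hypothesis mean_range_unb : mean_range xi n @[n --> \oo] --> +oo.

Lemma path_rate_ratio U U' (v v' : R) : v' != 0 -> path_rate xi U v -> path_rate xi U' v' ->
  \forall w \ae P, (U (xi^~ w) n)%:R / (U' (xi^~ w) n)%:R @[n --> \oo] --> v / v'.
Proof. by move=> v0; apply: filterS2 => w; exact: ratio_of_ratios. Qed.

Lemma path_mean_ratio U (v : R) : v != 0 -> path_rate xi U v -> mean_rate xi U v ->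
  \forall w \ae P, (U (xi^~ w) n)%:R / fine (mean xi (U^~ n)) @[n --> \oo] --> (1 : R).
Proof.
move=> v0 Uv [e eE ev]; apply: filterS Uv => w Uv; under eq_fun do rewrite eE.
by have := ratio_of_ratios mean_range_unb v0 Uv ev; rewrite divff.
Qed.

Lemma mean_rate_eq_1o1 U (v G K : R) (V : nat -> R) : v != 0 -> G != 0 -> K = v * G ->
  V n @[n --> \oo] --> +oo -> mean_range xi n / V n @[n --> \oo] --> G ->
  mean_rate xi U v -> eq_1o1 (fun n => mean xi (U^~ n)) (fun n => K * V n).
Proof.
move=> v0 G0 -> Voo mV [e eE ev].
have vG : v * G != 0 by rewrite mulf_neq0.
have m0 : \forall n \near \oo, 0 < mean_range xi n by move/cvgryPgt : mean_range_unb; exact.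
have V0 : \forall n \near \oo, 0 < V n by move/cvgryPgt : Voo; exact.
have h : e n / V n @[n --> \oo] --> v * G.
  apply: cvg_trans (cvgM ev mV); apply: near_eq_cvg; apply: filterS m0 => n mn /=.
  by rewrite mulrA divfK// gt_eqF.
exists (fun n => e n / V n / (v * G) - 1).
  have h1 : e n / V n / (v * G) @[n --> \oo] --> (1 : R) by rewrite -(divff vG); exact: cvgMl.
  rewrite -[X in _ --> X](subrr (1 : R)); apply: cvgB h1 _; exact: cvg_cst.
apply: filterS V0 => n Vn; rewrite eE; congr (_%:E).
by rewrite addrC subrK; field; rewrite v0 G0 gt_eqF.
Qed.

End Consequences.

Section Assembly.
Context {R : realType} {d : measure_display} {T : measurableType d}.
Variables (P : probability T R) (p : nat -> R) (phi : R -> R) (g : R).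
Variable xi : nat -> {RV P >-> nat}.
Hypotheses (p_pmf : is_pmf p) (p_decr : standing_decreasing p) (phi_ext : is_extension p phi).
Hypotheses (g0 : 0 < g) (g1 : g < 1) (phi_nc : non_critical phi g) (xi_iid : iid p xi).

Let p0 : p 0%N = 0. Proof. by case: p_pmf. Qed.
Let mu_p := letter_law_prob xi_iid.

Lemma mean_range_diverges : mean_range xi n @[n --> \oo] --> +oo.
Proof. exact: mean_repeats_unb p_pmf p_decr phi_ext g0 g1 phi_nc mu_p. Qed.

Lemma mean_repeats_share m : (0 < m)%N ->
  mean_repeats (letter_law xi) n m / mean_range xi n @[n --> \oo] --> repeat_ratio g m.
Proof. exact: mean_repeats_ratio p_pmf p_decr phi_ext g0 g1 phi_nc mu_p _. Qed.

Lemma mean_range_phi_inv : mean_range xi n / phi_inv phi n%:R @[n --> \oo] --> Gamma (1 - g).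
Proof.
by have := @mean_repeats_phi_inv _ _ _ _ _ p_pmf p_decr phi_ext g0 g1 phi_nc mu_p 0%N; rewrite fact0 divr1.
Qed.

Lemma rlim_gt0 l : (0 < l)%N -> 0 < rlim g l.
Proof.
move=> l0; rewrite rlim_ratio//; apply: mulr_gt0; last exact: repeat_ratio_gt0.
by rewrite divr_gt0 ?ltr0n.
Qed.

Lemma repeat_ratio_decr m : (0 < m)%N -> repeat_ratio g m.+1 <= repeat_ratio g m.
Proof. by move=> m0; rewrite -subr_ge0 repeat_ratioB// ltW// rlim_gt0. Qed.

Lemma range_eq_rate l : (0 < l)%N ->
  path_rate xi (fun s n => range_eq s n l) (rlim g l) /\
  mean_rate xi (fun s n => range_eq s n l) (rlim g l).
Proof.
move=> l0; apply: (rate_path xi_iid p0 (range_eq_local l)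
    (F := fun w => repeats l w - repeats l.+1 w)%N).
  by move=> s n _; rewrite -range_eq_repeats// addnK.
rewrite -repeat_ratioB//.
have rr := rate_repeats xi_iid mean_range_diverges mean_repeats_share.
apply: (rateB _ (rr _ l0) (rr _ (ltn0Sn l))) => w; rewrite subnK//.
by apply: leq_sum => x _; case: (ltnP l) => // /ltnW ->.
Qed.

Lemma range_ge_rate l : (0 < l)%N ->
  path_rate xi (fun s n => range_ge s n l) (repeat_ratio g l).
Proof.
move=> l0; apply: (rate_path_near xi_iid p0 mean_range_diverges (F := repeats l)).
  by move=> s n _; rewrite range_ge_repeats// leq_addr.
exact: (rate_repeats xi_iid mean_range_diverges mean_repeats_share).
Qed.

Lemma range_size_rate : path_rate xi range_size 1 /\ mean_rate xi range_size 1.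
Proof.
apply: (rate_path xi_iid p0 range_size_local (F := repeats 1)).
  exact: range_size_repeats.
rewrite -(repeat_ratio1 g1).
exact: (rate_repeats xi_iid mean_range_diverges mean_repeats_share).
Qed.

Lemma out_range_visits_rate k l : (0 < l)%N ->
  path_rate xi (fun s n => out_range_visits s n k l) (Ssum p k l * rlim g l) /\
  mean_rate xi (fun s n => out_range_visits s n k l) (Ssum p k l * rlim g l).
Proof.
move=> l0; apply: (rate_path xi_iid p0 (out_range_visits_local k l)
    (F := exact_census l (distinct k \o successors))).
  by move=> s n; exact: out_range_visits_census.
rewrite (SsumE mu_p p0) -pair_mean_successors -repeat_ratioB//.
exact: (rate_exact_census xi_iid mean_range_diverges mean_repeats_share).
Qed.

Lemma full_census_rate (Phi : pred (seq (nat * nat))) (S : nat -> R) a : (0 < a)%N ->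
  (forall l, S l = pair_mean (letter_law xi) l Phi) -> (forall z, Phi z -> (a <= size z)%N) ->
  has_rate xi (full_census Phi) (fine (\sum_(a <= l <oo) (rlim g l * S l)%:E)%E).
Proof.
move=> a0 SE Phi_a; have -> : fine (\sum_(a <= l <oo) (rlim g l * S l)%:E)%E =
    fine (\sum_(a <= l <oo) (pair_mean (letter_law xi) l Phi *
       (repeat_ratio g l - repeat_ratio g l.+1))%:E)%E.
  congr (fine (limn _)); apply/funext => n; apply: eq_big_nat => l /andP[al _].
  by rewrite SE repeat_ratioB 1?mulrC// (leq_trans a0).
exact: (rate_full_census xi_iid mean_range_diverges mean_repeats_share
  repeat_ratio_decr (fun m m0 => ltW (repeat_ratio_gt0 g1 m0)) (repeat_ratio_cvg0 g0 g1)).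
Qed.

Lemma out_range_census_rate k : (0 < k)%N ->
  has_rate xi (full_census (distinct k \o successors)) (fsum p g k).
Proof.
move=> k0; apply: full_census_rate => // [l|z]; last exact: distinct_successors_size.
by rewrite (SsumE mu_p p0) pair_mean_successors.
Qed.

Lemma out_range_rate k : (0 < k)%N ->
  path_rate xi (fun s n => out_range s n k) (fsum p g k) /\
  mean_rate xi (fun s n => out_range s n k) (fsum p g k).
Proof.
move=> k0; apply: (rate_path xi_iid p0 (out_range_local k) _ (out_range_census_rate k0)).
by move=> s n; exact: out_range_census.
Qed.

Lemma deg_range_visits_rate k l : (0 < l)%N ->
  path_rate xi (fun s n => deg_range_visits s n k l) (Ssum p k l.*2 * rlim g l).
Proof.
move=> l0; apply: (rate_path_near xi_iid p0 mean_range_diverges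
    (F := exact_census l (distinct k \o both_sides))).
  by move=> s n; exact: deg_range_visits_census.
rewrite (SsumE mu_p p0) -pair_mean_both_sides -repeat_ratioB//.
exact: (rate_exact_census xi_iid mean_range_diverges mean_repeats_share).
Qed.

Lemma deg_range_rate k : (0 < k)%N ->
  path_rate xi (fun s n => deg_range s n k) (fhat p g k).
Proof.
move=> k0; apply: (rate_path_near xi_iid p0 mean_range_diverges
    (F := full_census (distinct k \o both_sides))).
  by move=> s n; exact: deg_range_census.
apply: (@full_census_rate _ (fun l => Ssum p k l.*2)) => [|l|z]; first by case: k k0.
  by rewrite (SsumE mu_p p0) pair_mean_both_sides.
exact: distinct_both_sides_size.
Qed.

Lemma Ssum_rlim_gt0 k l : (0 < k)%N -> (k <= l)%N -> 0 < Ssum p k l * rlim g l.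
Proof.
move=> k0 kl; rewrite mulr_gt0 ?rlim_gt0 ?(leq_trans k0)//.
by apply: (Ssum_gt0 mu_p p0 _ k0 kl) => x; exact: (pmf_gt0 p_decr).
Qed.

(** The states with exactly k visits already contribute a positive amount. *)
Lemma fsum_gt0 k : (0 < k)%N -> 0 < fsum p g k.
Proof.
move=> k0; apply: (lt_le_trans (Ssum_rlim_gt0 k0 (leqnn k))).
rewrite (SsumE mu_p p0) -pair_mean_successors -repeat_ratioB//.
have r1 := rate_exact_census xi_iid mean_range_diverges mean_repeats_share
  (distinct k \o successors) k0.
apply: (rate_le mean_range_diverges _ r1 (out_range_census_rate k0)) => w.
by apply: leq_sum => x _; case: (_ == _).
Qed.

End Assembly.

Theorem theorem3 (R : realType) (d : measure_display) (T : measurableType d)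
    (P : probability T R) (p : nat -> R) (phi : R -> R) (g : R)
    (xi : nat -> {RV P >-> nat})
    (p_pmf : is_pmf p) (p_decr : standing_decreasing p)
    (phi_ext : is_extension p phi)
    (g_gt0 : 0 < g) (g_lt1 : g < 1) (phi_nc : non_critical phi g)
    (xi_iid : iid p xi) :
  [/\
    [/\ forall l : nat, (1 <= l)%N ->
          \forall w \ae P,
            (range_eq (xi^~ w) n l)%:R / (range_size (xi^~ w) n)%:R
              @[n --> \oo] --> rlim g l,
        forall l : nat, (1 <= l)%N ->
          rlim g l = g * (\prod_(1 <= j < l) (j%:R - g)) / l`!%:R,
        exists2 h : nat -> R, h =O_\oo (fun l : nat => l%:R^-1 : R) &
          \forall l \near \oo,
            rlim g l = g / Gamma (1 - g) * l%:R `^ (- (1 + g)) * (1 + h l),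
        forall l : nat, (1 <= l)%N ->
          \forall w \ae P,
            (range_eq (xi^~ w) n l)%:R / (range_ge (xi^~ w) n l)%:R
              @[n --> \oo] --> g / l%:R &
        [/\ forall l : nat, (1 <= l)%N ->
              \forall w \ae P,
                (range_eq (xi^~ w) n l)%:R
                  / fine (mean xi (fun s => range_eq s n l))
                  @[n --> \oo] --> (1 : R),
            eq_1o1 (fun n => mean xi (fun s => range_size s n))
                   (fun n => Gamma (1 - g) * phi_inv phi n%:R) &
            forall l : nat, (1 <= l)%N ->
              eq_1o1 (fun n => mean xi (fun s => range_eq s n l))
                     (fun n => g * Gamma (l%:R - g) / l`!%:R
                               * phi_inv phi n%:R)]],
    forall k l : nat, (1 <= k)%N -> (k <= l)%N ->
      [/\ \forall w \ae P,
            (out_range_visits (xi^~ w) n k l)%:R / (range_eq (xi^~ w) n l)%:R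
              @[n --> \oo] --> Ssum p k l,
          \forall w \ae P,
            (out_range (xi^~ w) n k)%:R / (range_size (xi^~ w) n)%:R
              @[n --> \oo] --> fsum p g k,
          \forall w \ae P,
            (out_range_visits (xi^~ w) n k l)%:R
              / fine (mean xi (fun s => out_range_visits s n k l))
              @[n --> \oo] --> (1 : R),
          \forall w \ae P,
            (out_range (xi^~ w) n k)%:R
              / fine (mean xi (fun s => out_range s n k))
              @[n --> \oo] --> (1 : R) &
          eq_1o1 (fun n => mean xi (fun s => out_range_visits s n k l))
                 (fun n => Ssum p k l * (g * Gamma (l%:R - g) / l`!%:R)
                           * phi_inv phi n%:R) /\
          eq_1o1 (fun n => mean xi (fun s => out_range s n k))
                 (fun n => fsum p g k * Gamma (1 - g) * phi_inv phi n%:R)] &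
    forall k l : nat, (1 <= k)%N -> (k <= l.*2)%N ->
      (\forall w \ae P,
         (deg_range_visits (xi^~ w) n k l)%:R / (range_eq (xi^~ w) n l)%:R
           @[n --> \oo] --> Ssum p k l.*2) /\
      (\forall w \ae P,
         (deg_range (xi^~ w) n k)%:R / (range_size (xi^~ w) n)%:R
           @[n --> \oo] --> fhat p g k)].
Proof.
have moo := mean_range_diverges p_pmf p_decr phi_ext g_gt0 g_lt1 phi_nc xi_iid.
have Voo := phi_inv_unb p_pmf p_decr phi_ext.
have mV := mean_range_phi_inv p_pmf p_decr phi_ext g_gt0 g_lt1 phi_nc xi_iid.
have Gne : Gamma (1 - g) != 0 by rewrite gt_eqF// Gamma_gt0// subr_gt0.
have rl0 l : (0 < l)%N -> rlim g l != 0 by move=> l0; rewrite gt_eqF// rlim_gt0.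
have Hs := range_size_rate p_pmf p_decr phi_ext g_gt0 g_lt1 phi_nc xi_iid.
have He l := range_eq_rate p_pmf p_decr phi_ext g_gt0 g_lt1 phi_nc xi_iid (l := l).
have Hg l := range_ge_rate p_pmf p_decr phi_ext g_gt0 g_lt1 phi_nc xi_iid (l := l).
have Hov k l := out_range_visits_rate p_pmf p_decr phi_ext g_gt0 g_lt1 phi_nc xi_iid k (l := l).
have Ho k := out_range_rate p_pmf p_decr phi_ext g_gt0 g_lt1 phi_nc xi_iid (k := k).
have rG l : (0 < l)%N -> rlim g l * Gamma (1 - g) = g * Gamma (l%:R - g) / l`!%:R.
  by move=> l0; rewrite /rlim invfM mulrA divfK.
have one_ne0 : (1 : R) != 0 by exact: oner_neq0.
split.
- split.
  + by move=> l l0; have := path_rate_ratio moo one_ne0 (He l l0).1 Hs.1; rewrite divr1.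
  + by move=> l l0; exact: rlimE.
  + exact: rlim_asymptotic.
  + move=> l l0; have cl : repeat_ratio g l != 0 by rewrite gt_eqF// repeat_ratio_gt0.
    by have := path_rate_ratio moo cl (He l l0).1 (Hg l l0); rewrite rlim_ratio// mulfK.
  + split.
    * by move=> l l0; have [h1 h2] := He l l0; exact: path_mean_ratio (rl0 l l0) h1 h2.
    * by apply: (mean_rate_eq_1o1 moo one_ne0 Gne _ Voo mV Hs.2); rewrite mul1r.
    * move=> l l0; apply: (mean_rate_eq_1o1 moo (rl0 l l0) Gne _ Voo mV (He l l0).2).
      by rewrite rG.
- move=> k l k1 kl; have l0 : (0 < l)%N by exact: leq_trans kl.
  have v0 : Ssum p k l * rlim g l != 0 by rewrite gt_eqF// (Ssum_rlim_gt0 p_pmf p_decr g_gt0 g_lt1 xi_iid).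
  have f0 : fsum p g k != 0 by rewrite gt_eqF// (fsum_gt0 p_pmf p_decr phi_ext g_gt0 g_lt1 phi_nc xi_iid).
  have [h1 h2] := Hov k l l0; have [h3 h4] := Ho k k1.
  split.
  + by have := path_rate_ratio moo (rl0 l l0) h1 (He l l0).1; rewrite mulfK// rl0.
  + by have := path_rate_ratio moo one_ne0 h3 Hs.1; rewrite divr1.
  + exact: path_mean_ratio v0 h1 h2.
  + exact: path_mean_ratio f0 h3 h4.
  + split; last by apply: (mean_rate_eq_1o1 moo f0 Gne _ Voo mV h4).
    by apply: (mean_rate_eq_1o1 moo v0 Gne _ Voo mV h2); rewrite -(mulrA (Ssum p k l)) rG.
- move=> k l k1 kl; have l0 : (0 < l)%N by case: l kl => //; case: k k1.
  split.
  + have h := deg_range_visits_rate p_pmf p_decr phi_ext g_gt0 g_lt1 phi_nc xi_iid k l0.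
    by have := path_rate_ratio moo (rl0 l l0) h (He l l0).1; rewrite mulfK// rl0.
  + have h := deg_range_rate p_pmf p_decr phi_ext g_gt0 g_lt1 phi_nc xi_iid k1.
    by have := path_rate_ratio moo one_ne0 h Hs.1; rewrite divr1.
Qed.
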